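(* Let $k_1\ge l_1\ge 0$ and $k_2\ge l_2\ge 0$ be integers. Let $\Lambda_{k_1,l_1,k_2,l_2}=1/L_{k_1,l_1,k_2,l_2}$ be the reciprocal of the minimal deviation on the unit ball of $\mathbb{C}^2$ of the monomial $z_1^{k_1}\bar z_1^{l_1}z_2^{k_2}\bar z_2^{l_2}$, and let $C_n(\alpha,\beta)$ be the constant attached to the domain $\Omega_n(\alpha,\beta)$. Then $$\ln \Lambda_{k_1,l_1,k_2,l_2} = C_{l_1+l_2}\left(\frac{k_1-l_1}{2},\frac{k_2-l_2}{2}\right).$$
   Context: Minimal deviation. Let $\mathbb{B}=\{(z_1,z_2)\in\mathbb{C}^2: |z_1|^2+|z_2|^2\le 1\}$ and $\|P\|=\sup_{(z_1,z_2)\in\mathbb{B}}|P(z_1,z_2)|$. Polynomials here are (non analytic) polynomials in $z_1,\bar z_1,z_2,\bar z_2$ with complex coefficients, i.e. complex linear combinations of monomials $z_1^{a}\bar z_1^{b}z_2^{c}\bar z_2^{d}$ ($a,b,c,d\ge 0$ integers), the total degree of such a monomial being $a+b+c+d$. $\Pi_m$ is the set of such polynomials of total degree at most $m$. For $N=k_1+l_1+k_2+l_2$, $$L_{k_1,l_1,k_2,l_2}:=\inf_{P\in \Pi_{N-1}}\|z_1^{k_1}\bar z_1^{l_1}z_2^{k_2}\bar z_2^{l_2}-P(z_1,z_2)\|.$$ The constant $C_n(\alpha,\beta)$. For nonnegative real numbers $\alpha,\beta$ and an integer $n\ge 0$, let $$\Omega_n(\alpha,\beta) = \{ w = u+iv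 : - \beta < \tfrac v \pi < \alpha + n \}\setminus \bigcup_{j=0}^{n} \{ w = u+iv : \tfrac v\pi= j,\ u \le 0 \}.$$ The boundary of the domain contains $n+3$ infinite points: $\infty_0=-\infty+iv$, $n<\frac v\pi<n+\alpha$; $\infty_j=-\infty+iv$, $n-j<\frac v\pi<n-j+1$ ($1\le j\le n$); $\infty_{n+1}=-\infty+iv$, $-\beta<\frac v\pi<0$; $\infty_{n+2}=+\infty+iv$, $-\beta<\frac v\pi<\alpha+n$. Let $w=w_n(\cdot\,;\alpha,\beta)$ be the conformal mapping of the upper half-plane $\mathbb{C}_+$ onto $\Omega_n(\alpha,\beta)$ with the normalization $w(0)=\infty_0$, $w(1)=\infty_{n+1}$, $w(\infty)=\infty_{n+2}$. The real constant $C_n(\alpha,\beta)$ is uniquely defined by the domain through the asymptotics $$w_n(z;\alpha,\beta)=(\alpha+\beta+n)\ln z+C_n(\alpha,\beta)-\beta\pi i+ O(1/z),\qquad z\to\infty.$$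
   Formalization: If k_1=l_1 (α=0) or k_2=l_2 (β=0) the infinite point ∞_0 or ∞_{n+1} is undefined; the normalization is then read as its limit, w(0)=inπ resp. w(1)=0, and C_0(0,0), whose domain is empty, is set to 0. *)

(* Defs.v *)
From HB Require Import structures.
From mathcomp Require Import all_boot all_order all_algebra.
From mathcomp Require Import complex.
From mathcomp Require Import all_classical all_reals all_analysis.

Set Implicit Arguments.
Unset Strict Implicit.
Unset Printing Implicit Defensive.

Import Order.TTheory GRing.Theory Num.Theory.
Import numFieldNormedType.Exports.

Local Open Scope classical_set_scope.
Local Open Scope ring_scope.
Local Open Scope complex_scope.

Definition cmod (R : realType) (z : R[i]) : R := Normc.normc z.

Section MinimalDeviation.
Variable R : realType.
Local Notation C := R[i].

Definition complex_ball : set (C * C) :=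
  [set z | cmod z.1 ^+ 2 + cmod z.2 ^+ 2 <= 1].

Definition ball_norm (F : C -> C -> C) : R :=
  sup [set cmod (F z.1 z.2) | z in complex_ball].

Definition monomial4 (a b c d : nat) (z1 z2 : C) : C :=
  z1 ^+ a * conjc z1 ^+ b * z2 ^+ c * conjc z2 ^+ d.

(* A term (x, (a, b, c, d)) of the list s stands for
   x * z1^a * (conj z1)^b * z2^c * (conj z2)^d.  The bound m is an integer so
   that Pi_poly (-1) contains only the zero polynomial. *)
Definition Pi_poly (m : int) : set (C -> C -> C) :=
  [set P | exists s : seq (C * (nat * nat * nat * nat)),
     (forall x a b c d, (x, (a, b, c, d)) \in s ->
        ((a + b + c + d)%N%:Z <= m)%R) /\
     (forall z1 z2, P z1 z2 =
        \sum_(t <- s) let: (x, (a, b, c, d)) := t in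
                      x * monomial4 a b c d z1 z2)].

Definition min_deviation (k1 l1 k2 l2 : nat) : R :=
  inf [set ball_norm (fun z1 z2 => monomial4 k1 l1 k2 l2 z1 z2 - P z1 z2)
      | P in Pi_poly ((k1 + l1 + k2 + l2)%N%:Z - 1)].

Definition Lambda (k1 l1 k2 l2 : nat) : R := (min_deviation k1 l1 k2 l2)^-1.

End MinimalDeviation.

Section ConformalConstant.
Variable R : realType.
Local Notation C := R[i].

Definition upper_half_plane : set C := [set z | 0 < complex.Im z].

Definition uhp_at (x : R) : set_system C :=
  within upper_half_plane (nbhs (x%:C : C^o)).

Definition uhp_infty : set_system C :=
  filter_from setT (fun r : R => upper_half_plane `&` [set z | r < cmod z]).

(* The principal branch; the formula with acos is valid when Im z >= 0. *)
Definition uhp_log (z : C) : C :=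
  ln (cmod z) +i* acos (complex.Re z / cmod z).

Definition Omega (n : nat) (alpha beta : R) : set C :=
  [set w | - beta < complex.Im w / pi < alpha + n%:R] `\`
  \bigcup_(j in `I_n.+1)
    [set w | complex.Im w / pi = j%:R /\ complex.Re w <= 0].

Definition conformal_map (D E : set C) (w : C -> C) : Prop :=
  (forall z, D z -> @derivable C C^o C^o w z 1) /\ set_bij D E w.

(* Convergence along F to the infinite boundary point -oo + iv,
   a < v / pi < b, lying between two cuts (or a cut and the boundary line). *)
Definition tends_to_left_end (F : set_system C) (w : C -> C) (a b : R) : Prop :=
  complex.Re (w z) @[z --> F] --> -oo /\
  \forall z \near F, a < complex.Im (w z) / pi < b.

(* When alpha = 0 the strip n < v / pi < n + alpha is empty: as alpha -> 0 the
   point infty_0 collapses, together with the whole n-th cut, which becomes a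
   part of the boundary line v = n * pi, to the tip i * n * pi of this cut.
   The normalization w(0) = infty_0 then reads w(0) = i * n * pi.  Likewise,
   w(1) = infty_{n+1} reads w(1) = 0 when beta = 0. *)
Definition normalized_map (n : nat) (alpha beta : R) (w : C -> C) : Prop :=
  [/\ conformal_map upper_half_plane (Omega n alpha beta) w,
      if alpha == 0
      then w z @[z --> uhp_at 0] --> (0 +i* (n%:R * pi) : C^o)
      else tends_to_left_end (uhp_at 0) w n%:R (n%:R + alpha),
      if beta == 0
      then w z @[z --> uhp_at 1] --> (0 : C^o)
      else tends_to_left_end (uhp_at 1) w (- beta) 0 &
      complex.Re (w z) @[z --> uhp_infty] --> +oo].

Definition asymptotic_const (n : nat) (alpha beta : R) (w : C -> C) (c : R) :
    Prop :=
  exists K : R, \forall z \near uhp_infty,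
    cmod (w z - ((alpha + beta + n%:R)%:C * uhp_log z
                 + (c +i* (- (beta * pi))))) <= K / cmod z.

(* Omega 0 0 0 is empty; the value 0 in this case is the limit of
   C_0(alpha, beta) as alpha, beta -> 0. *)
Definition conf_const (n : nat) (alpha beta : R) : R :=
  if [&& n == 0%N, alpha == 0 & beta == 0] then 0
  else xget 0 [set c | exists w : C -> C,
                 normalized_map n alpha beta w /\
                 asymptotic_const n alpha beta w c].

End ConformalConstant.

(* Main.v *)
(* The sphere problem. Averaging over the torus and restricting to the sphere turns the
   minimal deviation into that of monic polynomials of degree n = l1 + l2 on [0, 1] for
   the weight x^alpha (1 - x)^beta, so it is at least the norm E of the extremal
   weighted polynomial F(x) = x^alpha (1 - x)^beta prod (x - x_j). By minimality, |F|
   attains E in each of the n + 1 gaps between the zeros (otherwise move apart the two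
   zeros at a gap), and divided differences at these points (the "tips") show that E is
   a lower bound. It is attained on the ball by z1^p z2^q times
   prod_(j <= l1) (|z1|^2 - x_j) prod_(j > l1) (|z2|^2 - (1 - x_j)).

   The conformal map. The function
   w(z) = alpha log z + beta log (z - 1) + sum log (z - x_j) - ln E - i beta pi is an
   explicit normalized map onto Omega: on (0, 1) it is a branch of log (F / E), and the
   tips of the cuts are the images of the points where |F| = E. Injectivity and the
   location of the image come from Im ((w a - w b) conj (a - b)) < 0, surjectivity from
   following the level curves of Im w. Hence C_n = - ln E.

   Uniqueness. For another normalized map g, p = w^-1 o g is a self-bijection of the
   half-plane with p(z) = la z + O(1) at infinity, and Im (p - la z) vanishes at the
   boundary, so it vanishes identically by the maximum principle; thus p is affine, and
   the normalization at 0 and 1 makes it the identity. *)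

Require Import Defs.
From HB Require Import structures.
From mathcomp Require Import all_boot all_order all_algebra.
From mathcomp Require Import complex.
From mathcomp Require Import all_classical all_reals all_analysis.
From mathcomp Require Import ring lra zify.

Set Implicit Arguments.
Unset Strict Implicit.
Unset Printing Implicit Defensive.

Import Order.TTheory GRing.Theory Num.Theory.
Import numFieldNormedType.Exports.

Local Open Scope classical_set_scope.
Local Open Scope ring_scope.
Local Open Scope complex_scope.

(** The two sides of the theorem meet only in a certificate, produced by [extremal_zeros]: zeros in
    (0, 1), a bound |F| <= E, and n + 1 points with |F| = E separating the zeros. Each constant is
    then computed from these data alone. The exponents are halves of integers because s = |z1|^2
    turns |z1|^p into s^(p/2).

    The inequality Im ((w a - w b) conj (a - b)) < 0 comes from w' being a positive combination of
    functions 1 / (z - t), whose imaginary part is negative on the half-plane. It survives for b on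
    the real axis. Taking b to be a tip shows that no point is sent into the cut, and on which side
    of the tip the points above or below the cut originate.

    A competing map g is given only inside the half-plane, so its boundary behaviour has to be
    extracted from interior estimates: continuity of inverses from the maximum modulus principle,
    and smallness of Im p near the axis from compactness.

    If p = 0, then |F| decreases from 0 to the first zero, so the endpoint 0 itself attains E;
    symmetrically at 1 if q = 0. This is what the degenerate normalizations require. *)

Local Notation Re := complex.Re.
Local Notation Im := complex.Im.
Local Notation Log := (@uhp_log _).

(** * Complex modulus and derivative *)

Section ComplexModulus.
Variable R : realType.
Local Notation C := R[i].
Implicit Types (z w : C) (x y : R).

Lemma complex_ext z w : Re z = Re w -> Im z = Im w -> z = w.
Proof. by case: z w => [a b] [c d] /= -> ->. Qed.

Lemma ReD z w : Re (z + w) = Re z + Re w. Proof. by case: z w => ? ? []. Qed.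
Lemma ImD z w : Im (z + w) = Im z + Im w. Proof. by case: z w => ? ? []. Qed.
Lemma ReN z : Re (- z) = - Re z. Proof. by case: z. Qed.
Lemma ImN z : Im (- z) = - Im z. Proof. by case: z. Qed.
Lemma ReB z w : Re (z - w) = Re z - Re w. Proof. by rewrite ReD ReN. Qed.
Lemma ImB z w : Im (z - w) = Im z - Im w. Proof. by rewrite ImD ImN. Qed.
Lemma ReM z w : Re (z * w) = Re z * Re w - Im z * Im w.
Proof. by case: z w => ? ? []. Qed.
Lemma ImM z w : Im (z * w) = Re z * Im w + Im z * Re w.
Proof. by case: z w => ? ? []. Qed.
Lemma Re_conj z : Re (conjc z) = Re z. Proof. by case: z. Qed.
Lemma Im_conj z : Im (conjc z) = - Im z. Proof. by case: z. Qed.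
Lemma Re_real x : Re x%:C = x. Proof. by []. Qed.
Lemma Im_real x : Im x%:C = 0. Proof. by []. Qed.
Lemma ReE x y : Re (x +i* y) = x. Proof. by []. Qed.
Lemma ImE x y : Im (x +i* y) = y. Proof. by []. Qed.
Lemma ReX1 : Re (1 : C) = 1. Proof. by []. Qed.
Lemma ImX1 : Im (1 : C) = 0. Proof. by []. Qed.
Definition ReImE := (ReE, ImE, ReX1, ImX1, ReD, ImD, ReN, ImN, ReM, ImM, Re_conj, Im_conj, Re_real, Im_real).

Lemma cmodE z : cmod z = Num.sqrt (Re z ^+ 2 + Im z ^+ 2).
Proof. by case: z. Qed.

Lemma cmod_ge0 z : 0 <= cmod z. Proof. by rewrite cmodE sqrtr_ge0. Qed.

Lemma sqr_cmod z : cmod z ^+ 2 = Re z ^+ 2 + Im z ^+ 2.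
Proof. by rewrite cmodE sqr_sqrtr // addr_ge0 // sqr_ge0. Qed.

Lemma cmodM z w : cmod (z * w) = cmod z * cmod w.
Proof. exact: Normc.normcM. Qed.

Lemma cmodV z : cmod z^-1 = (cmod z)^-1.
Proof. exact: Normc.normcV. Qed.

Lemma cmod_div z w : cmod (z / w) = cmod z / cmod w.
Proof. by rewrite cmodM cmodV. Qed.

Lemma cmodD z w : cmod (z + w) <= cmod z + cmod w.
Proof. exact: le_normcD. Qed.

Lemma cmodN z : cmod (- z) = cmod z.
Proof. exact: normcN. Qed.

Lemma cmodC z w : cmod (z - w) = cmod (w - z).
Proof. by rewrite -cmodN opprB. Qed.

Lemma cmodB z w : cmod (z - w) <= cmod z + cmod w.
Proof. by rewrite -(cmodN w); exact: cmodD. Qed.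

Lemma lerB_cmod z w : cmod z - cmod w <= cmod (z - w).
Proof. by rewrite lerBlDr -[leLHS](congr1 (@cmod R) (subrK w z)); exact: cmodD. Qed.

Lemma cmod0 : cmod (0 : C) = 0.
Proof. exact: Normc.normc0. Qed.

Lemma cmod1 : cmod (1 : C) = 1.
Proof. exact: Normc.normc1. Qed.

Lemma cmod_eq0 z : (cmod z == 0) = (z == 0).
Proof.
by apply/eqP/eqP => [/Normc.eq0_normc //|->]; exact: cmod0.
Qed.

Lemma cmod_gt0 z : (0 < cmod z) = (z != 0).
Proof. by rewrite lt_def cmod_eq0 cmod_ge0 andbT. Qed.

Lemma cmod_real x : cmod x%:C = `|x|.
Proof. by rewrite cmodE /= expr0n addr0 sqrtr_sqr. Qed.

Lemma cmod_conj z : cmod (conjc z) = cmod z.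
Proof. by rewrite !cmodE Re_conj Im_conj sqrrN. Qed.

Lemma cmodX z n : cmod (z ^+ n) = cmod z ^+ n.
Proof.
by elim: n => [|n IH]; rewrite ?expr0 ?cmod1 // !exprS cmodM IH.
Qed.

Lemma mul_conjc z : z * conjc z = (cmod z ^+ 2)%:C.
Proof. by apply: complex_ext; rewrite !ReImE ?sqr_cmod; ring. Qed.

Lemma Re_le_cmod z : `|Re z| <= cmod z.
Proof.
rewrite cmodE -sqrtr_sqr ler_sqrt ?addr_ge0 ?sqr_ge0 //.
by rewrite lerDl sqr_ge0.
Qed.

Lemma Im_le_cmod z : `|Im z| <= cmod z.
Proof.
rewrite cmodE -sqrtr_sqr ler_sqrt ?addr_ge0 ?sqr_ge0 //.
by rewrite lerDr sqr_ge0.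
Qed.

Lemma cmod_le_ReIm z : cmod z <= `|Re z| + `|Im z|.
Proof.
rewrite -(ler_pXn2r (_ : 0 < 2)%N) ?nnegrE ?addr_ge0 ?cmod_ge0 //.
rewrite sqr_cmod -(real_normK (num_real (Re z))) -(real_normK (num_real (Im z))).
by rewrite sqrrD lerD2r lerDl mulrn_wge0 // mulr_ge0.
Qed.

End ComplexModulus.

(** * Complex differentiability with real error bounds *)

Section ComplexDerivative.
Variable R : realType.
Local Notation C := R[i].
Implicit Types (f g : C -> C) (z w l : C).

(** The product form of the derivative has no exceptional increment h = 0, so the chain rule needs
    no case distinction, and all bounds stay in the real field. *)
Definition cdiff f z l : Prop := forall e : R, 0 < e ->
  exists2 d : R, 0 < d & forall h : C, cmod h < d ->
    cmod (f (z + h) - f z - l * h) <= e * cmod h.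

Definition ccont f z : Prop := forall e : R, 0 < e ->
  exists2 d : R, 0 < d & forall h : C, cmod h < d -> cmod (f (z + h) - f z) < e.

Lemma cdiff_local f g z l (r : R) : 0 < r ->
  (forall w, cmod (w - z) < r -> f w = g w) -> cdiff f z l -> cdiff g z l.
Proof.
move=> r0 fg df e e0; have [d d0 hd] := df e e0.
exists (Num.min d r) => [|h]; first by rewrite lt_min d0.
rewrite lt_min => /andP[hd1 hr].
rewrite -!fg ?subrr ?cmod0 //; first exact: hd.
by rewrite [z + h]addrC addrK.
Qed.

Lemma cdiff_cont f z l : cdiff f z l -> ccont f z.
Proof.
move=> df e e0; have [d d0 hd] := df 1 ltr01.
have L0 : 0 < 1 + cmod l by have := cmod_ge0 l; lra.
exists (Num.min d (e / (1 + cmod l))) => [|h]; first by rewrite lt_min d0 divr_gt0.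
rewrite lt_min ltr_pdivlMr // => /andP[/hd H1 H2].
have -> : f (z + h) - f z = (f (z + h) - f z - l * h) + l * h by ring.
apply: le_lt_trans (cmodD _ _) _; rewrite cmodM.
by move: H1 H2; rewrite mul1r; lra.
Qed.

Lemma cdiff_cst a z : cdiff (fun=> a) z 0.
Proof.
move=> e e0; exists 1 => // h _.
by rewrite /= subrr mul0r subr0 cmod0 mulr_ge0 ?cmod_ge0 ?ltW.
Qed.

Lemma cdiff_id z : cdiff (fun w => w) z 1.
Proof.
move=> e e0; exists 1 => // h _.
rewrite (_ : z + h - z - 1 * h = 0) ?cmod0; last by ring.
by rewrite mulr_ge0 ?cmod_ge0 ?ltW.
Qed.

Lemma cdiffD f g z l m : cdiff f z l -> cdiff g z m ->
  cdiff (fun w => f w + g w) z (l + m).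
Proof.
move=> df dg e e0; have e2 : 0 < e / 2 by lra.
have [d d0 hd] := df _ e2; have [d' d'0 hd'] := dg _ e2.
exists (Num.min d d') => [|h]; first by rewrite lt_min d0.
rewrite lt_min => /andP[/hd H1 /hd' H2].
have -> : f (z + h) + g (z + h) - (f z + g z) - (l + m) * h =
  (f (z + h) - f z - l * h) + (g (z + h) - g z - m * h) by ring.
by apply: le_trans (cmodD _ _) _; lra.
Qed.

Lemma cdiff_sum (I : Type) (r : seq I) (F : I -> C -> C) z (l : I -> C) :
  (forall i, cdiff (F i) z (l i)) ->
  cdiff (fun w => \sum_(i <- r) F i w) z (\sum_(i <- r) l i).
Proof.
move=> dF; elim: r => [|i r IH].
  rewrite big_nil; apply: (cdiff_local (r := 1)) (cdiff_cst 0 z) => // w _.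
  by rewrite big_nil.
rewrite big_cons; apply: (cdiff_local (r := 1)) (cdiffD (dF i) IH) => // w _.
by rewrite big_cons.
Qed.

Lemma cdiff_mul f a z l : cdiff f z l -> cdiff (fun w => a * f w) z (a * l).
Proof.
move=> df e e0; have A0 : 0 < 1 + cmod a by have := cmod_ge0 a; lra.
have [d d0 hd] := df _ (divr_gt0 e0 A0).
exists d => // h /hd H.
have -> : a * f (z + h) - a * f z - a * l * h = a * (f (z + h) - f z - l * h) by ring.
rewrite cmodM; apply: le_trans (ler_wpM2l (cmod_ge0 _) H) _.
rewrite mulrA ler_wpM2r ?cmod_ge0 // mulrCA ger_pMr // ler_pdivrMr //; lra.
Qed.

Lemma cdiff_comp f g z l m : cdiff f z l -> cdiff g (f z) m ->
  cdiff (fun w => g (f w)) z (m * l).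
Proof.
move=> df dg e e0.
have L0 : 0 < 1 + cmod l by have := cmod_ge0 l; lra.
have M0 : 0 < 1 + cmod m by have := cmod_ge0 m; lra.
have [d d0 hd] := dg _ (divr_gt0 e0 (mulr_gt0 (ltr0n _ 2) L0)).
have [d' d'0 hd'] := cdiff_cont df d0.
(* The bound 1 makes the increment of f at most (1 + |l|) |h|; the other bound keeps the error of f,
   multiplied by m, below half of e |h|. *)
pose e1 := Num.min 1 (e / (2 * (1 + cmod m))).
have e10 : 0 < e1 by rewrite lt_min ltr01 divr_gt0 // mulr_gt0.
have [d2 d20 hd2] := df _ e10.
exists (Num.min d' d2) => [|h]; first by rewrite lt_min d'0.
rewrite lt_min => /andP[/hd' H1 /hd2 H2].
have := hd _ H1; rewrite [f z + _]addrC subrK => H3.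
have -> : g (f (z + h)) - g (f z) - m * l * h =
  (g (f (z + h)) - g (f z) - m * (f (z + h) - f z)) +
  m * (f (z + h) - f z - l * h) by ring.
apply: le_trans (cmodD _ _) _.
have H4 : cmod (f (z + h) - f z) <= (1 + cmod l) * cmod h.
  have -> : f (z + h) - f z = (f (z + h) - f z - l * h) + l * h by ring.
  apply: le_trans (cmodD _ _) _; rewrite cmodM mulrDl lerD2r.
  by apply: le_trans H2 _; rewrite ler_wpM2r ?cmod_ge0 // ge_min lexx.
have -> : e * cmod h = e / (2 * (1 + cmod l)) * ((1 + cmod l) * cmod h) +
   (1 + cmod m) * (e / (2 * (1 + cmod m)) * cmod h).
  by field; rewrite !gt_eqF.
apply: lerD; first by apply: le_trans H3 _; rewrite ler_wpM2l // ltW // divr_gt0 // mulr_gt0.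
rewrite cmodM; apply: ler_pM; rewrite ?cmod_ge0 //; first lra.
apply: le_trans H2 _; rewrite ler_wpM2r ?cmod_ge0 // ge_min lexx orbT //.
Qed.

Lemma cdiff_inv z : z != 0 -> cdiff (fun w => w^-1) z (- z ^- 2).
Proof.
move=> z0 e e0; have Z0 : 0 < cmod z by rewrite cmod_gt0.
have Z3 : 0 < cmod z ^+ 3 by rewrite exprn_gt0.
(* The error is h^2 / (z^2 (z + h)): the first radius gives |z + h| > |z| / 2, and the second then
   bounds it by e |h|. *)
exists (Num.min (cmod z / 2) (e * cmod z ^+ 3 / 2)) => [|h].
  by rewrite lt_min !divr_gt0 // mulr_gt0.
rewrite lt_min => /andP[H1 H2].
have zh : cmod z / 2 < cmod (z + h).
  have := lerB_cmod z (- h); rewrite opprK cmodN; lra.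
have zh0 : z + h != 0 by rewrite -cmod_gt0; lra.
have -> : (z + h)^-1 - z^-1 - - z ^- 2 * h = h ^+ 2 / (z ^+ 2 * (z + h)).
  by field; rewrite z0 zh0.
rewrite cmod_div cmodM !cmodX expr2 -mulrA mulrC ler_wpM2r ?cmod_ge0 //.
rewrite ler_pdivrMr; last by rewrite mulr_gt0 ?exprn_gt0 // cmod_gt0.
apply: le_trans (_ : e * cmod z ^+ 3 / 2 <= _); first exact: ltW.
rewrite -mulrA ler_pM2l // exprSr -mulrA ler_pM2l ?exprn_gt0 //; exact: ltW.
Qed.

End ComplexDerivative.

(** * Filters, limits and derivatives expressed by real moduli *)

Section ComplexBridge.
Variable R : realType.
Local Notation C := R[i].

Lemma norm_cmod (z : C) : `|z| = (cmod z)%:C.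
Proof. by rewrite cmodE normc_def. Qed.

Lemma complex_gt0 (e : C) : 0 < e -> e = (Re e)%:C /\ 0 < Re e.
Proof. by case: e => a b; rewrite ltcE /= => /andP[/eqP -> ->]. Qed.

(** Balls of [C^o] have complex radii, but a positive complex number is a positive real. *)
Lemma nbhs_complexP (z : C) (A : set C) :
  nbhs (z : C^o) A <-> exists2 r : R, 0 < r & forall w, cmod (w - z) < r -> A w.
Proof.
split.
  move/nbhs_ballP => [e /= /complex_gt0[-> e0] H]; exists (Re e) => // w wz.
  by apply: H; rewrite -ball_normE /= norm_cmod cmodC ltcR.
move=> [r r0 H]; apply/nbhs_ballP; exists r%:C; first by rewrite /= ltcR.
by move=> w; rewrite -ball_normE /= norm_cmod cmodC ltcR => /H.
Qed.

Lemma cvg_complexP (T : Type) (F : set_system T) (f : T -> C) (l : C) :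
  Filter F ->
  (f z @[z --> F] --> (l : C^o)) <->
  (forall e : R, 0 < e -> \forall z \near F, cmod (f z - l) < e).
Proof.
move=> FF; split.
  move=> H e e0; have /H : nbhs (l : C^o) [set w | cmod (w - l) < e].
    by apply/nbhs_complexP; exists e.
  by [].
move=> H A /nbhs_complexP[r r0 hA]; apply: filterS (H r r0) => z; exact: hA.
Qed.

Lemma derivable_cdiff (f : C -> C) (z : C) :
  @derivable C C^o C^o f z 1 <-> exists l, cdiff f z l.
Proof.
split.
  move=> df; pose l := lim ((fun h : C^o => h^-1 *: ((f (h *: 1 + z) - f z) : C^o)) @ 0^').
  exists l => e e0.
  have : (fun h : C^o => h^-1 *: ((f (h *: 1 + z) - f z) : C^o)) @ 0^' --> (l : C^o) by [].
  move=> /cvg_complexP /(_ e e0).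
  rewrite /= -nbhs_nearE => /nbhs_complexP[r r0 H].
  exists r => // h hr; have [->|h0] := eqVneq h 0.
    by rewrite addr0 mulr0 subrr subrr cmod0 mulr0.
  have := H h; rewrite subr0 => /(_ hr h0); rewrite /GRing.scale /= mulr1 => H1.
  have -> : f (z + h) - f z - l * h = h * (h^-1 * (f (h + z) - f z) - l).
    by rewrite [h + z]addrC; field.
  by rewrite cmodM mulrC ler_wpM2r ?cmod_ge0 ?ltW.
move=> [l df]; apply/cvg_ex; exists l; apply/cvg_complexP => e e0.
rewrite /= -nbhs_nearE; apply/nbhs_complexP.
have e2 : 0 < e / 2 by lra.
have [d d0 hd] := df _ e2; exists d => // h; rewrite subr0 => /hd H h0.
rewrite /GRing.scale /= mulr1.
have -> : h^-1 * (f (h + z) - f z) - l = h^-1 * (f (z + h) - f z - l * h).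
  by rewrite [h + z]addrC; field.
have hp : 0 < cmod h by rewrite cmod_gt0.
rewrite cmodM cmodV mulrC ltr_pdivrMr //; apply: le_lt_trans H _.
by rewrite ltr_pM2r //; lra.
Qed.

Lemma near_uhp_at (x : R) (P : set C) :
  (\forall z \near uhp_at x, P z) <->
  exists2 r : R, 0 < r & forall z, 0 < Im z -> cmod (z - x%:C) < r -> P z.
Proof.
split.
  move/nbhs_complexP => [r r0 H]; exists r => // z z0 zr; exact: H.
move=> [r r0 H]; apply/nbhs_complexP; exists r => // z zr z0; exact: H.
Qed.

Lemma near_uhp_infty (P : set C) :
  (\forall z \near (@uhp_infty R), P z) <->
  exists r : R, forall z, 0 < Im z -> r < cmod z -> P z.
Proof.
split; first by move=> [r _ H]; exists r => z z0 zr; apply: H.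
by move=> [r H]; exists r => // z [z0 zr]; exact: H.
Qed.

Lemma uhp_at_filter (x : R) : Filter (uhp_at x).
Proof. exact: within_filter. Qed.

Lemma uhp_infty_filter : Filter (@uhp_infty R).
Proof.
apply: filter_from_filter; first by exists 0.
move=> a b _ _; exists (Num.max a b) => // z [z0]; rewrite /= gt_max => /andP[za zb].
by split; split.
Qed.

Lemma is_derive_epsilon (g : R -> R) (t l : R) :
  (forall e, 0 < e -> exists2 d, 0 < d &
     forall h, `|h| < d -> `|g (t + h) - g t - l * h| <= e * `|h|) ->
  is_derive t 1 g l.
Proof.
move=> H.
have Hc : (fun h : R => h^-1 *: (g (h *: 1 + t) - g t)) @ 0^' --> l.
  apply/cvgrPdist_lt => e e0; have e2 : 0 < e / 2 by lra.
  have [d d0 hd] := H _ e2.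
  near=> h; have h0 : h != 0 by near: h; exact: nbhs_dnbhs_neq.
  have hp : 0 < `|h| by rewrite normr_gt0.
  rewrite distrC /GRing.scale /= mulr1.
  have -> : h^-1 * (g (h + t) - g t) - l = h^-1 * (g (t + h) - g t - l * h).
    by rewrite [h + t]addrC; field.
  rewrite normrM normfV mulrC ltr_pdivrMr //.
  apply: le_lt_trans (hd h _) _; last by rewrite ltr_pM2r //; lra.
  by near: h; apply: dnbhs0_lt.
apply: DeriveDef; first by apply/cvg_ex; exists l.
exact: cvg_lim Hc.
Unshelve. all: by end_near. Qed.

(** Reduction to real calculus along a line. The factor [k] selects the component: 1 gives the real
    part, -i the imaginary part, and a conjugate direction a scalar product. *)
Lemma cdiff_line (f : C -> C) (a d k l : C) (t : R) : cdiff f (a + t%:C * d) l ->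
  is_derive t 1 (fun x : R => Re (k * f (a + x%:C * d))) (Re (k * (l * d))).
Proof.
move=> df; apply: is_derive_epsilon => e e0.
have K0 : 0 < 1 + cmod k * cmod d.
  by have := mulr_ge0 (cmod_ge0 k) (cmod_ge0 d); lra.
have [r r0 hr] := df _ (divr_gt0 e0 K0).
have D0 : 0 < 1 + cmod d by have := cmod_ge0 d; lra.
exists (r / (1 + cmod d)); first exact: divr_gt0.
move=> h; rewrite ltr_pdivlMr // => hd.
have hs : cmod (h%:C * d) < r.
  by rewrite cmodM cmod_real; move: (normr_ge0 h); lra.
have := hr _ hs.
have -> : a + t%:C * d + h%:C * d = a + (t + h)%:C * d.
  by apply: complex_ext; rewrite !ReImE; ring.
set A := f (a + (t + h)%:C * d); set B := f (a + t%:C * d) => H.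
have -> : Re (k * A) - Re (k * B) - Re (k * (l * d)) * h =
  Re (k * (A - B - l * (h%:C * d))) by rewrite !ReImE /=; ring.
apply: le_trans (Re_le_cmod _) _; rewrite cmodM.
apply: le_trans (ler_wpM2l (cmod_ge0 _) H) _.
rewrite cmodM cmod_real.
set K := 1 + _ in K0 *.
have -> : cmod k * (e / K * (`|h| * cmod d)) = (e * `|h|) * ((cmod k * cmod d) / K).
  by field; rewrite gt_eqF.
rewrite ler_piMr //; first by rewrite mulr_ge0 // ltW.
by rewrite ler_pdivrMr // mul1r /K; lra.
Qed.

End ComplexBridge.

(** * Exponential and logarithm on the upper half-plane *)

Section ComplexLogarithm.
Variable R : realType.
Local Notation C := R[i].

Lemma is_deriveP (g : R -> R) (t l : R) : is_derive t 1 g l ->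
  (forall e, 0 < e -> exists2 d, 0 < d &
     forall h, `|h| < d -> `|g (t + h) - g t - l * h| <= e * `|h|).
Proof.
move=> [dg lE] e e0.
have : (fun h : R => h^-1 *: (g (h *: 1 + t) - g t)) @ 0^' --> l by rewrite -lE.
move=> /cvgrPdist_lt /(_ e e0); rewrite near_withinE => /nbhs_ballP[r /= r0 H].
exists r => // h hr; have [->|h0] := eqVneq h 0.
  by rewrite addr0 mulr0 subrr subrr normr0 mulr0.
have := H h; rewrite -ball_normE /= sub0r normrN => /(_ hr h0).
rewrite /GRing.scale /= mulr1 => H1.
have -> : g (t + h) - g t - l * h = h * (h^-1 * (g (h + t) - g t) - l).
  by rewrite [h + t]addrC; field.
by rewrite normrM mulrC ler_wpM2r // distrC ltW.
Qed.

Lemma continuousP_epsilon (g : R -> R) (t : R) : {for t, continuous g} ->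
  forall e, 0 < e -> exists2 d, 0 < d & forall s, `|s - t| < d -> `|g s - g t| < e.
Proof.
move=> /cvgrPdist_lt H e /H; rewrite /= => /nbhs_ballP[r /= r0 hr].
exists r => // s st; rewrite distrC; apply: hr.
by rewrite -ball_normE /= distrC.
Qed.

Definition cexp (z : C) : C := 
  (expR (Re z) * cos (Im z))%R +i* (expR (Re z) * sin (Im z))%R.

Lemma Re_cexp z : Re (cexp z) = expR (Re z) * cos (Im z). Proof. by []. Qed.
Lemma Im_cexp z : Im (cexp z) = expR (Re z) * sin (Im z). Proof. by []. Qed.

Lemma cexpD z w : cexp (z + w) = cexp z * cexp w.
Proof.
by apply: complex_ext; rewrite ?ReM ?ImM ?Re_cexp ?Im_cexp ReD ImD expRD ?cosD ?sinD; ring.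
Qed.

Lemma cmod_cexp z : cmod (cexp z) = expR (Re z).
Proof.
rewrite cmodE Re_cexp Im_cexp !exprMn -mulrDr cos2Dsin2 mulr1 sqrtr_sqr ger0_norm // expR_ge0.
Qed.

Lemma cexp0 : cexp 0 = 1.
Proof. by apply: complex_ext; rewrite ?Re_cexp ?Im_cexp expR0 ?cos0 ?sin0 mul1r. Qed.

Lemma cexp_neq0 z : cexp z != 0.
Proof. by rewrite -cmod_gt0 cmod_cexp expR_gt0. Qed.

Lemma cexp_small (e : R) : 0 < e -> exists2 d : R, 0 < d &
  forall k, cmod k < d -> cmod (cexp k - 1 - k) <= e * cmod k.
Proof.
(* The two components of the remainder add up to at most e1 (|x| + 8 |y|), hence the 9; e1 <= 1
   gives the crude bounds on |E - 1| and |s|. *)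
move=> e0; have [e1 [e10 e11 e19]] : exists e1 : R, [/\ 0 < e1, e1 <= 1 & e1 * 9 <= e].
  exists (Num.min 1 (e / 9)); split; first by rewrite lt_min; lra.
    by rewrite ge_min lexx.
  by rewrite -ler_pdivlMr // ge_min lexx orbT.
have [d1 d10 h1] := is_deriveP (is_derive_expR (0 : R)) e10.
have [d2 d20 h2] := is_deriveP (is_derive_cos (0 : R)) e10.
have [d3 d30 h3] := is_deriveP (is_derive_sin (0 : R)) e10.
exists (Num.min e1 (Num.min d1 (Num.min d2 d3))); first by rewrite !lt_min e10 d10 d20.
move=> k; rewrite !lt_min => /and4P[k0 k1 k2 k3].
have xk := Re_le_cmod k; have yk := Im_le_cmod k.
have {k1}h1 := h1 (Re k) (le_lt_trans xk k1).
have {k2}h2 := h2 (Im k) (le_lt_trans yk k2).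
have {k3}h3 := h3 (Im k) (le_lt_trans yk k3).
rewrite !add0r expR0 mul1r in h1.
rewrite !add0r cos0 sin0 oppr0 mul0r subr0 in h2.
rewrite !add0r cos0 sin0 subr0 mul1r in h3.
apply: le_trans (cmod_le_ReIm _) _; rewrite !ReB !ImB Re_cexp Im_cexp /= subr0.
move: h1 h2 h3 xk yk; set x := Re k; set y := Im k.
set E := expR x; set c := cos y; set s := sin y => h1 h2 h3 xk yk.
have x0 := normr_ge0 x; have y0 := normr_ge0 y.
have hE : `|E - 1| <= 2 * `|x|.
  have -> : E - 1 = (E - 1 - x) + x by ring.
  by apply: le_trans (ler_normD _ _) _; nra.
have hE3 : `|E| <= 3.
  have -> : E = (E - 1) + 1 by ring.
  by apply: le_trans (ler_normD _ _) _; rewrite normr1; lra.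
have hs : `|s| <= 2 * `|y|.
  have -> : s = (s - y) + y by ring.
  by apply: le_trans (ler_normD _ _) _; nra.
have H1 : `|E * c - 1 - x| <= e1 * `|x| + 3 * (e1 * `|y|).
  have -> : E * c - 1 - x = (E - 1 - x) + E * (c - 1) by ring.
  apply: le_trans (ler_normD _ _) _; apply: lerD => //.
  by rewrite normrM; apply: ler_pM.
have H2 : `|E * s - y| <= (2 * e1) * (2 * `|y|) + e1 * `|y|.
  have -> : E * s - y = (E - 1) * s + (s - y) by ring.
  apply: le_trans (ler_normD _ _) _; apply: lerD => //.
  by rewrite normrM; apply: ler_pM => //; lra.
have := cmod_ge0 k; nra.
Qed.

Lemma cdiff_cexp z : cdiff cexp z (cexp z).
Proof.
move=> e e0; have E0 : 0 < cmod (cexp z) by rewrite cmod_gt0 cexp_neq0.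
have [d d0 hd] := cexp_small (divr_gt0 e0 E0).
exists d => // h /hd H.
have -> : cexp (z + h) - cexp z - cexp z * h = cexp z * (cexp h - 1 - h).
  by rewrite cexpD; ring.
rewrite cmodM; apply: le_trans (ler_wpM2l (cmod_ge0 _) H) _.
by rewrite mulrA [_ * (e / _)]mulrC divfK // gt_eqF.
Qed.

Lemma cos_arg_itv (z : C) : -1 <= Re z / cmod z <= 1.
Proof.
have [->|z0] := eqVneq z 0; first by rewrite mul0r; lra.
have zp : 0 < cmod z by rewrite cmod_gt0.
rewrite ler_pdivlMr // ler_pdivrMr // mul1r mulN1r.
by have := Re_le_cmod z; rewrite ler_norml.
Qed.

Lemma cexp_Log (z : C) : 0 <= Im z -> z != 0 -> cexp (Log z) = z.
Proof.
move=> z1 z0; have zp : 0 < cmod z by rewrite cmod_gt0.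
have zi := cos_arg_itv z.
apply: complex_ext; rewrite ?Re_cexp ?Im_cexp /uhp_log lnK ?posrE //.
  by rewrite acosK ?in_itv //= mulrC divfK ?gt_eqF.
rewrite [complex.Im _]/= sin_acos //.
rewrite -[X in X * _]ger0_norm ?cmod_ge0 // -sqrtr_sqr -sqrtrM ?sqr_ge0 //.
rewrite mulrBr mulr1 -exprMn [cmod z * _]mulrC divfK ?gt_eqF // sqr_cmod.
by rewrite addrC addKr sqrtr_sqr ger0_norm.
Qed.

Lemma Im_Log_gt0 (z : C) : 0 < Im z -> 0 < Im (Log z) < pi.
Proof.
move=> z0; have zp : 0 < cmod z.
  by rewrite cmod_gt0; apply: contraTneq z0 => ->; rewrite ltxx.
have : `|Re z / cmod z| < 1.
  rewrite normrM normfV (ger0_norm (cmod_ge0 z)) ltr_pdivrMr // mul1r.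
  rewrite cmodE -sqrtr_sqr ltr_sqrt; last by rewrite ltr_wpDl ?sqr_ge0 ?exprn_gt0.
  by rewrite ltrDl exprn_gt0.
rewrite ltr_norml => /andP[h1 h2] /=.
by rewrite acos_gt0 ?acos_ltpi // ?h1 ?h2 ?ltW.
Qed.

Lemma Log_pos (x : R) : 0 < x -> Log x%:C = (ln x)%:C.
Proof.
move=> x0; rewrite /uhp_log cmod_real gtr0_norm // Re_real divff ?gt_eqF //.
by rewrite acos1.
Qed.

Lemma Log_neg (x : R) : x < 0 -> Log x%:C = ln (- x) +i* pi.
Proof.
move=> x0; rewrite /uhp_log cmod_real ltr0_norm // Re_real.
by rewrite invrN mulrN divff ?lt_eqF // acosN1.
Qed.

(** Compare with cos (acos c0 + e), as cos is strictly decreasing on [0, pi]. The endpoints are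
    included since they are the cosines of the arguments of real numbers; the opposite estimate
    follows from acos (- c) = pi - acos c. *)
Lemma acos_cont_up (c0 e : R) : -1 <= c0 <= 1 -> 0 < e ->
  exists2 d : R, 0 < d &
    forall c, -1 <= c <= 1 -> `|c - c0| < d -> acos c < acos c0 + e.
Proof.
move=> c0i e0; have [te|te] := lerP (acos c0 + e) pi; last first.
  exists 1 => // c ci _; apply: le_lt_trans te; exact: acos_lepi.
have a0 := acos_ge0 c0i.
have lt0 : cos (acos c0 + e) < c0.
  have a1 := acos_lepi c0i.
  by rewrite -[ltRHS]acosK ?in_itv //= ltr_cos ?in_itv /= ?a0 ?a1 //; lra.
exists (c0 - cos (acos c0 + e)); first lra.
move=> c ci; rewrite ltr_norml => /andP[h _].
have : cos (acos c0 + e) < c by lra.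
have b0 := acos_ge0 ci; have b1 := acos_lepi ci.
by rewrite -[ltRHS]acosK ?in_itv //= ltr_cos ?in_itv /= ?b0 ?b1 //; lra.
Qed.

Lemma acos_cont (c0 e : R) : -1 <= c0 <= 1 -> 0 < e ->
  exists2 d : R, 0 < d &
    forall c, -1 <= c <= 1 -> `|c - c0| < d -> `|acos c - acos c0| < e.
Proof.
move=> c0i e0; have [d d0 hd] := acos_cont_up c0i e0.
have c0i' : -1 <= - c0 <= 1 by move: c0i; lra.
have [d' d'0 hd'] := acos_cont_up c0i' e0.
exists (Num.min d d') => [|c ci]; first by rewrite lt_min d0.
rewrite lt_min => /andP[/(hd _ ci) H1 H2].
have ci' : -1 <= - c <= 1 by move: ci; lra.
have := hd' (- c) ci'; rewrite -opprD normrN => /(_ H2).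
by rewrite !acosN // ltr_norml; lra.
Qed.

(** The formula of [uhp_log] takes equal values at z and at its conjugate, so there is no branch cut
    and continuity holds across both real half-axes. *)
Lemma Log_cont (z0 : C) : z0 != 0 -> forall e : R, 0 < e -> exists2 d : R, 0 < d &
  forall z, cmod (z - z0) < d -> cmod (Log z - Log z0) < e.
Proof.
move=> z00 e e0; have Z0 : 0 < cmod z0 by rewrite cmod_gt0.
have e2 : 0 < e / 2 by lra.
have [d d0 hd] := continuousP_epsilon (continuous_ln Z0) e2.
have [d' d'0 hd'] := acos_cont (cos_arg_itv z0) e2.
exists (Num.min d (Num.min (cmod z0 / 2) (d' * cmod z0 / 4))).
  by rewrite !lt_min d0 /= !divr_gt0 // mulr_gt0.
move=> z; rewrite !lt_min => /and3P[h1 h2 h3].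
have hz : `|cmod z - cmod z0| <= cmod (z - z0).
  rewrite ler_norml; have := lerB_cmod z z0; have := lerB_cmod z0 z.
  by rewrite cmodC; lra.
have hz2 : cmod z0 / 2 < cmod z by move: hz; rewrite ler_norml; lra.
have Z : 0 < cmod z by lra.
apply: le_lt_trans (cmod_le_ReIm _) _; rewrite ReB ImB /=.
have := hd _ (le_lt_trans hz h1).
suff : `|acos (Re z / cmod z) - acos (Re z0 / cmod z0)| < e / 2 by lra.
apply: hd'; first exact: cos_arg_itv.
have -> : Re z / cmod z - Re z0 / cmod z0 =
  (Re (z - z0) * cmod z0 - Re z0 * (cmod z - cmod z0)) / (cmod z * cmod z0).
  by rewrite ReB; field; rewrite !gt_eqF.
rewrite normrM normfV (gtr0_norm (mulr_gt0 Z Z0)) ltr_pdivrMr ?mulr_gt0 //.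
apply: (@le_lt_trans _ _ (2 * cmod (z - z0) * cmod z0)).
  apply: le_trans (ler_normB _ _) _; rewrite !normrM (gtr0_norm Z0).
  have := ler_wpM2r (ltW Z0) (Re_le_cmod (z - z0)).
  have := ler_pM (normr_ge0 _) (normr_ge0 _) (Re_le_cmod z0) hz; lra.
have : 2 * cmod (z - z0) < d' * cmod z.
  apply: lt_trans (_ : d' * (cmod z0 / 2) < _); first lra.
  by rewrite ltr_pM2l.
by move=> H; rewrite mulrA ltr_pM2r.
Qed.

(** Inversion of the exponential: the increment k of Log satisfies exp k - 1 = h / z, and exp k - 1
    - k is of smaller order than k. *)
Lemma cdiff_Log (z : C) : 0 < Im z -> cdiff Log z z^-1.
Proof.
move=> z0 e e0; have zn0 : z != 0 by apply: contraTneq z0 => ->; rewrite ltxx.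
have Z : 0 < cmod z by rewrite cmod_gt0.
pose e1 := Num.min (1 / 2) (e * cmod z / 2).
have e10 : 0 < e1 by rewrite lt_min !divr_gt0 // mulr_gt0.
have [d d0 hd] := cexp_small e10.
have [d' d'0 hd'] := Log_cont zn0 d0.
exists (Num.min d' (Im z)); first by rewrite lt_min d'0.
move=> h; rewrite lt_min => /andP[h1 h2].
have zh0 : 0 < Im (z + h).
  by rewrite ImD; have := Im_le_cmod h; rewrite ler_norml; lra.
have zhn0 : z + h != 0 by apply: contraTneq zh0 => ->; rewrite ltxx.
have := hd' (z + h); rewrite addrC addKr => /(_ h1) h3.
set k := Log (z + h) - Log z in h3 *.
have := hd _ h3.
have -> : cexp k = (z + h) / z.
  rewrite -[in RHS](cexp_Log (ltW zh0) zhn0) -[X in _ / X](cexp_Log (ltW z0) zn0).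
  have -> : Log (z + h) = k + Log z by rewrite /k subrK.
  by rewrite cexpD mulfK // cexp_neq0.
have -> : (z + h) / z - 1 - k = - (k - z^-1 * h) by field.
rewrite cmodN => H.
(* Since e1 <= 1/2, the error e1 |k| can be absorbed into |k|, which replaces k by h / z in the
   bound. *)
have K2 : cmod k <= 2 * cmod (z^-1 * h).
  have : cmod k <= cmod (k - z^-1 * h) + cmod (z^-1 * h).
    by rewrite -[leLHS](congr1 (@cmod R) (subrK (z^-1 * h) k)) cmodD.
  have : e1 <= 1 / 2 by rewrite ge_min lexx.
  by have := cmod_ge0 k; nra.
apply: le_trans H _; apply: le_trans (ler_wpM2l (ltW e10) K2) _.
have : e1 <= e * cmod z / 2 by rewrite ge_min lexx orbT.
rewrite cmodM cmodV => H1.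
apply: le_trans (_ : (e * cmod z / 2) * (2 * ((cmod z)^-1 * cmod h)) <= _).
  by rewrite ler_wpM2r // mulr_ge0 // mulr_ge0 ?invr_ge0 ?cmod_ge0.
rewrite le_eqVlt; apply/orP; left; apply/eqP; field.
by rewrite gt_eqF.
Qed.

End ComplexLogarithm.

(** * Mean value arguments and monotonicity of the logarithm *)

Section LogarithmInequalities.
Variable R : realType.
Local Notation C := R[i].

Lemma ccont_Log (z : C) : z != 0 -> ccont Log z.
Proof.
move=> z0 e e0; have [d d0 hd] := Log_cont z0 e0.
by exists d => // h hh; apply: hd; rewrite [z + h]addrC addrK.
Qed.

Lemma Im_neq0 (z : C) : 0 < Im z -> z != 0.
Proof. by move=> z0; apply: contraTneq z0 => ->; rewrite ltxx. Qed.

Lemma ccont_line (f : C -> C) (a d k : C) (t : R) : ccont f (a + t%:C * d) ->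
  {for t, continuous (fun x : R => Re (k * f (a + x%:C * d)))}.
Proof.
move=> cf; apply/cvgrPdist_lt => e e0.
have K0 : 0 < 1 + cmod k by have := cmod_ge0 k; lra.
have D0 : 0 < 1 + cmod d by have := cmod_ge0 d; lra.
have [r r0 hr] := cf _ (divr_gt0 e0 K0).
have := @nbhsx_ballx _ _ t _ (divr_gt0 r0 D0); apply: filterS => x.
rewrite -ball_normE /= ltr_pdivlMr // => hx.
have -> : a + x%:C * d = a + t%:C * d + (x - t)%:C * d.
  by apply: complex_ext; rewrite !ReImE; ring.
have := hr ((x - t)%:C * d); rewrite cmodM cmod_real distrC => H.
have {}H : cmod (f (a + t%:C * d + (x - t)%:C * d) - f (a + t%:C * d)) < e / (1 + cmod k).
  by apply: H; move: (normr_ge0 (t - x)) (cmod_ge0 d) hx; lra.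
rewrite -ReB -mulrBr; apply: le_lt_trans (Re_le_cmod _) _; rewrite cmodM.
rewrite cmodC; move: H; rewrite ltr_pdivlMr //.
set u := cmod (_ - _); have : 0 <= u by exact: cmod_ge0.
lra.
Qed.

(** The mean value theorem fails for complex values but holds for each real component [k]. Only
    continuity is asked at the ends, so that the segment may start on the real axis. *)
Lemma cdiff_MVT (f : C -> C) (df : C -> C) (a b k : C) :
  (forall t : R, 0 <= t <= 1 -> ccont f (a + t%:C * (b - a))) ->
  (forall t : R, 0 < t < 1 ->
     cdiff f (a + t%:C * (b - a)) (df (a + t%:C * (b - a)))) ->
  exists2 t : R, 0 < t < 1 &
    Re (k * (f b - f a)) = Re (k * (df (a + t%:C * (b - a)) * (b - a))).
Proof.
move=> cf dfd; pose g (x : R) := Re (k * f (a + x%:C * (b - a))).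
have [t|t|t tI] := @MVT R g (fun t => Re (k * (df (a + t%:C * (b - a)) * (b - a))))
    0 1 (ltr01).
- by rewrite in_itv /= => /dfd H; exact: (cdiff_line k H).
- apply: continuous_in_subspaceT => x.
  rewrite inE /= in_itv /= => /cf H; exact: (ccont_line H).
rewrite subr0 mulr1 => E; exists t; first by move: tI; rewrite in_itv.
rewrite -E /g mul0r addr0 mul1r [a + _]addrC subrK.
by rewrite mulrBr ReB.
Qed.

Lemma Re_mulNi (z : C) : Re (- 'i * z) = Im z.
Proof. by case: z => x y /=; ring. Qed.

Lemma Im_inv (z : C) : Im z^-1 = - Im z / cmod z ^+ 2.
Proof. by case: z => x y; rewrite sqr_cmod /= mulNr. Qed.

Lemma Log_segment (a b : C) (t : R) : 0 < Im a -> 0 <= Im b -> 0 < t <= 1 ->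
  0 < Im (b + t%:C * (a - b)).
Proof.
move=> a0 b0 t01; rewrite !ReImE /=.
have -> : Im b + (t * (Im a - Im b) + 0 * (Re a - Re b)) = (1 - t) * Im b + t * Im a.
  by ring.
have := mulr_gt0 (proj1 (andP t01)) a0.
have : 0 <= (1 - t) * Im b by rewrite mulr_ge0 //; move: t01; lra.
lra.
Qed.

(* The derivative of Im (Log (b + t d) conj d) in t is |d|^2 Im (1 / (b + t d)) < 0. *)
Lemma Log_monotone (a b : C) : 0 < Im a -> 0 <= Im b -> b != 0 -> a != b ->
  Im ((Log a - Log b) * conjc (a - b)) < 0.
Proof.
move=> a0 b0 bn0 ab.
have ccL (t : R) : 0 <= t <= 1 -> ccont Log (b + t%:C * (a - b)).
  move=> /andP[t0 t1]; apply: ccont_Log.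
  move: t0; rewrite le_eqVlt => /predU1P[<-|t0]; first by rewrite mul0r addr0.
  by apply: Im_neq0; apply: Log_segment => //; rewrite t0.
have dL (t : R) : 0 < t < 1 ->
    cdiff Log (b + t%:C * (a - b)) (b + t%:C * (a - b))^-1.
  move=> /andP[t0 t1]; apply: cdiff_Log; apply: Log_segment => //.
  by rewrite t0 ltW.
have [t /andP[t0 t1]] := cdiff_MVT (df := fun z => z^-1) (- 'i * conjc (a - b)) ccL dL.
set w := b + _.
have -> : Re (- 'i * conjc (a - b) * (Log a - Log b)) = Im ((Log a - Log b) * conjc (a - b)).
  by rewrite -mulrA Re_mulNi [conjc _ * _]mulrC.
move=> ->.
have -> : - 'i * conjc (a - b) * (w^-1 * (a - b)) = (- 'i * w^-1) * ((a - b) * conjc (a - b)).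
  by ring.
rewrite mul_conjc -mulrA Re_mulNi ImM Re_real Im_real mulr0 add0r.
have w0 : 0 < Im w by apply: Log_segment => //; rewrite t0 ltW.
have wn0 : 0 < cmod w by rewrite cmod_gt0 Im_neq0.
have abp : 0 < cmod (a - b) ^+ 2 by rewrite exprn_gt0 // cmod_gt0 subr_eq0.
rewrite Im_inv mulNr mulNr oppr_lt0.
by rewrite mulr_gt0 // divr_gt0 // exprn_gt0.
Qed.

Lemma Im_Log_decreasing (z : C) (x : R) : 0 < Im z -> 0 < x ->
  Im (Log (z + x%:C)) < Im (Log z).
Proof.
move=> z0 x0; have zx : z + x%:C - z = x%:C by ring.
have := @Log_monotone (z + x%:C) z; rewrite zx ImD addr0.
move=> /(_ z0 (ltW z0) (Im_neq0 z0)).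
rewrite -subr_eq0 zx (_ : x%:C != 0); last first.
  by rewrite -cmod_gt0 cmod_real normr_gt0 gt_eqF.
move=> /(_ isT); rewrite conjc_real ImM mulr0 add0r ImB Re_real pmulr_llt0 //.
by rewrite subr_lt0.
Qed.

Lemma Im_LogE (z : C) : Im (Log z) = acos (Re z / cmod z). Proof. by []. Qed.

Lemma Im_Log_sym (z : C) : Im (Log (- conjc z)) = pi - Im (Log z).
Proof.
by rewrite /= cmodN cmod_conj ReN Re_conj mulNr acosN // cos_arg_itv.
Qed.

(** By homogeneity the argument depends on y / x only, so continuity of Log at 1 suffices. *)
Lemma Im_Log_right (e : R) : 0 < e ->
  exists2 d, 0 < d & forall x y, 0 < y -> y < d * x -> Im (Log (x +i* y)) < e.
Proof.
move=> e0; have [d d0 hd] := Log_cont (oner_neq0 C) e0.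
exists d => // x y y0 yx.
have x0 : 0 < x by rewrite -(pmulr_rgt0 _ d0) (lt_trans y0).
have -> : Im (Log (x +i* y)) = Im (Log (1 +i* (y / x))).
  rewrite !Im_LogE; congr acos.
  have -> : x +i* y = x%:C * (1 +i* (y / x)).
    by apply: complex_ext; rewrite !ReImE; field; rewrite gt_eqF.
  rewrite cmodM cmod_real gtr0_norm // ReM Re_real Im_real mul0r subr0.
  have H : 0 < cmod (1 +i* (y / x)).
    by rewrite cmod_gt0 Im_neq0 //= divr_gt0.
  by field; rewrite !gt_eqF.
have := hd (1 +i* (y / x)).
have -> : 1 +i* (y / x) - 1 = (y / x) *i.
  by apply: complex_ext; rewrite !ReImE; ring.
have -> : cmod ((y / x) *i) = y / x.
  by rewrite cmodE /= expr0n add0r sqrtr_sqr gtr0_norm // divr_gt0.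
rewrite ltr_pdivrMr // yx => /(_ isT); apply: le_lt_trans.
apply: le_trans (Im_le_cmod _); rewrite ImB.
by rewrite (Log_pos ltr01) subr0; exact: ler_norm.
Qed.

Lemma Im_Log_left (e : R) : 0 < e ->
  exists2 d, 0 < d & forall x y, 0 < y -> y < d * - x -> pi - e < Im (Log (x +i* y)).
Proof.
move=> e0; have [d d0 hd] := Im_Log_right e0.
exists d => // x y y0 /(hd _ _ y0).
have -> : x +i* y = - conjc (- x +i* y) by apply: complex_ext; rewrite !ReImE ?opprK.
by rewrite Im_Log_sym; lra.
Qed.

(** On the horizontal segment from z to z - s the modulus is at least |z| - 1 >= |z| / 2, so the
    derivative is at most 2 / |z|; the real and the imaginary part contribute this amount each. *)
Lemma Log_shift_bound (z : C) (s : R) : 0 < Im z -> 2 <= cmod z -> 0 <= s <= 1 ->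
  cmod (Log (z - s%:C) - Log z) <= 4 / cmod z.
Proof.
move=> z0 z2 /andP[s0 s1].
have path (t : R) : Im (z + t%:C * (z - s%:C - z)) = Im z.
  by rewrite !ReImE /=; ring.
have ccL (t : R) : 0 <= t <= 1 -> ccont Log (z + t%:C * (z - s%:C - z)).
  by move=> _; apply: ccont_Log; apply: Im_neq0; rewrite path.
have dL (t : R) : 0 < t < 1 -> cdiff Log (z + t%:C * (z - s%:C - z))
     (z + t%:C * (z - s%:C - z))^-1.
  by move=> _; apply: cdiff_Log; rewrite path.
have Z : 0 < cmod z by lra.
have H k : cmod k = 1 -> `|Re (k * (Log (z - s%:C) - Log z))| <= 2 / cmod z.
  move=> k1; have [t /andP[t0 t1] ->] := cdiff_MVT (df := fun z => z^-1) k ccL dL.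
  apply: le_trans (Re_le_cmod _) _; rewrite !cmodM k1 mul1r cmodV.
  have -> : z + t%:C * (z - s%:C - z) = z - (t * s)%:C.
    by apply: complex_ext; rewrite !ReImE /=; ring.
  have -> : z - s%:C - z = - s%:C by ring.
  rewrite cmodN cmod_real ger0_norm //.
  have ts : t * s <= 1 by rewrite -[leRHS]mulr1 ler_pM // ltW.
  have h1 := lerB_cmod z (t * s)%:C.
  rewrite cmod_real ger0_norm in h1; last by rewrite mulr_ge0 // ltW.
  set u := cmod (z - _) in h1 *.
  have u0 : 0 < u by lra.
  rewrite mulrC ler_pdivrMr // mulrAC ler_pdivlMr //; nra.
apply: le_trans (cmod_le_ReIm _) _.
have -> : 4 / cmod z = 2 / cmod z + 2 / cmod z by ring.
apply: lerD; first by have := H 1; rewrite mul1r cmod1; apply.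
have Ni : cmod (- 'i : C) = 1 by rewrite cmodN cmodE /= expr0n expr1n add0r sqrtr1.
by have := H _ Ni; rewrite Re_mulNi.
Qed.

End LogarithmInequalities.

(** * The Goursat theorem and the maximum principle *)

Section Goursat.
Variable R : realType.

Definition integral_on (f : R -> R) (a b : R) : R :=
  \int[@lebesgue_measure R]_(x in `[a, b]) f x.

Definition cont_on (f : R -> R) (a b : R) : Prop :=
  forall x, a <= x <= b -> {for x, continuous f}.

Lemma cont_on_integrable (f : R -> R) a b : cont_on f a b ->
  (@lebesgue_measure R).-integrable `[a, b] (EFin \o f).
Proof.
move=> cf; apply: continuous_compact_integrable; first exact: segment_compact.
apply: continuous_in_subspaceT => x; rewrite inE /= in_itv /=; exact: cf.
Qed.

Lemma cont_on_sub (f : R -> R) a b a' b' : a <= a' -> b' <= b ->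
  cont_on f a b -> cont_on f a' b'.
Proof. by move=> aa bb cf x /andP[h1 h2]; apply: cf; apply/andP; split; lra. Qed.

Lemma integral_on_add (f : R -> R) a b m : a <= m -> m <= b -> cont_on f a b ->
  integral_on f a b = integral_on f a m + integral_on f m b.
Proof.
move=> am mb cf; have itf := cont_on_integrable cf.
have := Rintegral_itvB (x := m) itf; rewrite !bnd_simp => /(_ am mb).
rewrite Rintegral_itv_obnd_cbnd.
  by rewrite /integral_on => <-; rewrite addrC subrK.
by apply: integrableS itf => //; apply: subset_itvr; rewrite bnd_simp.
Qed.

Lemma integral_onB (f g : R -> R) a b : cont_on f a b -> cont_on g a b ->
  integral_on (fun x => f x - g x) a b = integral_on f a b - integral_on g a b.
Proof. by move=> cf cg; apply: RintegralB => //; exact: cont_on_integrable. Qed.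

Lemma integral_on_cst (r a b : R) : a <= b -> integral_on (fun=> r) a b = r * (b - a).
Proof.
move=> ab; rewrite /integral_on Rintegral_cst //.
rewrite [X in fine X](_ : _ = (b - a)%:E) //.
apply: etrans (lebesgue_measure_itv `[a, b]) _; rewrite /= lte_fin.
by case: ltgtP ab => // -> _; rewrite subrr.
Qed.

Lemma integral_on_le (f : R -> R) (M a b : R) : a <= b -> cont_on f a b ->
  (forall x, a <= x <= b -> f x <= M) -> integral_on f a b <= M * (b - a).
Proof.
move=> ab cf fM; rewrite -integral_on_cst //; apply: le_Rintegral.
- exact: measurable_itv.
- exact: cont_on_integrable.
- by apply: cont_on_integrable => x _; exact: cvg_cst.
- by move=> x; rewrite /= in_itv /=; exact: fM.
Qed.

Lemma integral_on_ge (f : R -> R) (M a b : R) : a <= b -> cont_on f a b ->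
  (forall x, a <= x <= b -> M <= f x) -> M * (b - a) <= integral_on f a b.
Proof.
move=> ab cf fM; rewrite -integral_on_cst //; apply: le_Rintegral.
- exact: measurable_itv.
- by apply: cont_on_integrable => x _; exact: cvg_cst.
- exact: cont_on_integrable.
- by move=> x; rewrite /= in_itv /=; exact: fM.
Qed.

Lemma integral_on_near (f : R -> R) (k e a b : R) : a <= b -> cont_on f a b ->
  (forall x, a <= x <= b -> `|f x - k| <= e) ->
  `|integral_on f a b - k * (b - a)| <= e * (b - a).
Proof.
move=> ab cf fe.
have := @integral_on_le f (k + e) a b ab cf; have := @integral_on_ge f (k - e) a b ab cf.
have h1 x : a <= x <= b -> k - e <= f x by move=> /fe; rewrite ler_norml; lra.
have h2 x : a <= x <= b -> f x <= k + e by move=> /fe; rewrite ler_norml; lra.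
move=> /(_ h1) H1 /(_ h2) H2; rewrite ler_norml; nra.
Qed.

(* The corner of a rectangle in a sequence of nested rectangles that violate P. *)
Fixpoint bad_corner (P : R -> R -> R -> R -> Prop) (a c L M : R) (n : nat) : R * R :=
  if n is m.+1 then
    let p := bad_corner P a c L M m in
    let l := L / 2 ^+ m.+1 in let h := M / 2 ^+ m.+1 in
    let bad x y := ~ P x (x + l) y (y + h) in
    if pselect (bad p.1 p.2) then p
    else if pselect (bad (p.1 + l) p.2) then (p.1 + l, p.2)
    else if pselect (bad p.1 (p.2 + h)) then (p.1, p.2 + h)
    else (p.1 + l, p.2 + h)
  else (a, c).

(** Nested bisection as an induction principle. The local hypothesis concerns only rectangles
    similar to the given one, because the error estimate in Goursat's theorem depends on the aspect
    ratio. The principle also supplies compactness in [rectangle_uniform]. *)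
Lemma rectangle_bisection (P : R -> R -> R -> R -> Prop) (a b c d : R) :
  a < b -> c < d ->
  (forall x y l h, a <= x -> x + 2 * l <= b -> c <= y -> y + 2 * h <= d -> 0 < l -> 0 < h ->
     P x (x + l) y (y + h) ->
     P (x + l) (x + l + l) y (y + h) -> P x (x + l) (y + h) (y + h + h) ->
     P (x + l) (x + l + l) (y + h) (y + h + h) ->
     P x (x + 2 * l) y (y + 2 * h)) ->
  (forall s t, a <= s <= b -> c <= t <= d ->
     exists2 e, 0 < e & forall x y r, 0 < r ->
       a <= x <= s -> s <= x + (b - a) * r <= b ->
       c <= y <= t -> t <= y + (d - c) * r <= d ->
       r < e -> P x (x + (b - a) * r) y (y + (d - c) * r)) ->
  P a b c d.
Proof.
move=> ab cd split4 loc; apply: contrapT => Pabcd.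
pose p := bad_corner P a c (b - a) (d - c).
pose l n := (b - a) / 2 ^+ n; pose h n := (d - c) / 2 ^+ n.
have ln n : l n = 2 * l n.+1.
  by rewrite /l exprS; field; rewrite expf_neq0.
have hn n : h n = 2 * h n.+1.
  by rewrite /h exprS; field; rewrite expf_neq0.
have l0 n : 0 < l n by rewrite divr_gt0 ?exprn_gt0 // subr_gt0.
have h0 n : 0 < h n by rewrite divr_gt0 ?exprn_gt0 // subr_gt0.
have step n : [/\ (p n).1 <= (p n.+1).1, (p n.+1).1 + l n.+1 <= (p n).1 + l n,
     (p n).2 <= (p n.+1).2 & (p n.+1).2 + h n.+1 <= (p n).2 + h n].
  have := l0 n.+1; have := h0 n.+1; rewrite (ln n) (hn n) /p /=.
  rewrite -/(p n) -/(l n.+1) -/(h n.+1).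
  by do 3 (case: pselect => _ /=; first by move=> *; split; lra);
     move=> *; split; lra.
have mono m n : [/\ (p m).1 <= (p (m + n)%N).1, (p (m + n)%N).1 + l (m + n)%N <= (p m).1 + l m,
     (p m).2 <= (p (m + n)%N).2 & (p (m + n)%N).2 + h (m + n)%N <= (p m).2 + h m].
  elim: n => [|n [h1 h2 h3 h4]]; first by rewrite addn0.
  by have [] := step (m + n)%N; rewrite addnS => *; split; lra.
have l00 : l 0%N = b - a by rewrite /l expr0 divr1.
have h00 : h 0%N = d - c by rewrite /h expr0 divr1.
have bnd n : [/\ a <= (p n).1, (p n).1 + l n <= b, c <= (p n).2 & (p n).2 + h n <= d].
  have [] := mono 0%N n; rewrite add0n l00 h00 /= => *; split; lra.
have bad n : ~ P (p n).1 ((p n).1 + l n) (p n).2 ((p n).2 + h n).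
  elim: n => [|n IH].
    by rewrite l00 h00 /=; have -> : a + (b - a) = b by [ring];
       have -> : c + (d - c) = d by [ring].
  have [b1 b2 b3 b4] := bnd n.
  move: IH b2 b4; rewrite (ln n) (hn n) => IH b2 b4.
  rewrite /p /= -/(p n) -/(l n.+1) -/(h n.+1).
  case: pselect => //= /contrapT P1; case: pselect => //= /contrapT P2.
  case: pselect => //= /contrapT P3 P4; apply: IH; exact: split4.
pose s := sup (range (fun n => (p n).1)); pose t := sup (range (fun n => (p n).2)).
have ub1 m : ubound (range (fun n => (p n).1)) ((p m).1 + l m).
  move=> _ [n _ <-]; have [mn|/ltnW nm] := leqP m n.
    by have [] := mono m (n - m)%N; rewrite subnKC // => *; have := l0 n; lra.
  by have [] := mono n (m - n)%N; rewrite subnKC // => *; have := l0 m; lra.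
have ub2 m : ubound (range (fun n => (p n).2)) ((p m).2 + h m).
  move=> _ [n _ <-]; have [mn|/ltnW nm] := leqP m n.
    by have [] := mono m (n - m)%N; rewrite subnKC // => *; have := h0 n; lra.
  by have [] := mono n (m - n)%N; rewrite subnKC // => *; have := h0 m; lra.
have sP n : (p n).1 <= s <= (p n).1 + l n.
  apply/andP; split.
    by apply: ub_le_sup; [exists ((p 0%N).1 + l 0%N); exact: ub1 | exists n].
  by apply: ge_sup => //; exists (p 0%N).1; exists 0%N.
have tP n : (p n).2 <= t <= (p n).2 + h n.
  apply/andP; split.
    by apply: ub_le_sup; [exists ((p 0%N).2 + h 0%N); exact: ub2 | exists n].
  by apply: ge_sup => //; exists (p 0%N).2; exists 0%N.
have sab : a <= s <= b by have := sP 0%N; rewrite l00 /=; lra.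
have tcd : c <= t <= d by have := tP 0%N; rewrite h00 /=; lra.
have [e e0 He] := loc s t sab tcd.
pose n := Num.truncn e^-1; have en : (2 ^+ n.+1)^-1 < e.
  rewrite invf_plt ?posrE ?exprn_gt0 //.
  apply: lt_trans (truncnS_gt _) _.
  by rewrite -natrX ltr_nat ltn_expl.
apply: (bad n.+1); have [b1 b2 b3 b4] := bnd n.+1.
have /andP[s1 s2] := sP n.+1; have /andP[t1 t2] := tP n.+1.
apply: (He _ _ (2 ^+ n.+1)^-1); last exact: en.
- by rewrite invr_gt0 exprn_gt0.
- by rewrite b1.
- by rewrite s2.
- by rewrite b3.
- by rewrite t2.
Qed.

(** The shared coefficient [us] is the Cauchy-Riemann equation U_s = V_t, which says that the form V
    ds + U dt is closed. *)
Definition grid_differentiable (U V : R -> R -> R) (s t : R) : Prop :=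
  exists us ut vs : R, forall e, 0 < e -> exists2 r, 0 < r &
    forall x y, `|x| < r -> `|y| < r ->
      `|U (s + x) (t + y) - U s t - us * x - ut * y| <= e * (`|x| + `|y|) /\
      `|V (s + x) (t + y) - V s t - vs * x - us * y| <= e * (`|x| + `|y|).

Theorem goursat_rectangle (U V : R -> R -> R) (a b c d : R) : a < b -> c < d ->
  (forall s t, a <= s <= b -> c <= t <= d -> grid_differentiable U V s t) ->
  (forall s, a <= s <= b -> cont_on (U s) c d) ->
  (forall t, c <= t <= d -> cont_on (V^~ t) a b) ->
  integral_on (U b) c d - integral_on (U a) c d =
  integral_on (V^~ d) a b - integral_on (V^~ c) a b.
Proof.
move=> ab cd dUV cU cV.
(* J is the integral of V ds + U dt around the rectangle. It is additive under quartering, as is the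
   area, so a bound by e times the area passes from the quarters to the whole. *)
pose J x x' y y' := integral_on (U x') y y' - integral_on (U x) y y' -
  (integral_on (V^~ y') x x' - integral_on (V^~ y) x x').
suff H e : 0 < e -> `|J a b c d| <= e * ((b - a) * (d - c)).
  apply/eqP; rewrite -subr_eq0 -normr_eq0 eq_le normr_ge0 andbT.
  apply/ler_addgt0Pr => e e0; rewrite add0r.
  have A0 : 0 < (b - a) * (d - c) by rewrite mulr_gt0 // subr_gt0.
  by have := H (e / ((b - a) * (d - c))) (divr_gt0 e0 A0); rewrite divfK // gt_eqF.
move=> e0.
apply: (rectangle_bisection (P := fun x x' y y' =>
  `|J x x' y y'| <= e * ((x' - x) * (y' - y)))) => //.
  move=> x y l h ax xb cy yd l0 h0 P1 P2 P3 P4.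
  have -> : J x (x + 2 * l) y (y + 2 * h) =
    J x (x + l) y (y + h) + J (x + l) (x + l + l) y (y + h) +
    J x (x + l) (y + h) (y + h + h) + J (x + l) (x + l + l) (y + h) (y + h + h).
    have E1 : x + 2 * l = x + l + l by ring.
    have E2 : y + 2 * h = y + h + h by ring.
    have cUs s : a <= s <= b -> cont_on (U s) y (y + h + h).
      by move=> /cU; apply: cont_on_sub => //; clear - yd; lra.
    have cVs t : c <= t <= d -> cont_on (V^~ t) x (x + l + l).
      by move=> /cV; apply: cont_on_sub => //; clear - xb; lra.
    rewrite E1 E2 /J.
    have [yh yhh] : y <= y + h /\ y + h <= y + h + h by rewrite !lerDl ltW.
    have [xl xll] : x <= x + l /\ x + l <= x + l + l by rewrite !lerDl ltW.
    have x1 : a <= x <= b by clear - ax xb l0; lra.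
    have x2 : a <= x + l + l <= b by clear - ax xb l0; lra.
    have y1 : c <= y <= d by clear - cy yd h0; lra.
    have y2 : c <= y + h + h <= d by clear - cy yd h0; lra.
    rewrite !(integral_on_add yh yhh (cUs _ _)) // !(integral_on_add xl xll (cVs _ _)) //.
    ring.
  have -> : e * ((x + 2 * l - x) * (y + 2 * h - y)) =
    e * ((x + l - x) * (y + h - y)) + e * ((x + l + l - (x + l)) * (y + h - y)) +
    e * ((x + l - x) * (y + h + h - (y + h))) +
    e * ((x + l + l - (x + l)) * (y + h + h - (y + h))) by ring.
  do 3 (apply: le_trans (ler_normD _ _) _; apply: lerD => //).
move=> s t sab tcd; have [us [ut [vs Huv]]] := dUV s t sab tcd.
pose L := b - a; pose M := d - c.
have L0 : 0 < L by rewrite subr_gt0.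
have M0 : 0 < M by rewrite subr_gt0.
(* Linearization at (s, t) leaves a total error 2 e1 (L + M)^2 k^2, and this e1 makes it e times the
   area L k M k. *)
pose e1 := e * (L * M) / (2 * (L + M) ^+ 2).
have e10 : 0 < e1.
  apply: divr_gt0; first by rewrite mulr_gt0 // mulr_gt0.
  by rewrite mulr_gt0 // exprn_gt0 // addr_gt0.
have [r r0 hr] := Huv _ e10.
exists (r / (L + M)); first by rewrite divr_gt0 // addr_gt0.
move=> x y k k0 /andP[ax xs] /andP[sx xb] /andP[cy yt] /andP[ty yd].
rewrite ltr_pdivlMr ?(addr_gt0 L0 M0) // => kr.
set x' := x + _ in sx xb *; set y' := y + _ in ty yd *.
have x'E : x' - x = L * k by rewrite /x' addrC addKr.
have y'E : y' - y = M * k by rewrite /y' addrC addKr.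
have Lk : 0 < L * k by rewrite mulr_gt0.
have Mk : 0 < M * k by rewrite mulr_gt0.
have est p q : x <= p <= x' -> y <= q <= y' ->
   `|U p q - U s t - us * (p - s) - ut * (q - t)| <= e1 * ((L + M) * k) /\
   `|V p q - V s t - vs * (p - s) - us * (q - t)| <= e1 * ((L + M) * k).
  move=> /andP[p1 p2] /andP[q1 q2].
  have hp : `|p - s| <= L * k by clear - p1 p2 xs sx x'E; rewrite ler_norml; lra.
  have hq : `|q - t| <= M * k by clear - q1 q2 yt ty y'E; rewrite ler_norml; lra.
  have [] := hr (p - s) (q - t); [clear - hp kr Mk; lra|clear - hq kr Lk; lra|].
  rewrite !subrKC => h1 h2.
  by split; [apply: le_trans h1 _|apply: le_trans h2 _]; rewrite ler_pM2l //;
     clear - hp hq; lra.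
have cU1 q : a <= q <= b -> cont_on (U q) y y' by move=> /cU; apply: cont_on_sub.
have cV1 q : c <= q <= d -> cont_on (V^~ q) x x' by move=> /cV; apply: cont_on_sub.
have xx' : x <= x' := le_trans xs sx. have yy' : y <= y' := le_trans yt ty.
have [x_ab x'_ab] : a <= x <= b /\ a <= x' <= b.
  by split; [rewrite ax (le_trans xx')|rewrite xb (le_trans ax)].
have [y_cd y'_cd] : c <= y <= d /\ c <= y' <= d.
  by split; [rewrite cy (le_trans yy')|rewrite yd (le_trans cy)].
pose e2 := 2 * (e1 * ((L + M) * k)).
have H1 : `|integral_on (U x') y y' - integral_on (U x) y y' - (us * (L * k)) * (M * k)| <=
    e2 * (M * k).
  rewrite -y'E -integral_onB; [|exact: cU1|exact: cU1].
  apply: integral_on_near => //.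
    move=> q qy; by apply: continuousB; [exact: (cU1 x')|exact: (cU1 x)].
  move=> q qy.
  have [u1 _] := est x' q ltac:(by rewrite xx' lexx) qy.
  have [u2 _] := est x q ltac:(by rewrite xx' lexx) qy.
  have -> : U x' q - U x q - us * (L * k) =
    (U x' q - U s t - us * (x' - s) - ut * (q - t)) -
    (U x q - U s t - us * (x - s) - ut * (q - t)) by rewrite -x'E; ring.
  by apply: le_trans (ler_normB _ _) _; rewrite /e2; clear - u1 u2; lra.
have H2 : `|integral_on (V^~ y') x x' - integral_on (V^~ y) x x' - (us * (M * k)) * (L * k)| <=
    e2 * (L * k).
  rewrite -x'E -integral_onB; [|exact: cV1|exact: cV1].
  apply: integral_on_near => //.
    move=> q qy; by apply: continuousB; [exact: (cV1 y')|exact: (cV1 y)].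
  move=> q qx.
  have [_ u1] := est q y' qx ltac:(by rewrite yy' lexx).
  have [_ u2] := est q y qx ltac:(by rewrite yy' lexx).
  have -> : V q y' - V q y - us * (M * k) =
    (V q y' - V s t - vs * (q - s) - us * (y' - t)) -
    (V q y - V s t - vs * (q - s) - us * (y - t)) by rewrite -y'E; ring.
  by apply: le_trans (ler_normB _ _) _; rewrite /e2; clear - u1 u2; lra.
rewrite x'E y'E /J.
set A := integral_on (U x') y y' - _ in H1 *.
set B := integral_on (V^~ y') x x' - _ in H2 *.
(* The main terms of A and B are both [us] times the area and cancel: here the Cauchy-Riemann
   equation is used. *)
have -> : A - B = (A - us * (L * k) * (M * k)) - (B - us * (M * k) * (L * k)) by ring.
apply: le_trans (ler_normB _ _) _; apply: le_trans (lerD H1 H2) _.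
rewrite /e2 /e1 le_eqVlt; apply/orP; left; apply/eqP; field.
by rewrite gt_eqF // (addr_gt0 L0 M0).
Qed.

End Goursat.

(** * Maximum principle on discs *)

Section MaximumPrinciple.
Variable R : realType.
Local Notation C := R[i].

Definition holo_on (D : set C) (f : C -> C) : Prop :=
  forall z, D z -> exists l, cdiff f z l.

Lemma grid_of_cdiff (G : C -> C) (s t : R) (L : C) : cdiff G (s +i* t) L ->
  grid_differentiable (fun x y => Re (G (x +i* y))) (fun x y => Im (G (x +i* y))) s t.
Proof.
move=> dG; exists (Re L), (- Im L), (Im L) => e e0.
have [d d0 hd] := dG _ e0; exists (d / 2); first lra.
move=> x y xd yd; have hxy : cmod (x +i* y) <= `|x| + `|y| := cmod_le_ReIm (x +i* y).
have := hd (x +i* y) ltac:(lra).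
have -> : s +i* t + (x +i* y) = (s + x) +i* (t + y) by [].
set A := G (_ +i* (t + y)); set B := G (s +i* t) => H.
have {}H : cmod (A - B - L * (x +i* y)) <= e * (`|x| + `|y|).
  by apply: le_trans H _; rewrite ler_pM2l.
split; apply: le_trans H; [apply: le_trans (Re_le_cmod _)|apply: le_trans (Im_le_cmod _)];
  rewrite !ReImE le_eqVlt; apply/orP; left; apply/eqP; congr `|_|; ring.
Qed.

Lemma ccont_vertical (G : C -> C) (s t : R) : ccont G (s +i* t) ->
  {for t, continuous (fun y => Re (G (s +i* y)))}.
Proof.
have E y : s +i* y = s%:C + y%:C * 'i by apply: complex_ext; rewrite !ReImE; ring.
rewrite E => /(ccont_line (k := 1)).
have -> // : (fun x => Re (1 * G (s%:C + x%:C * 'i))) = (fun y => Re (G (s +i* y))).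
by apply/funext => y; rewrite mul1r E.
Qed.

Lemma ccont_horizontal (G : C -> C) (s t : R) : ccont G (s +i* t) ->
  {for s, continuous (fun x => Im (G (x +i* t)))}.
Proof.
have E x : x +i* t = 0 +i* t + x%:C * 1 by apply: complex_ext; rewrite !ReImE; ring.
rewrite E => /(ccont_line (k := - 'i)).
have -> // : (fun x => Re (- 'i * G (0 +i* t + x%:C * 1))) = (fun x => Im (G (x +i* t))).
by apply/funext => y; rewrite Re_mulNi -E.
Qed.

(* In logarithmic polar coordinates around z0, Goursat's theorem shows that the mean
   of Re f over circles does not depend on the radius. *)
Theorem circle_maximum (f : C -> C) (z0 : C) (r r1 M : R) : 0 < r -> r < r1 ->
  holo_on [set w | cmod (w - z0) < r1] f ->
  (forall w, cmod (w - z0) = r -> Re (f w) <= M) -> Re (f z0) <= M.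
Proof.
move=> r0 rr1 df fM; apply/ler_addgt0Pr => e e0.
have aux (x y : R) : - e < x - y -> y - e <= x by lra.
have r10 : 0 < r1 by lra.
have [l0 df0] := df z0 ltac:(by rewrite /= subrr cmod0).
have [d d0 hd] := cdiff_cont df0 e0.
(* The inner circle has radius [expR a], so small that f stays within e of f z0 on it. *)
have [a expa ab] : exists2 a, expR a < d & a < ln r.
  have m0 : 0 < Num.min (r / 2) (d / 2) by rewrite lt_min; lra.
  exists (ln (Num.min (r / 2) (d / 2))).
    by rewrite lnK ?posrE // gt_min; apply/orP; right; lra.
  by rewrite ltr_ln ?posrE // gt_min; lra.
pose G w := f (z0 + cexp w).
have dG w : Re w <= ln r -> exists L, cdiff G w L.
  move=> wr; have [l dl] := df (z0 + cexp w) ltac:(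
    rewrite /= [z0 + _]addrC addrK cmod_cexp; apply: le_lt_trans rr1;
    by rewrite -[leRHS]lnK ?posrE // ler_expR).
  exists (l * (0 + cexp w)).
  exact: (cdiff_comp (cdiffD (cdiff_cst z0 w) (cdiff_cexp w)) dl).
pose U x y := Re (G (x +i* y)); pose V x y := Im (G (x +i* y)).
have p0 : 0 < (pi *+ 2 : R) by rewrite mulrn_wgt0 // pi_gt0.
have := @goursat_rectangle R U V a (ln r) 0 (pi *+ 2) ab p0.
have H1 : forall s t, a <= s <= ln r -> 0 <= t <= pi *+ 2 -> grid_differentiable U V s t.
  move=> s t /andP[_ sr] _; have [L dL] := dG (s +i* t) sr; exact: (grid_of_cdiff dL).
have H2 : forall s, a <= s <= ln r -> cont_on (U s) 0 (pi *+ 2).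
  move=> s /andP[_ sr] t _; have [L dL] := dG (s +i* t) sr.
  exact: ccont_vertical (cdiff_cont dL).
have H3 : forall t, 0 <= t <= pi *+ 2 -> cont_on (V^~ t) a (ln r).
  move=> t _ s /andP[_ sr]; have [L dL] := dG (s +i* t) sr.
  exact: ccont_horizontal (cdiff_cont dL).
move=> /(_ H1 H2 H3).
(* Periodicity of the exponential identifies the two horizontal sides of the rectangle, so their
   integrals cancel. *)
have -> : V^~ (pi *+ 2) = V^~ 0.
  apply/funext => s; rewrite /V /G; congr (Im (f (_ + _))).
  by apply: complex_ext; rewrite ?Re_cexp ?Im_cexp !ReImE ?cos2pi ?sin2pi ?cos0 ?sin0.
rewrite [X in _ = X]subrr => /subr0_eq E.
have upper : integral_on (U (ln r)) 0 (pi *+ 2) <= M * (pi *+ 2 - 0).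
  apply: integral_on_le; [exact: ltW|by apply: H2; rewrite lexx ltW|].
  move=> t _; apply: fM; rewrite [z0 + _]addrC addrK cmod_cexp ReE.
  by rewrite lnK ?posrE.
have lower : (Re (f z0) - e) * (pi *+ 2 - 0) <= integral_on (U a) 0 (pi *+ 2).
  apply: integral_on_ge; [exact: ltW|by apply: H2; rewrite lexx ltW|].
  move=> t _; have := hd (cexp (a +i* t)); rewrite cmod_cexp ReE => /(_ expa) H.
  have := le_lt_trans (Re_le_cmod _) H; rewrite ReB ltr_norml => /andP[h _].
  exact: aux h.
move: upper lower; rewrite E subr0 => h1 h2.
by have := le_trans h2 h1; rewrite ler_pM2r // lerBlDr.
Qed.

Lemma circle_maximum_modulus (g : C -> C) (z0 : C) (r r1 M : R) : 0 < r -> r < r1 ->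
  holo_on [set w | cmod (w - z0) < r1] g ->
  (forall w, cmod (w - z0) = r -> cmod (g w) <= M) -> cmod (g z0) <= M.
Proof.
move=> r0 rr1 dg gM.
have M0 : 0 <= M.
  apply: le_trans (cmod_ge0 (g (z0 + r%:C))) (gM _ _).
  by rewrite [z0 + _]addrC addrK cmod_real gtr0_norm.
have [->|g0] := eqVneq (g z0) 0; first by rewrite cmod0.
(* A phase that rotates g z0 to its modulus and reduces the claim to real parts. *)
pose k := conjc (g z0) / (cmod (g z0))%:C.
have gp : 0 < cmod (g z0) by rewrite cmod_gt0.
have k1 : cmod k = 1.
  by rewrite cmod_div cmod_conj cmod_real ger0_norm ?cmod_ge0 // divff ?gt_eqF.
have -> : cmod (g z0) = Re (k * g z0).
  have -> : k * g z0 = (cmod (g z0))%:C.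
    rewrite /k mulrAC [conjc _ * _]mulrC mul_conjc expr2 rmorphM /= mulfK //.
    by rewrite -cmod_gt0 cmod_real normr_gt0 gt_eqF.
  by [].
apply: (circle_maximum (f := fun w => k * g w) r0 rr1).
  by move=> w /dg[l dl]; exists (k * l); exact: cdiff_mul.
move=> w /gM H; apply: le_trans (ler_norm _) _; apply: le_trans (Re_le_cmod _) _.
by rewrite cmodM k1 mul1r.
Qed.

End MaximumPrinciple.

(** * Compactness, continuity of inverses, and the maximum principle on the half-plane *)

Section HalfPlane.
Variable R : realType.
Local Notation C := R[i].

Definition rectangle (a b c d : R) : set C :=
  [set z | a <= Re z <= b /\ c <= Im z <= d].

(** Compactness of the rectangle through bisection: as [Phi] is inherited by smaller constants, four
    quarters are glued by taking the least of their constants. *)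
Lemma rectangle_uniform (Phi : R -> C -> Prop) (a b c d : R) : a < b -> c < d ->
  (forall m m' z, 0 < m' -> m' <= m -> Phi m z -> Phi m' z) ->
  (forall z, rectangle a b c d z -> exists2 e, 0 < e & exists2 m, 0 < m &
     forall w, rectangle a b c d w -> cmod (w - z) < e -> Phi m w) ->
  exists2 m, 0 < m & forall w, rectangle a b c d w -> Phi m w.
Proof.
move=> ab cd mono loc.
apply: (@rectangle_bisection R (fun a b c d => exists2 m, 0 < m &
  forall w, rectangle a b c d w -> Phi m w) a b c d ab cd).
  move=> x y l h _ _ _ _ l0 h0 [m1 p1 H1] [m2 p2 H2] [m3 p3 H3] [m4 p4 H4].
  have M0 : 0 < Num.min (Num.min m1 m2) (Num.min m3 m4) by rewrite !lt_min p1 p2 p3.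
  exists (Num.min (Num.min m1 m2) (Num.min m3 m4)) => //.
  have xl : x + 2 * l = x + l + l by ring.
  have yh : y + 2 * h = y + h + h by ring.
  move=> w [/andP[w1 w2] /andP[w3 w4]]; rewrite xl in w2; rewrite yh in w4.
  have [wx|/ltW wx] := lerP (Re w) (x + l); have [wy|/ltW wy] := lerP (Im w) (y + h).
  - apply: mono (H1 w _) => //; first by rewrite !ge_min lexx.
    by split; apply/andP.
  - apply: mono (H3 w _) => //; first by rewrite !ge_min lexx !orbT.
    by split; apply/andP.
  - apply: mono (H2 w _) => //; first by rewrite !ge_min lexx !orbT.
    by split; apply/andP.
  - apply: mono (H4 w _) => //; first by rewrite !ge_min lexx !orbT.
    by split; apply/andP.
move=> s t sab tcd; have [e e0 [m m0 H]] := loc (s +i* t) (conj sab tcd).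
pose L := (b - a) + (d - c).
have L0 : 0 < L by rewrite addr_gt0 // subr_gt0.
exists (e / L); first exact: divr_gt0.
move=> x y r r0 /andP[ax xs] /andP[sx xb] /andP[cy yt] /andP[ty yd].
rewrite ltr_pdivlMr // => rL; exists m => // w [/andP[w1 w2] /andP[w3 w4]].
apply: H.
  by split; apply/andP; split; [exact: le_trans w1|exact: le_trans xb|
     exact: le_trans w3|exact: le_trans yd].
apply: le_lt_trans (cmod_le_ReIm _) _; rewrite ReB ImB ReE ImE.
have h1 : `|Re w - s| <= (b - a) * r.
  by clear - w1 w2 xs sx; rewrite ler_norml; lra.
have h2 : `|Im w - t| <= (d - c) * r.
  by clear - w3 w4 yt ty; rewrite ler_norml; lra.
by apply: le_lt_trans (lerD h1 h2) _; rewrite -mulrDl mulrC.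
Qed.

Lemma rectangle_max (u : C -> R) (a b c d : R) : a < b -> c < d ->
  (forall z, rectangle a b c d z -> forall e, 0 < e -> exists2 r, 0 < r &
     forall w, cmod (w - z) < r -> u w < u z + e) ->
  exists2 z, rectangle a b c d z & forall w, rectangle a b c d w -> u w <= u z.
Proof.
move=> ab cd usc.
(* The upper bound is written as an inverse so that it weakens when m decreases, as
   [rectangle_uniform] demands. *)
have [m m0 hm] : exists2 m, 0 < m & forall w, rectangle a b c d w -> u w <= m^-1.
  apply: rectangle_uniform => //.
    by move=> m m' z m'0 mm' H; apply: le_trans H _; rewrite lef_pV2 ?posrE // (lt_le_trans m'0).
  move=> z /usc /(_ 1 ltr01)[r r0 hr]; exists r => //.
  have u0 : 0 < `|u z| + 1 by rewrite ltr_wpDl.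
  exists (`|u z| + 1)^-1; first by rewrite invr_gt0.
  move=> w _ /hr /ltW H; rewrite invrK; apply: le_trans H _.
  by rewrite lerD2r ler_norm.
pose S := [set u w | w in rectangle a b c d].
have Sub : has_ubound S by exists m^-1 => _ [w Kw <-]; exact: hm.
have S0 : S !=set0.
  by exists (u (a +i* c)); exists (a +i* c) => //; split; rewrite lexx ltW.
apply: contrapT => nmax.
have [k k0 hk] : exists2 k, 0 < k & forall w, rectangle a b c d w -> u w <= sup S - k.
  apply: rectangle_uniform => //.
    by move=> p p' z _ pp' H; apply: le_trans H _; rewrite lerD2l lerN2.
  move=> z Kz.
  have uz : u z < sup S.
    rewrite ltNge; apply/negP => Mu; apply: nmax; exists z => // w Kw.
    by apply: le_trans Mu; apply: ub_le_sup => //; exists w.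
  have e0 : 0 < (sup S - u z) / 2 by rewrite divr_gt0 // subr_gt0.
  have [r r0 hr] := usc z Kz _ e0; exists r => //.
  by exists ((sup S - u z) / 2) => // w _ /hr; lra.
have : sup S <= sup S - k by apply: ge_sup => // _ [w Kw <-]; exact: hk.
by lra.
Qed.

Lemma ccont_shift (f : C -> C) (z : C) (e : R) : ccont f z -> 0 < e ->
  exists2 r, 0 < r & forall w, cmod (w - z) < r -> cmod (f w - f z) < e.
Proof.
move=> fz e0; have [r r0 hr] := fz _ e0; exists r => // w /hr.
by rewrite [z + _]addrC subrK.
Qed.

(* If w stayed away from z0 while f w is close to f z0, then 1 / (f - f w) would
   violate the maximum modulus principle on a disc around z0. *)
Lemma injective_holo_inverse_cont (D : set C) (f : C -> C) (z0 : C) (e : R) :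
  holo_on D f -> {in D &, injective f} -> 0 < e ->
  (exists2 r, 0 < r & forall w, cmod (w - z0) < r -> D w) ->
  exists2 d, 0 < d & forall z, D z -> cmod (f z - f z0) < d -> cmod (z - z0) < e.
Proof.
move=> df injf e0 [r1 r10 Dball].
have Dz0 : D z0 by apply: Dball; rewrite subrr cmod0.
pose r2 := Num.min r1 e; have r20 : 0 < r2 by rewrite lt_min r10.
have r2r1 : r2 <= r1 by rewrite ge_min lexx.
have r2e : r2 <= e by rewrite ge_min lexx orbT.
clearbody r2; pose r := r2 / 2.
have r0 : 0 < r by rewrite /r; lra.
have rr2 : r < r2 by rewrite /r; lra.
clearbody r.
(* Compactness of the circle is taken from the surrounding square: near a point off the circle the
   condition is vacuous. *)
have [m m0 hm] : exists2 m, 0 < m & forall w,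
    rectangle (Re z0 - r) (Re z0 + r) (Im z0 - r) (Im z0 + r) w ->
    cmod (w - z0) = r -> m <= cmod (f w - f z0).
  apply: rectangle_uniform => [||m m' z _ mm' H /H|z Kz]; [lra|lra|exact: le_trans|].
  have [zr|zr] := eqVneq (cmod (z - z0)) r; last first.
    have d0 : 0 < `|cmod (z - z0) - r| by rewrite normr_gt0 subr_eq0.
    exists `|cmod (z - z0) - r| => //; exists 1 => // w _ wz wr; exfalso.
    move: wz; rewrite -wr ltNge; apply/negP; rewrite negbK.
    have t1 := lerB_cmod (w - z0) (z - z0); have t2 := lerB_cmod (z - z0) (w - z0).
    rewrite !opprB !addrA !subrK in t1 t2.
    by rewrite [X in _ <= X]cmodC in t2; rewrite ler_norml; clear - t1 t2; lra.
  have Dz : D z by apply: Dball; rewrite zr; apply: lt_le_trans r2r1.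
  have m0 : 0 < cmod (f z - f z0).
    rewrite cmod_gt0 subr_eq0; apply/eqP => /injf; rewrite !inE => /(_ Dz Dz0) zz0.
    by move: zr; rewrite zz0 subrr cmod0 => E; rewrite -E ltxx in r0.
  have [l dl] := df z Dz.
  have m2 : 0 < cmod (f z - f z0) / 2 by rewrite divr_gt0.
  have [d d0 hd] := ccont_shift (cdiff_cont dl) m2.
  exists d => //; exists (cmod (f z - f z0) / 2) => // w _ /hd H _.
  have := lerB_cmod (f z - f z0) (f z - f w).
  rewrite (_ : f z - f z0 - (f z - f w) = f w - f z0); last by ring.
  by rewrite [cmod (f z - f w)]cmodC; clear - H; lra.
have hcirc w : cmod (w - z0) = r -> m <= cmod (f w - f z0).
  move=> wr; apply: hm => //.
  have t1 := Re_le_cmod (w - z0); have t2 := Im_le_cmod (w - z0).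
  rewrite wr ReB ler_norml in t1; rewrite wr ImB ler_norml in t2.
  by split; [clear - t1|clear - t2]; lra.
(* If |f z - f z0| < m / 2, then |f - f z| is at least m / 2 on the circle but smaller than m / 2 at
   its centre. *)
exists (m / 2); first by rewrite divr_gt0.
move=> z Dz fz; rewrite ltNge; apply/negP => ez.
have dg : holo_on [set w | cmod (w - z0) < r2] (fun w => (f w - f z)^-1).
  move=> w /= wr2; have Dw : D w by apply: Dball; apply: lt_le_trans r2r1.
  have [l dl] := df w Dw.
  have fwz : f w - f z != 0.
    rewrite subr_eq0; apply/eqP => /injf; rewrite !inE => /(_ Dw Dz) wz.
    by move: wr2; rewrite wz ltNge (le_trans r2e ez).
  exists (- (f w - f z) ^- 2 * (l + 0)).
  exact: (cdiff_comp (f := fun w => f w - f z) (cdiffD dl (cdiff_cst (- f z) w)) (cdiff_inv fwz)).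
have gM w : cmod (w - z0) = r -> cmod (f w - f z)^-1 <= (m / 2)^-1.
  move=> /hcirc H; rewrite cmodV.
  have H2 : m / 2 <= cmod (f w - f z).
    have := lerB_cmod (f w - f z0) (f z - f z0).
    rewrite (_ : f w - f z0 - (f z - f z0) = f w - f z); last by ring.
    by clear - H fz; lra.
  have m2 : 0 < m / 2 by rewrite divr_gt0.
  by rewrite lef_pV2 // posrE; apply: lt_le_trans H2.
have := circle_maximum_modulus r0 rr2 dg gM; rewrite cmodV cmodC.
have fz0 : 0 < cmod (f z - f z0).
  rewrite cmod_gt0 subr_eq0; apply/eqP => /injf; rewrite !inE => /(_ Dz Dz0) zz0.
  by move: ez; rewrite zz0 subrr cmod0 leNgt e0.
rewrite lef_pV2 ?posrE // ?divr_gt0 //.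
by move=> h; move: (lt_le_trans fz h); rewrite ltxx.
Qed.

(* On a large rectangle, f - eps Log (z + i) + delta |z|^2 cannot have an interior
   maximum, because delta |z|^2 is strictly subharmonic. *)
Lemma half_plane_maximum (f : C -> C) (B : R) :
  holo_on (@upper_half_plane R) f ->
  (forall z, 0 < Im z -> Re (f z) <= B) ->
  (forall r e, 0 < r -> 0 < e -> exists2 h, 0 < h &
     forall z, 0 < Im z < h -> cmod z <= r -> Re (f z) <= e) ->
  forall z, 0 < Im z -> Re (f z) <= 0.
Proof.
move=> df fB bd z1 z10; rewrite leNgt; apply/negP; set m := Re (f z1) => m0.
pose lg (z : C) := ln (cmod (z + 'i)).
have lgE (z : C) : Re (Log (z + 'i)) = lg z by [].
have zi (z : C) : 0 < Im z -> [/\ 0 < Im (z + 'i), cmod z <= cmod (z + 'i) & 1 <= cmod (z + 'i)].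
  move=> z0; have i0 : Im (z + 'i) = Im z + 1 by rewrite ImD ImE.
  split; first by rewrite i0; clear - z0; lra.
    rewrite -(ler_pXn2r (_ : 0 < 2)%N) ?nnegrE ?cmod_ge0 // !sqr_cmod i0 ReD ReE addr0.
    by rewrite lerD2l; clear - z0; nra.
  by have := Im_le_cmod (z + 'i); rewrite i0 ger0_norm; clear - z0; lra.
have lg0 (z : C) : 0 < Im z -> 0 <= lg z by move=> /zi[_ _ h]; rewrite ln_ge0.
have [eps eps0 heps] : exists2 eps, 0 < eps & eps * lg z1 <= m / 4.
  have l0 := lg0 _ z10; exists (m / (4 * (1 + lg z1))).
    by rewrite divr_gt0 // mulr_gt0 // ltr_wpDr.
  rewrite [X in _ <= X](_ : _ = m / (4 * (1 + lg z1)) * (1 + lg z1)).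
    by rewrite ler_pM2l ?lerDr // divr_gt0 // mulr_gt0 // ltr_wpDr.
  by field; rewrite gt_eqF // ltr_wpDr.
(* From this radius on, eps ln |z + i| exceeds B, so the logarithmic term beats the global bound on
   Re f. *)
pose r := expR (B / eps) + cmod z1 + 1.
have rpos : 0 < expR (B / eps) := expR_gt0 _.
have z1r : cmod z1 < r by rewrite /r; clear - rpos; lra.
have r0 : 0 < r := le_lt_trans (cmod_ge0 _) z1r.
have big (z : C) : 0 < Im z -> r <= cmod z -> Re (f z) - eps * lg z <= 0.
  move=> z0 zr; have [_ h1 _] := zi z z0.
  rewrite subr_le0; apply: le_trans (fB z z0) _.
  rewrite mulrC -ler_pdivrMr // -[leLHS]expRK ler_ln ?posrE //.
    apply: le_trans (le_trans zr h1); rewrite /r; have := cmod_ge0 z1.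
    by clear - rpos; lra.
  by apply: lt_le_trans h1; apply: lt_le_trans zr.
clearbody r.
(* On the rectangle |z|^2 <= 2 r^2, so the quadratic term is at most m / 8. Then u is at most m / 8
   where |z| >= r and at most m / 4 on the bottom side, against at least 3 m / 4 at z1. *)
pose dl := m / (16 * r ^+ 2).
have dl0 : 0 < dl by rewrite divr_gt0 // mulr_gt0 // exprn_gt0.
have [h h0 hh] := bd (2 * r) (m / 8) ltac:(by rewrite mulr_gt0) ltac:(by rewrite divr_gt0).
have [h1 [h10 h1h h1z]] : exists h1, [/\ 0 < h1, h1 < h & h1 < Im z1].
  exists (Num.min h (Im z1) / 2).
  have M0 : 0 < Num.min h (Im z1) by rewrite lt_min h0.
  have Mh : Num.min h (Im z1) <= h by rewrite ge_min lexx.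
  have Mz : Num.min h (Im z1) <= Im z1 by rewrite ge_min lexx orbT.
  by split; clear - M0 Mh Mz; lra.
have Imz1 : Im z1 < r.
  by apply: le_lt_trans z1r; apply: le_trans (ler_norm _) (Im_le_cmod _).
have Rez1 : - r < Re z1 < r.
  by have := Re_le_cmod z1; rewrite ler_norml; clear - z1r; lra.
have h1r : h1 < r by apply: lt_trans h1z Imz1.
pose u (z : C) := Re (f z) - eps * lg z + dl * cmod z ^+ 2.
pose F (z : C) := f z + (- eps)%:C * Log (z + 'i).
have dF (z : C) : 0 < Im z -> exists l, cdiff F z l.
  move=> z0; have [l dlf] := df z z0; have [zi0 _ _] := zi z z0.
  exists (l + (- eps)%:C * ((z + 'i)^-1 * (1 + 0))); apply: cdiffD => //; apply: cdiff_mul.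
  exact: (cdiff_comp (f := fun z => z + 'i) (cdiffD (cdiff_id z) (cdiff_cst 'i z)) (cdiff_Log zi0)).
have uF z : u z = Re (F z) + dl * cmod z ^+ 2.
  by rewrite /u /F ReD ReM Re_real Im_real mul0r subr0 lgE mulNr.
have [zs Kzs umax] : exists2 zs, rectangle (- r) r h1 r zs &
    forall w, rectangle (- r) r h1 r w -> u w <= u zs.
  apply: rectangle_max => //; first by clear - r0; lra.
  move=> z [_ /andP[z0 _]] e e0; have [l dFz] := dF z (lt_le_trans h10 z0).
  have e2 : 0 < e / 2 by rewrite divr_gt0.
  have [d d0 hd] := ccont_shift (cdiff_cont dFz) e2.
  pose c := 2 * cmod z + 1; have c0 : 0 < c by have := cmod_ge0 z; rewrite /c; lra.
  have dc0 : 0 < dl * c by rewrite mulr_gt0.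
  exists (Num.min d (Num.min 1 (e / 2 / (dl * c)))).
    by rewrite !lt_min d0 ltr01 divr_gt0.
  move=> w; rewrite !lt_min => /and3P[/hd w1 w2 w3]; rewrite !uF.
  have t1 : Re (F w) < Re (F z) + e / 2.
    have := le_lt_trans (Re_le_cmod _) w1; rewrite ReB ltr_norml.
    by clear; lra.
  have t2 : cmod w ^+ 2 <= cmod z ^+ 2 + c * cmod (w - z).
    have t3 : cmod w <= cmod z + cmod (w - z).
      by rewrite -[leLHS](congr1 (@cmod R) (subrK z w)) addrC cmodD.
    have := cmod_ge0 w; have := cmod_ge0 z; have := cmod_ge0 (w - z).
    by rewrite /c; clear - t3 w2; nra.
  have t4 : dl * (c * cmod (w - z)) < e / 2.
    by rewrite mulrA mulrC -ltr_pdivlMr.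
  have t5 : dl * cmod w ^+ 2 <= dl * (cmod z ^+ 2 + c * cmod (w - z)) by rewrite ler_pM2l.
  by move: t1 t4 t5; clear; rewrite mulrDr; lra.
have Kz1 : rectangle (- r) r h1 r z1.
  by split; [clear - Rez1|clear - Imz1 h1z]; lra.
have uz1 : 3 / 4 * m <= u z1.
  have : 0 <= dl * cmod z1 ^+ 2 by rewrite mulr_ge0 ?exprn_ge0 ?cmod_ge0 // ltW.
  by rewrite /u -/m; clear - heps; lra.
have dlr z : rectangle (- r) r h1 r z -> dl * cmod z ^+ 2 <= m / 8.
  move=> [/andP[a1 a2] /andP[a3 a4]]; rewrite sqr_cmod.
  have -> : m / 8 = dl * (r ^+ 2 + r ^+ 2) by rewrite /dl; field; rewrite gt_eqF.
  by rewrite ler_pM2l //; apply: lerD; clear - a1 a2 a3 a4 h10; nra.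
have zs0 : 0 < Im zs by have [_ /andP[]] := Kzs; clear - h10; lra.
have uzs : 3 / 4 * m <= u zs by apply: le_trans uz1 (umax _ Kz1).
have small : cmod zs < r.
  rewrite ltNge; apply/negP => /(big zs zs0) H.
  by have := dlr zs Kzs; move: uzs; rewrite /u; clear - m0 H; lra.
have high : h1 < Im zs.
  rewrite ltNge; apply/negP => H.
  have := hh zs; rewrite zs0 (le_lt_trans H h1h) => /(_ isT).
  have -> : cmod zs <= 2 * r by clear - small r0; lra.
  move=> /(_ isT) H2; have := dlr zs Kzs; have := mulr_ge0 (ltW eps0) (lg0 zs zs0).
  by move: uzs; rewrite /u; clear - m0 H2; lra.
pose q := Num.min (Im zs - h1) (r - cmod zs) / 2.
have [q0 q1 q2] : [/\ 0 < q, q < Im zs - h1 & q < r - cmod zs].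
  have M0 : 0 < Num.min (Im zs - h1) (r - cmod zs) by rewrite lt_min !subr_gt0 high.
  have M1 : Num.min (Im zs - h1) (r - cmod zs) <= Im zs - h1 by rewrite ge_min lexx.
  have M2 : Num.min (Im zs - h1) (r - cmod zs) <= r - cmod zs by rewrite ge_min lexx orbT.
  by rewrite /q; split; clear - M0 M1 M2; lra.
clearbody q.
(* Expanding |w|^2 around zs gives the linear term 2 Re (conj zs (w - zs)), which a (w - zs)
   reproduces holomorphically, and |w - zs|^2, which leaves the strict deficit dl q^2 on the
   circle. *)
pose a := (2 * dl)%:C * conjc zs.
pose G (z : C) := F z + a * (z - zs).
have dG : holo_on [set w | cmod (w - zs) < Im zs] G.
  move=> w /= wzs.
  have w0 : 0 < Im w.
    have := le_lt_trans (Im_le_cmod _) wzs; rewrite ImB ltr_norml.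
    by clear; lra.
  have [l dFw] := dF w w0; exists (l + a * (1 + 0)); apply: cdiffD => //; apply: cdiff_mul.
  exact: cdiffD (cdiff_id w) (cdiff_cst (- zs) w).
have qIm : q < Im zs by clear - q1 h10; lra.
have := circle_maximum (M := Re (F zs) - dl * q ^+ 2) q0 qIm dG.
have H : forall w, cmod (w - zs) = q -> Re (G w) <= Re (F zs) - dl * q ^+ 2.
  move=> w wq.
  have Kw : rectangle (- r) r h1 r w.
    have t1 := Re_le_cmod (w - zs); rewrite wq ReB ler_norml in t1.
    have t2 := Im_le_cmod (w - zs); rewrite wq ImB ler_norml in t2.
    have t3 := Re_le_cmod zs; rewrite ler_norml in t3.
    have t4 := Im_le_cmod zs; rewrite ler_norml in t4.
    by split; [clear - t1 t3 q2|clear - t2 t4 q1 q2]; lra.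
  have := umax w Kw; rewrite !uF -wq !sqr_cmod /G /a !ReImE.
  by clear; lra.
move=> /(_ H); rewrite /G subrr mulr0 addr0.
have : 0 < dl * q ^+ 2 by rewrite mulr_gt0 // exprn_gt0.
by clear; lra.
Qed.

End HalfPlane.

(** * Conformal maps of the upper half-plane with a logarithmic asymptotic *)

Section HalfPlaneUniqueness.
Variable R : realType.
Local Notation C := R[i].
Local Notation H := (@upper_half_plane R).

Definition log_asymptotic (f : C -> C) (S : R) (c : C) : Prop :=
  exists K r : R, forall z, 0 < Im z -> r < cmod z ->
    cmod (f z - (S%:C * Log z + c)) <= K / cmod z.

Lemma Re_LogE (z : C) : Re (Log z) = ln (cmod z). Proof. by []. Qed.

Lemma uhp_ball (z : C) : H z -> exists2 r : R, 0 < r & forall w, cmod (w - z) < r -> H w.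
Proof.
rewrite /upper_half_plane /= => z0; exists (Im z) => // w wz.
by have := le_lt_trans (Im_le_cmod _) wz; rewrite ImB ltr_norml; lra.
Qed.

Lemma uhp_transition_cont (f g p : C -> C) (z0 : C) (e : R) :
  holo_on H f -> holo_on H g -> {in H &, injective f} ->
  (forall z, H z -> H (p z) /\ f (p z) = g z) -> H z0 -> 0 < e ->
  exists2 d, 0 < d & forall z, H z -> cmod (z - z0) < d -> cmod (p z - p z0) < e.
Proof.
move=> df dg injf hp Hz0 e0; have [Hp0 fp0] := hp z0 Hz0.
have [d d0 hd] := injective_holo_inverse_cont df injf e0 (uhp_ball Hp0).
have [l dl] := dg z0 Hz0.
have [d' d'0 hd'] := ccont_shift (cdiff_cont dl) d0.
exists d' => // z Hz /hd'; have [Hp fp] := hp z Hz.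
by rewrite -fp -fp0; exact: hd.
Qed.

Lemma uhp_transition_holo (f g p : C -> C) :
  holo_on H f -> holo_on H g -> {in H &, injective f} ->
  (forall z, H z -> exists2 l, l != 0 & cdiff f z l) ->
  (forall z, H z -> H (p z) /\ f (p z) = g z) -> holo_on H p.
Proof.
move=> df dg injf df0 hp z0 Hz0; have [Hp0 fp0] := hp z0 Hz0.
have [l l0 dl] := df0 _ Hp0; have [l' dl'] := dg _ Hz0.
have lp : 0 < cmod l by rewrite cmod_gt0.
exists (l' / l) => e e0.
(* An a priori Lipschitz constant of p at z0: with e1 <= |l| / 2 the error e1 |q| is absorbed into
   |l| |q|. *)
pose D := 2 * (cmod l' + cmod l) / cmod l.
have D0 : 0 <= D.
  by rewrite divr_ge0 ?cmod_ge0 // mulr_ge0 // addr_ge0 // cmod_ge0.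
pose e1 := Num.min (cmod l / 2) (e * cmod l / (D + 1)).
have e10 : 0 < e1 by rewrite lt_min !divr_gt0 // ?mulr_gt0 //; lra.
have e1l : e1 <= cmod l / 2 by rewrite ge_min lexx.
have e1e : e1 * (D + 1) <= e * cmod l by rewrite -ler_pdivlMr ?ge_min ?lexx ?orbT //; lra.
clearbody e1.
have [d d0 hd] := dl _ e10; have [d' d'0 hd'] := dl' _ e10.
have [d2 d20 hd2] := uhp_transition_cont df dg injf hp Hz0 d0.
have [d3 d30 hd3] := uhp_ball Hz0.
exists (Num.min d' (Num.min d2 d3)); first by rewrite !lt_min d'0 d20.
move=> h; rewrite !lt_min => /and3P[h1 h2 h3].
have zh : z0 + h - z0 = h by ring.
have Hz : H (z0 + h) by apply: hd3; rewrite zh.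
have [Hp fp] := hp _ Hz.
have hq := hd2 _ Hz; rewrite zh in hq; have {}hq := hq h2.
pose q := p (z0 + h) - p z0; rewrite -/q in hq *.
have pq : p z0 + q = p (z0 + h) by rewrite /q addrC subrK.
have := hd _ hq; rewrite pq fp fp0 => A.
have := hd' _ h1 => B.
have E : cmod (l * q - l' * h) <= e1 * cmod q + e1 * cmod h.
  have -> : l * q - l' * h = (g (z0 + h) - g z0 - l' * h) - (g (z0 + h) - g z0 - l * q) by ring.
  by apply: le_trans (cmodB _ _) _; rewrite addrC lerD.
have q0 := cmod_ge0 q; have hh0 := cmod_ge0 h.
have F : cmod q <= D * cmod h.
  rewrite /D mulrAC ler_pdivlMr //.
  have : cmod (l * q) <= cmod (l * q - l' * h) + cmod (l' * h).
    by rewrite -[leLHS](congr1 (@cmod R) (subrK (l' * h) (l * q))) cmodD.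
  rewrite !cmodM; clear - E e1l q0 hh0 e10; nra.
have -> : q - l' / l * h = (l * q - l' * h) / l by field.
rewrite cmod_div ler_pdivrMr //; apply: le_trans E _.
apply: le_trans (_ : e1 * (D + 1) * cmod h <= _).
  have : e1 * cmod q <= e1 * (D * cmod h) by rewrite ler_pM2l.
  by clear; lra.
by rewrite [leRHS]mulrAC ler_wpM2r.
Qed.

(** The increments along t and along i t are real, so both l and i l are real; hence l = 0
    everywhere and g is constant along segments. *)
Lemma holo_real_cst (g : C -> C) : holo_on H g -> (forall z, 0 < Im z -> Im (g z) = 0) ->
  exists b : R, forall z, 0 < Im z -> g z = b%:C.
Proof.
move=> dg g0.
have d0 z : 0 < Im z -> cdiff g z 0.
  move=> z0; have [l dl] := dg z z0.
  suff -> : 0 = l by [].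
  have small e : 0 < e -> `|Im l| <= e /\ `|Re l| <= e.
    move=> e0; have [d dp hd] := dl _ e0.
    pose t := Num.min (d / 2) (Im z / 2).
    have [t0 td tz] : [/\ 0 < t, t < d & t < Im z].
      have M0 : 0 < t by rewrite lt_min !divr_gt0.
      have M1 : t <= d / 2 by rewrite ge_min lexx.
      have M2 : t <= Im z / 2 by rewrite ge_min lexx orbT.
      by split => //; clear - M1 M2 dp z0; lra.
    clearbody t.
    have ct : cmod t%:C = t by rewrite cmod_real gtr0_norm.
    have cit : cmod ('i * t%:C) = t.
      by rewrite cmodM ct cmodE /= expr0n expr1n add0r sqrtr1 mul1r.
    have im1 : 0 < Im (z + t%:C) by rewrite ImD addr0.
    have im2 : 0 < Im (z + 'i * t%:C).
      by rewrite !ReImE mul0r mul1r add0r; clear - z0 t0; lra.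
    have h1 := hd t%:C; rewrite ct in h1; have {}h1 := le_trans (Im_le_cmod _) (h1 td).
    have h2 := hd ('i * t%:C); rewrite cit in h2.
    have {}h2 := le_trans (Im_le_cmod _) (h2 td).
    rewrite !ImB !g0 // subr0 sub0r normrN in h1; rewrite !ImB !g0 // subr0 sub0r normrN in h2.
    have E1 : Im (l * t%:C) = t * Im l by rewrite !ReImE; ring.
    have E2 : Im (l * ('i * t%:C)) = t * Re l by rewrite !ReImE; ring.
    rewrite E1 normrM gtr0_norm // mulrC ler_pM2r // in h1.
    by rewrite E2 normrM gtr0_norm // mulrC ler_pM2r // in h2.
  apply/esym; apply: complex_ext; apply/eqP; rewrite -normr_eq0 eq_le normr_ge0 andbT;
    apply/ler_addgt0Pr => e e0; rewrite add0r; by have [] := small e e0.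
exists (Re (g 'i)) => z z0; apply: complex_ext; last by rewrite g0.
have i0 : 0 < Im ('i : C) by rewrite ImE.
have seg (t : R) : 0 <= t <= 1 -> 0 < Im ('i + t%:C * (z - 'i)).
  by rewrite !ReImE; clear - z0; nra.
have [||t _] := cdiff_MVT (f := g) (df := fun=> 0) (a := 'i) (b := z) 1.
- by move=> t /seg /d0 /cdiff_cont.
- by move=> t /andP[t0 t1]; apply: d0; apply: seg; rewrite !ltW.
by rewrite !mul1r mul0r ReB => /subr0_eq.
Qed.

(** The intermediate value theorem in place of connectedness: along the segment |p| cannot cross the
    value rho. *)
Lemma segment_avoid (p : C -> C) (rho : R) (a b : C) :
  (forall z, H z -> ccont p z) ->
  (forall t : R, 0 <= t <= 1 -> H (a + t%:C * (b - a)) /\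
     cmod (p (a + t%:C * (b - a))) != rho) ->
  cmod (p a) < rho -> cmod (p b) < rho.
Proof.
move=> cp path pa; rewrite ltNge; apply/negP => pb.
have cg : {within `[(0:R), 1], continuous (fun t : R => cmod (p (a + t%:C * (b - a))))}.
  apply: continuous_in_subspaceT => t; rewrite inE /= in_itv /= => /path[Ht _].
  apply/cvgrPdist_lt => e e0.
  have D0 : 0 < 1 + cmod (b - a) by have := cmod_ge0 (b - a); lra.
  have [r r0 hr] := ccont_shift (cp _ Ht) e0.
  have := @nbhsx_ballx _ _ t _ (divr_gt0 r0 D0); apply: filterS => x.
  rewrite -ball_normE /= ltr_pdivlMr // => hx.
  have E : a + x%:C * (b - a) - (a + t%:C * (b - a)) = (x - t)%:C * (b - a).
    by apply: complex_ext; rewrite !ReImE; ring.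
  have := hr (a + x%:C * (b - a)); rewrite E cmodM cmod_real distrC => K.
  have {}K := K ltac:(move: (normr_ge0 (t - x)) (cmod_ge0 (b - a)) hx; clear; lra).
  apply: le_lt_trans K.
  have := lerB_cmod (p (a + x%:C * (b - a))) (p (a + t%:C * (b - a))).
  have := lerB_cmod (p (a + t%:C * (b - a))) (p (a + x%:C * (b - a))).
  by rewrite cmodC ler_norml; clear; lra.
have [|t] := @IVT R (fun t => cmod (p (a + t%:C * (b - a)))) 0 1 rho ler01 cg.
  rewrite mul0r addr0 mul1r [a + _]addrC subrK ge_min le_max.
  by rewrite (ltW pa) pb orbT.
by rewrite in_itv /= => /path[_ /eqP].
Qed.

Theorem uhp_automorphism_affine (f g : C -> C) (S : R) (c c' : C) : 0 < S ->
  holo_on H f -> holo_on H g -> {in H &, injective f} -> {in H &, injective g} ->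
  (forall z, H z -> exists2 l, l != 0 & cdiff f z l) ->
  f @` H = g @` H ->
  (forall r, exists M, forall z, 0 < Im z -> cmod z <= r -> Re (f z) <= M) ->
  (forall M, exists r, forall z, 0 < Im z -> r < cmod z -> M < Re (g z)) ->
  log_asymptotic f S c -> log_asymptotic g S c' -> Im c = Im c' ->
  exists b : R, forall z, 0 < Im z ->
    g z = f ((expR ((Re c' - Re c) / S))%:C * z + b%:C).
Proof.
move=> S0 df dg injf injg df0 img fbnd ginf [K [r0 asf]] [K' [r0' asg]] Ic.
have /choice[p hp] : forall z, exists t, H z -> H t /\ f t = g z.
  move=> z.
  have [Hz|Hz] := pselect (H z); last by exists 0.
  have : (f @` H) (g z) by rewrite img; exists z.
  by move=> [t Ht ft]; exists t.
have /choice[q hq] : forall z, exists t, H z -> H t /\ g t = f z.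
  move=> z.
  have [Hz|Hz] := pselect (H z); last by exists 0.
  have : (g @` H) (f z) by rewrite -img; exists z.
  by move=> [t Ht ft]; exists t.
have qp z : H z -> q (p z) = z.
  move=> Hz; have [Hp fp] := hp z Hz; have [Hq gq] := hq _ Hp.
  by apply: injg; rewrite ?inE // gq fp.
have dp := uhp_transition_holo df dg injf df0 hp.
have cq z : H z -> ccont q z.
  move=> Hz e e0; have [d d0 hd] := uhp_transition_cont dg df injg hq Hz e0.
  have [d' d'0 hd'] := uhp_ball Hz.
  exists (Num.min d d'); first by rewrite lt_min d0.
  move=> h; rewrite lt_min => /andP[h1 h2].
  have zh : z + h - z = h by ring.
  by apply: hd; [apply: hd'|]; rewrite zh.
have pinf r : exists r', forall z, 0 < Im z -> r' < cmod z -> r < cmod (p z).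
  have [M hM] := fbnd r; have [r' hr'] := ginf M; exists r' => z z0 /(hr' z z0).
  have [Hp <-] := hp z z0; rewrite [_ < cmod _]ltNge => lt; apply/negP => /(hM _ Hp).
  by rewrite leNgt lt.
set ka := (Re c' - Re c) / S; pose la := expR ka.
have la0 : 0 < la := expR_gt0 _.
have Sc : c' - c = S%:C * ka%:C.
  by apply: complex_ext; rewrite !ReImE ?Ic /ka; [field; rewrite gt_eqF|rewrite subrr; ring].
(* The two asymptotics give Log (p z) = Log z + ka + O(1 / |z|); exponentiate. *)
have [D [r1 [r10 D0 hD]]] : exists D r1 : R, [/\ 0 < r1, 0 < D & forall z,
    0 < Im z -> r1 < cmod z -> cmod (p z - la%:C * z) <= D].
  have [d d0 hd] := cexp_small (@ltr01 R).
  pose L := (`|K| + `|K'|) / S.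
  have L0 : 0 <= L by rewrite divr_ge0 ?addr_ge0 // ltW.
  have [ra hra] := pinf (Num.max r0 (L + 1)).
  pose L2 := (`|K| * expR (1 - ka) + `|K'|) / S.
  have L20 : 0 <= L2.
    by rewrite divr_ge0 ?addr_ge0 ?mulr_ge0 ?expR_ge0 // ltW.
  have maxge (a b : R) : a <= Num.max a b /\ b <= Num.max a b.
    by rewrite !le_max !lexx orbT.
  pose r1 := Num.max (Num.max r0' ra) (Num.max (L + 1) (L2 / d)).
  exists (2 * la * L2 + 1), (Num.max 1 r1); split.
  - by rewrite lt_max ltr01.
  - by rewrite ltr_wpDl // mulr_ge0 // mulr_ge0 // ltW.
  move=> z z0; rewrite /r1 !gt_max => /andP[z1 /andP[/andP[zr' zra] /andP[zL zd]]].
  have [Hp fp] := hp z z0; have := hra z z0 zra; rewrite gt_max => /andP[pr pL].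
  have zp : 0 < cmod z by rewrite (lt_trans ltr01).
  have pp : 0 < cmod (p z) by apply: lt_trans pL; clear - L0; lra.
  pose eta := Log (p z) - Log z - ka%:C.
  have Eeta : cmod eta <= (K / cmod (p z) + K' / cmod z) / S.
    have -> : eta = ((g z - (S%:C * Log z + c')) - (f (p z) - (S%:C * Log (p z) + c))) / S%:C.
      rewrite fp /eta.
      have -> : g z - (S%:C * Log z + c') - (g z - (S%:C * Log (p z) + c)) =
        S%:C * (Log (p z) - Log z) - (c' - c) by ring.
      rewrite Sc; field.
      by rewrite -cmod_gt0 cmod_real normr_gt0 gt_eqF.
    rewrite cmod_div cmod_real (gtr0_norm S0) ler_pM2r ?invr_gt0 //.
    by apply: le_trans (cmodB _ _) _; rewrite addrC; apply: lerD; [apply: asf|apply: asg].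
  have Eeta' : cmod eta <= (`|K| / cmod (p z) + `|K'| / cmod z) / S.
    apply: le_trans Eeta _; rewrite ler_pM2r ?invr_gt0 //.
    by apply: lerD; rewrite ler_pM2r ?invr_gt0 // ler_norm.
  (* Bootstrap: the crude bound 1 already compares |z| with |p z|, and this turns the error K / |p
     z| into a multiple of 1 / |z|. *)
  have eta1 : cmod eta <= 1.
    apply: le_trans Eeta' _.
    apply: (@le_trans _ _ (L / (L + 1))); last by rewrite ler_pdivrMr; clear - L0; lra.
    rewrite /L mulrAC ler_pM2r ?invr_gt0 // -/L mulrDl.
    have LL : 0 < L + 1 by clear - L0; lra.
    by apply: lerD; apply: ler_wpM2l => //; rewrite lef_pV2 ?posrE // ltW.
  have plow : cmod z / cmod (p z) <= expR (1 - ka).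
    rewrite -[cmod z]lnK ?posrE // -[cmod (p z)]lnK ?posrE // -expRN -expRD ler_expR.
    have := le_trans (Re_le_cmod eta) eta1; rewrite /eta !ReB !Re_LogE Re_real ler_norml.
    by clear; lra.
  have eta2 : cmod eta <= L2 / cmod z.
    apply: le_trans Eeta' _; rewrite /L2 mulrAC ler_pM2r ?invr_gt0 // mulrDl.
    rewrite lerD2r -mulrA; apply: ler_wpM2l => //.
    by rewrite ler_pdivlMr // mulrC.
  have etad : cmod eta < d.
    by apply: le_lt_trans eta2 _; rewrite ltr_pdivrMr // mulrC -ltr_pdivrMr.
  have pE : p z = cexp eta * (la%:C * z).
    rewrite -[LHS](cexp_Log (ltW Hp) (Im_neq0 Hp)) -[X in _ * (_ * X)](cexp_Log (ltW z0) (Im_neq0 z0)).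
    have -> : la%:C = cexp ka%:C.
      by apply: complex_ext; rewrite ?Re_cexp ?Im_cexp !ReImE ?cos0 ?sin0 ?mulr1 ?mulr0.
    by rewrite -!cexpD; congr cexp; rewrite /eta; ring.
  have -> : p z - la%:C * z = (cexp eta - 1) * (la%:C * z) by rewrite pE; ring.
  have E1 : cmod (cexp eta - 1) <= 2 * cmod eta.
    have -> : cexp eta - 1 = (cexp eta - 1 - eta) + eta by ring.
    apply: le_trans (cmodD _ _) _; have := hd eta etad.
    by rewrite mul1r; clear; lra.
  rewrite !cmodM cmod_real (gtr0_norm la0).
  apply: le_trans (_ : 2 * (L2 / cmod z) * (la * cmod z) <= _).
    apply: ler_wpM2r; first by rewrite mulr_ge0 ?cmod_ge0 // ltW.
    by apply: le_trans E1 _; rewrite ler_pM2l.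
  have -> : 2 * (L2 / cmod z) * (la * cmod z) = 2 * la * L2.
    by field; rewrite gt_eqF.
  by rewrite lerDl.
(* A point with |z| <= r1 + 1 sent far away could be joined to infinity by a path
   whose preimage never crosses |z| = r1 + 1. *)
have pbnd z : 0 < Im z -> cmod z < r1 + 1 -> cmod (p z) <= la * (r1 + 1) + D.
  move=> z0 zr; rewrite leNgt; apply/negP => far.
  have [Hp fp] := hp z z0.
  pose T := Num.max (la * (r1 + 1) + D) (Im (p z)).
  have T1 : la * (r1 + 1) + D <= T by rewrite le_max lexx.
  have T2 : Im (p z) <= T by rewrite le_max lexx orbT.
  have T0 : 0 < T by apply: lt_le_trans T2.
  clearbody T.
  (* High enough on the imaginary axis for la s - D > T, so that the image of i s lies above height
     T. *)
  pose s := r1 + 1 + (T + D + 1) / la.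
  have s1 : r1 + 1 < s.
    by rewrite /s ltrDl divr_gt0 //; clear - T0 D0; lra.
  have cs : cmod (s *i) = s.
    by rewrite cmodE /= expr0n add0r sqrtr_sqr ger0_norm //; clear - s1 r10; lra.
  have Is : 0 < Im (s *i) by rewrite ImE; clear - s1 r10; lra.
  have Hs := hp _ Is; pose xi := p (s *i).
  have Ixi : T < Im xi.
    have := hD (s *i) Is; rewrite cs => E.
    have {}E := E ltac:(clear - s1; lra).
    have := le_trans (Im_le_cmod _) E; rewrite !ReImE mul0r addr0 ler_norml -/xi.
    have : T + D + 1 <= la * s.
      have -> : la * s = la * (r1 + 1) + (T + D + 1) by rewrite /s; field; rewrite gt_eqF.
      by rewrite lerDr mulr_ge0 //; [exact: ltW|clear - r10; lra].
    by clear; lra.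
  have far_avoid zeta : H zeta -> la * (r1 + 1) + D < cmod zeta -> cmod (q zeta) != r1 + 1.
    move=> Hz; apply: contraTneq => qr; rewrite -leNgt.
    have [Hq gq] := hq _ Hz.
    have pq : p (q zeta) = zeta.
      by have [Hpq fpq] := hp _ Hq; apply: injf; rewrite ?inE // fpq gq.
    have := hD (q zeta) Hq; rewrite qr pq => E.
    have {}E := E ltac:(clear; lra).
    have := cmodD (zeta - la%:C * q zeta) (la%:C * q zeta).
    rewrite subrK cmodM cmod_real (gtr0_norm la0) qr.
    by clear - E; lra.
  (* The path from p z to xi goes up and then sideways. The modulus grows on the vertical leg, and
     on the horizontal leg the height alone exceeds T. *)
  pose xi0 := Re (p z) +i* Im xi.
  have up : cmod (q xi0) < r1 + 1.
    apply: (segment_avoid (a := p z)) => //; last by rewrite qp.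
    move=> t /andP[t0 t1].
    have [d d0 E] : exists2 d, 0 <= d & p z + t%:C * (xi0 - p z) = p z + d *i.
      exists (t * (Im xi - Im (p z))).
        by rewrite mulr_ge0 // subr_ge0; clear - Ixi T2; lra.
      by apply: complex_ext; rewrite /xi0 !ReImE; ring.
    have Hd : H (p z + d *i).
      by move: Hp; rewrite /upper_half_plane /= ImD ImE; clear - d0; lra.
    rewrite E; split => //; apply: far_avoid => //; apply: lt_le_trans far _.
    rewrite -(ler_pXn2r (_ : 0 < 2)%N) ?nnegrE ?cmod_ge0 // !sqr_cmod !ReD !ImD ReE ImE addr0.
    rewrite lerD2l; move: Hp; rewrite /upper_half_plane /=; clear - d0; nra.
  have : cmod (q xi) < r1 + 1.
    apply: (segment_avoid (a := xi0)) => // t _.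
    have [x E] : exists x, xi0 + t%:C * (xi - xi0) = x +i* Im xi.
      exists (Re xi0 + t * (Re xi - Re xi0)).
      by apply: complex_ext; rewrite /xi0 !ReImE; ring.
    have Hx : H (x +i* Im xi) by apply: lt_trans Ixi.
    rewrite E; split => //; apply: far_avoid => //.
    apply: lt_le_trans (Im_le_cmod _); rewrite ImE ger0_norm; first exact: le_lt_trans Ixi.
    by rewrite ltW // (lt_trans T0).
  by rewrite qp // cs ltNge ltW.
have bnd r : exists2 B, 0 < B & forall z, 0 < Im z -> cmod z <= r -> cmod (p z) <= B.
  exists (la * (r1 + 1) + D + la * `|r|).
    by rewrite ltr_pwDl ?mulr_ge0 ?(ltW la0) // addr_gt0 // mulr_gt0 // addr_gt0.
  move=> z z0 zr; have [zr1|zr1] := ltrP (cmod z) (r1 + 1).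
    by apply: le_trans (pbnd z z0 zr1) _; rewrite lerDl mulr_ge0 // ltW.
  have := hD z z0 ltac:(clear - zr1; lra) => E.
  have := cmodD (p z - la%:C * z) (la%:C * z); rewrite subrK cmodM cmod_real (gtr0_norm la0).
  have : la * cmod z <= la * `|r| by rewrite ler_pM2l // (le_trans zr) // ler_norm.
  have : 0 < la * (r1 + 1) by rewrite mulr_gt0 // addr_gt0.
  by clear - E; lra.
(* If Im (p z) > e, then p z lies in a compact rectangle inside the half-plane, on which Im q has a
   positive minimum m; but q (p z) = z, so Im z >= m. *)
have boundary r e : 0 < e -> exists2 h, 0 < h &
    forall z, 0 < Im z < h -> cmod z <= r -> Im (p z) <= e.
  move=> e0; have [B B0 hB] := bnd r.
  have BB : - B < B by clear - B0; lra.
  have eB : e < e + B by clear - B0; lra.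
  have [m m0 hm] : exists2 m, 0 < m & forall zeta, rectangle (- B) B e (e + B) zeta ->
      m <= Im (q zeta).
    apply: rectangle_uniform => //.
      by move=> m m' zeta _ mm' ; exact: le_trans.
    move=> zeta [_ /andP[ez _]].
    have Hz : H zeta by apply: lt_le_trans ez.
    have [Hq _] := hq _ Hz; have q2 : 0 < Im (q zeta) / 2 by rewrite divr_gt0.
    have [d d0 hd] := ccont_shift (cq _ Hz) q2.
    exists d => //; exists (Im (q zeta) / 2) => // t _ /hd tz.
    have := le_lt_trans (Im_le_cmod _) tz; rewrite ImB ltr_norml.
    by clear; lra.
  exists m => // z /andP[z0 zm] zr; rewrite leNgt; apply/negP => ez.
  have pB := hB z z0 zr.
  have Kp : rectangle (- B) B e (e + B) (p z).
    have := le_trans (Re_le_cmod _) pB; have := le_trans (Im_le_cmod _) pB.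
    rewrite !ler_norml => /andP[_ i1] r12.
    by split => //; clear - ez i1 e0; lra.
  by have := hm _ Kp; rewrite qp // leNgt zm.
pose u (z : C) := p z - la%:C * z.
have du : holo_on H u.
  move=> z Hz; have [l dl] := dp z Hz; exists (l + (- la%:C) * 1).
  apply: (cdiff_local (f := fun w => p w + - la%:C * w) (r := 1)) => //.
    by move=> w _; rewrite /u mulNr.
  exact: cdiffD dl (cdiff_mul _ (cdiff_id z)).
have dku (k : C) : holo_on H (fun z => k * u z).
  by move=> z /du[l dl]; exists (k * l); exact: cdiff_mul.
have [B B0 hB] : exists2 B, 0 < B & forall z, 0 < Im z -> cmod (u z) <= B.
  have [B B0 hB] := bnd r1; exists (D + B + la * r1).
    by rewrite addr_gt0 ?addr_gt0 // mulr_gt0.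
  move=> z z0; have := mulr_gt0 la0 r10 => lr.
  have [zr|zr] := ltrP r1 (cmod z).
    by apply: le_trans (hD z z0 zr) _; clear - B0 lr; lra.
  apply: le_trans (cmodB _ _) _; rewrite cmodM cmod_real (gtr0_norm la0).
  have := hB z z0 zr; have : la * cmod z <= la * r1 by rewrite ler_pM2l.
  by clear - D0; lra.
have ImuE z : Im (u z) = Im (p z) - la * Im z.
  by rewrite /u ImB ImM Re_real Im_real mul0r addr0.
have Re_i (z : C) : Re ('i * z) = - Im z.
  by rewrite -[in RHS]Re_mulNi mulNr ReN opprK.
(* The upper estimate of Im u near the axis is the one on Im p just shown; the lower one follows
   from Im p > 0, with [e / la] as the admissible height. *)
have upper z : 0 < Im z -> Re (- 'i * u z) <= 0.
  apply: (half_plane_maximum (B := B) (dku _)).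
    move=> t t0; rewrite Re_mulNi; apply: le_trans (ler_norm _) _.
    exact: le_trans (Im_le_cmod _) (hB t t0).
  move=> r e rp e0; have [h h0 hh] := boundary r e e0; exists h => // t th tr.
  rewrite Re_mulNi ImuE; have := hh t th tr; have /andP[t0 _] := th.
  by have := mulr_gt0 la0 t0; clear; lra.
have lower z : 0 < Im z -> Re ('i * u z) <= 0.
  apply: (half_plane_maximum (B := B) (dku _)).
    move=> t t0; rewrite Re_i; apply: le_trans (ler_norm _) _; rewrite normrN.
    exact: le_trans (Im_le_cmod _) (hB t t0).
  move=> r e rp e0; exists (e / la); first exact: divr_gt0.
  move=> t /andP[t0]; rewrite ltr_pdivlMr // => te tr.
  rewrite Re_i ImuE; have [Hp _] := hp t t0.
  by move: Hp; rewrite /upper_half_plane /=; clear - te; lra.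
have im0 z : 0 < Im z -> Im (u z) = 0.
  move=> z0; have := upper z z0; have := lower z z0; rewrite Re_i Re_mulNi.
  by clear; lra.
have [b hb] := holo_real_cst du im0.
exists b => z z0; have [_ <-] := hp z z0; congr f.
by have := hb z z0; rewrite /u => <-; ring.
Qed.

End HalfPlaneUniqueness.

(** * Sums of logarithms *)

Section LogSum.
Variable R : realType.
Local Notation C := R[i].
Variables (ts : seq (R * R)) (k : C).
Hypothesis ts_pos : forall p, p \in ts -> 0 < p.1.
Hypothesis ts_neq0 : ts != [::].

(* A term (c, t) of ts stands for c * Log (z - t). *)
Definition logsum (z : C) : C := \sum_(p <- ts) p.1%:C * Log (z - p.2%:C) + k.

Definition weight : R := \sum_(p <- ts) p.1.

Definition not_pole (z : C) : Prop := forall p, p \in ts -> z != p.2%:C.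

Lemma Re_sum (I : Type) (r : seq I) (F : I -> C) :
  Re (\sum_(i <- r) F i) = \sum_(i <- r) Re (F i).
Proof.
by elim: r => [|i r IH]; rewrite ?big_nil // !big_cons ReD IH.
Qed.

Lemma Im_sum (I : Type) (r : seq I) (F : I -> C) :
  Im (\sum_(i <- r) F i) = \sum_(i <- r) Im (F i).
Proof.
by elim: r => [|i r IH]; rewrite ?big_nil // !big_cons ImD IH.
Qed.

Lemma Re_logsum z : Re (logsum z) = \sum_(p <- ts) p.1 * ln (cmod (z - p.2%:C)) + Re k.
Proof.
rewrite /logsum ReD Re_sum; congr (_ + _); apply: eq_bigr => p _.
by rewrite ReM Re_real Im_real mul0r subr0.
Qed.

Lemma Im_logsum z : Im (logsum z) = \sum_(p <- ts) p.1 * Im (Log (z - p.2%:C)) + Im k.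
Proof.
rewrite /logsum ImD Im_sum; congr (_ + _); apply: eq_bigr => p _.
by rewrite ImM Re_real Im_real mul0r addr0.
Qed.

Lemma ltr_sum_seq (I : eqType) (r : seq I) (F G : I -> R) : r != [::] ->
  (forall i, i \in r -> F i < G i) -> \sum_(i <- r) F i < \sum_(i <- r) G i.
Proof.
case: r => // i r _ H; rewrite !big_cons; apply: ltr_leD; first by rewrite H ?mem_head.
rewrite big_seq [leRHS]big_seq; apply: ler_sum => j jr.
by rewrite ltW // H // in_cons jr orbT.
Qed.

Lemma sum_seq_gt0 (I : eqType) (r : seq I) (F : I -> R) : r != [::] ->
  (forall i, i \in r -> 0 < F i) -> 0 < \sum_(i <- r) F i.
Proof.
move=> r0 H; have := ltr_sum_seq (F := fun=> 0) r0 H.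
by rewrite big1_eq.
Qed.

Lemma sum_seq_lt0 (I : eqType) (r : seq I) (F : I -> R) : r != [::] ->
  (forall i, i \in r -> F i < 0) -> \sum_(i <- r) F i < 0.
Proof.
move=> r0 H; have := ltr_sum_seq (G := fun=> 0) r0 H.
by rewrite big1_eq.
Qed.

Lemma weight_gt0 : 0 < weight.
Proof. exact: sum_seq_gt0 ts_neq0 ts_pos. Qed.

Lemma Im_shift (z : C) (t : R) : Im (z - t%:C) = Im z.
Proof. by rewrite ImB Im_real subr0. Qed.

Lemma not_pole_uhp z : 0 < Im z -> not_pole z.
Proof. by move=> z0 p _; apply: contraTneq z0 => ->; rewrite ltxx. Qed.

Lemma cdiff_logsum z : 0 < Im z ->
  cdiff logsum z (\sum_(p <- ts) p.1%:C * (z - p.2%:C)^-1).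
Proof.
move=> z0; have -> : \sum_(p <- ts) p.1%:C * (z - p.2%:C)^-1 =
    \sum_(p <- ts) p.1%:C * ((z - p.2%:C)^-1 * (1 + 0)) + 0.
  by rewrite addr0 addr0; apply: eq_bigr => p _; rewrite mulr1.
apply: cdiffD; last exact: cdiff_cst.
apply: cdiff_sum => p; apply: cdiff_mul.
apply: (cdiff_comp (f := fun w => w - p.2%:C)).
  exact: cdiffD (cdiff_id z) (cdiff_cst (- p.2%:C) z).
by apply: cdiff_Log; rewrite Im_shift.
Qed.

(** Every term has negative imaginary part, so there is no cancellation. *)
Lemma logsum_derivative_neq0 z : 0 < Im z ->
  \sum_(p <- ts) p.1%:C * (z - p.2%:C)^-1 != 0.
Proof.
move=> z0; have : Im (\sum_(p <- ts) p.1%:C * (z - p.2%:C)^-1) < 0.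
  rewrite Im_sum.
  apply: sum_seq_lt0 => // p pts.
  rewrite ImM Re_real Im_real mul0r addr0 Im_inv Im_shift.
  rewrite mulNr mulrN oppr_lt0 mulr_gt0 ?ts_pos // divr_gt0 // exprn_gt0 //.
  by rewrite cmod_gt0; apply: Im_neq0; rewrite Im_shift.
by move=> H; apply: contraTneq H => ->; rewrite ltxx.
Qed.

(** Inherited from [Log_monotone] term by term, the weights being positive. Injectivity is the case
    of b in the half-plane; the tips enter as real b. *)
Lemma logsum_monotone (a b : C) : 0 < Im a -> 0 <= Im b -> not_pole b -> a != b ->
  Im ((logsum a - logsum b) * conjc (a - b)) < 0.
Proof.
move=> a0 b0 bp ab.
have -> : (logsum a - logsum b) * conjc (a - b) = \sum_(p <- ts)
    p.1%:C * ((Log (a - p.2%:C) - Log (b - p.2%:C)) * conjc (a - b)).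
  rewrite /logsum opprD addrACA subrr addr0 -sumrB mulr_suml.
  by apply: eq_bigr => p _; ring.
rewrite Im_sum; apply: sum_seq_lt0 => // p pts; rewrite ImM Re_real Im_real mul0r addr0.
rewrite pmulr_rlt0 ?ts_pos //.
have -> : a - b = (a - p.2%:C) - (b - p.2%:C) by ring.
apply: Log_monotone; rewrite ?Im_shift //.
  by rewrite subr_eq0 bp.
by rewrite (inj_eq (addIr _)).
Qed.

Lemma ccontD (f g : C -> C) z : ccont f z -> ccont g z -> ccont (fun w => f w + g w) z.
Proof.
move=> cf cg e e0; have e2 : 0 < e / 2 by lra.
have [d d0 hd] := cf _ e2; have [d' d'0 hd'] := cg _ e2.
exists (Num.min d d') => [|h]; first by rewrite lt_min d0.
rewrite lt_min => /andP[/hd H1 /hd' H2].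
have -> : f (z + h) + g (z + h) - (f z + g z) = (f (z + h) - f z) + (g (z + h) - g z).
  by ring.
by apply: le_lt_trans (cmodD _ _) _; lra.
Qed.

Lemma ccont_mul (f : C -> C) a z : ccont f z -> ccont (fun w => a * f w) z.
Proof.
move=> cf e e0; have A0 : 0 < 1 + cmod a by have := cmod_ge0 a; lra.
have [d d0 hd] := cf _ (divr_gt0 e0 A0).
exists d => // h /hd; rewrite ltr_pdivlMr // => H; rewrite -mulrBr cmodM.
by apply: le_lt_trans H; rewrite mulrC ler_wpM2l ?cmod_ge0 // lerDr.
Qed.

Lemma ccont_logsum z : not_pole z -> ccont logsum z.
Proof.
rewrite /logsum /not_pole => zp; apply: ccontD; last first.
  by move=> e e0; exists 1 => // h _; rewrite subrr cmod0.
elim: ts zp => [|p s IH] zp.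
  by move=> e e0; exists 1 => // h _; rewrite !big_nil subrr cmod0.
have zs : forall q, q \in s -> z != q.2%:C.
  by move=> q qs; apply: zp; rewrite in_cons qs orbT.
have zp0 : z - p.2%:C != 0 by rewrite subr_eq0 zp // mem_head.
have H : ccont (fun w => p.1%:C * Log (w - p.2%:C)) z.
  apply: ccont_mul => e e0; have [d d0 hd] := ccont_Log zp0 e0.
  by exists d => // h /hd; rewrite addrAC.
have := ccontD H (IH zs).
by move=> cH e /cH[d d0 hd]; exists d => // h /hd; rewrite !big_cons.
Qed.

Lemma ln_le_id (x : R) : 0 <= x -> ln x <= x.
Proof.
rewrite le_eqVlt => /predU1P[<-|x0]; first by rewrite ln0.
have := expR_ge1Dx (ln x); rewrite lnK ?posrE //; lra.
Qed.

Lemma Re_logsum_upper z (M : R) : cmod z <= M ->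
  Re (logsum z) <= \sum_(p <- ts) p.1 * (M + `|p.2|) + Re k.
Proof.
move=> zM; rewrite Re_logsum lerD2r big_seq [leRHS]big_seq; apply: ler_sum => p pts.
rewrite ler_pM2l ?ts_pos //; apply: le_trans (ln_le_id (cmod_ge0 _)) _.
by apply: le_trans (cmodB _ _) _; rewrite cmod_real lerD2r.
Qed.

(** One term at x tends to -oo while the others stay below [B] near x. The point x is excluded
    because [ln 0] is 0. *)
Lemma logsum_at_pole (x M : R) : (exists2 p, p \in ts & p.2 = x) ->
  exists2 d, 0 < d & forall z, z != x%:C -> cmod (z - x%:C) < d -> Re (logsum z) < M.
Proof.
move=> [p pts px]; pose B := \sum_(q <- rem p ts) q.1 * (1 + `|x| + `|q.2|) + Re k.
have p0 := ts_pos pts.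
exists (Num.min 1 (expR ((M - B) / p.1))); first by rewrite lt_min ltr01 expR_gt0.
move=> z zx; rewrite lt_min => /andP[z1 z2].
have zp : 0 < cmod (z - x%:C) by rewrite cmod_gt0 subr_eq0.
rewrite Re_logsum (perm_big _ (perm_to_rem pts)) big_cons px -addrA.
have H1 : \sum_(q <- rem p ts) q.1 * ln (cmod (z - q.2%:C)) + Re k <= B.
  rewrite lerD2r big_seq [leRHS]big_seq; apply: ler_sum => q /mem_rem qts.
  rewrite ler_pM2l ?ts_pos //; apply: le_trans (ln_le_id (cmod_ge0 _)) _.
  apply: le_trans (cmodB _ _) _; rewrite cmod_real lerD2r.
  have := cmodD (z - x%:C) x%:C; rewrite subrK cmod_real; lra.
have H2 : p.1 * ln (cmod (z - x%:C)) < M - B.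
  by rewrite mulrC -ltr_pdivlMr // -[ltRHS]expRK ltr_ln ?posrE ?expR_gt0.
lra.
Qed.

Lemma Im_logsum_bounds z : 0 < Im z -> Im k < Im (logsum z) < Im k + pi * weight.
Proof.
move=> z0; rewrite Im_logsum.
have H p : p \in ts -> 0 < Im (Log (z - p.2%:C)) < pi.
  by move=> _; apply: Im_Log_gt0; rewrite Im_shift.
have h1 : 0 < \sum_(p <- ts) p.1 * Im (Log (z - p.2%:C)).
  apply: sum_seq_gt0 => // p pts; have /andP[h _] := H p pts.
  by rewrite mulr_gt0 ?ts_pos.
have h2 : \sum_(p <- ts) p.1 * Im (Log (z - p.2%:C)) < pi * weight.
  rewrite mulr_sumr; apply: ltr_sum_seq => // p pts; have /andP[_ h] := H p pts.
  by rewrite mulrC ltr_pM2r ?ts_pos.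
lra.
Qed.

Lemma Im_logsum_real (x : R) : not_pole x%:C ->
  Im (logsum x%:C) = pi * \sum_(p <- ts | x < p.2) p.1 + Im k.
Proof.
move=> xp; rewrite Im_logsum; congr (_ + _); rewrite mulr_sumr [RHS]big_mkcond.
rewrite big_seq [RHS]big_seq; apply: eq_bigr => p /xp xpn.
have -> : x%:C - p.2%:C = (x - p.2)%:C by apply: complex_ext; rewrite !ReImE ?subrr.
case: ltgtP xpn => [h _|h _|->]; last by rewrite eqxx.
  by rewrite Log_neg ?subr_lt0 //= mulrC.
by rewrite Log_pos ?subr_gt0 //= mulr0.
Qed.

Lemma Im_logsum_decreasing z (x : R) : 0 < Im z -> 0 < x ->
  Im (logsum (z + x%:C)) < Im (logsum z).
Proof.
move=> z0 x0; rewrite !Im_logsum ltrD2r; apply: ltr_sum_seq => // p pts.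
rewrite ltr_pM2l ?ts_pos // addrAC; apply: Im_Log_decreasing => //.
by rewrite Im_shift.
Qed.

Hypothesis ts01 : forall p, p \in ts -> 0 <= p.2 <= 1.

Lemma Re_logsum_infty z : 1 < cmod z -> 
  weight * ln (cmod z - 1) + Re k <= Re (logsum z).
Proof.
move=> z1; rewrite Re_logsum lerD2r mulr_suml big_seq [leRHS]big_seq.
apply: ler_sum => p pts; rewrite ler_pM2l ?ts_pos //.
have /andP[p0 p1] := ts01 pts.
have := lerB_cmod z p.2%:C; rewrite cmod_real ger0_norm // => h.
have zp : cmod z - 1 <= cmod (z - p.2%:C) by lra.
by rewrite ler_ln ?posrE //; lra.
Qed.

Lemma logsum_asymptotic z : 0 < Im z -> 2 <= cmod z ->
  cmod (logsum z - (weight%:C * Log z + k)) <= weight * 4 / cmod z.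
Proof.
move=> z0 z2.
have -> : logsum z - (weight%:C * Log z + k) =
    \sum_(p <- ts) p.1%:C * (Log (z - p.2%:C) - Log z).
  rewrite /logsum /weight rmorph_sum mulr_suml opprD addrACA subrr addr0 -sumrB.
  by apply: eq_bigr => p _; rewrite mulrBr.
apply: le_trans (_ : \sum_(p <- ts) cmod (p.1%:C * (Log (z - p.2%:C) - Log z)) <= _).
  elim: ts => [|p s IH]; first by rewrite !big_nil cmod0.
  by rewrite !big_cons; apply: le_trans (cmodD _ _) _; rewrite lerD2l.
rewrite -mulrA mulr_suml big_seq [leRHS]big_seq; apply: ler_sum => p pts.
have p0 := ts_pos pts.
by rewrite cmodM cmod_real gtr0_norm // ler_pM2l // Log_shift_bound // ts01.
Qed.

End LogSum.

(** * Surjectivity through the level curves of the imaginary part *)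

Section LogSumSurjective.
Variable R : realType.
Local Notation C := R[i].
Variables (ts : seq (R * R)) (k : C).
Hypothesis ts_pos : forall p, p \in ts -> 0 < p.1.
Hypothesis ts_neq0 : ts != [::].
Hypothesis ts01 : forall p, p \in ts -> 0 <= p.2 <= 1.
Local Notation w := (logsum ts k).

Lemma shiftE (x y t : R) : x +i* y - t%:C = (x - t) +i* y.
Proof. by apply: complex_ext; rewrite !ReImE ?subr0. Qed.

Lemma Im_logsum_right (v y0 : R) : 0 < y0 -> Im k < v ->
  exists2 B, 1 < B & forall x y, 0 < y <= y0 -> B <= x -> Im (w (x +i* y)) < v.
Proof.
move=> y00 kv; have W := weight_gt0 ts_pos ts_neq0.
have e0 : 0 < (v - Im k) / weight ts by rewrite divr_gt0 // subr_gt0.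
have [d d0 hd] := Im_Log_right e0.
have yd : 0 < y0 / d by rewrite divr_gt0.
exists (2 + y0 / d); first lra.
move=> x y /andP[yp yy0] xB; rewrite Im_logsum -ltrBrDr.
rewrite -[ltRHS](divfK (lt0r_neq0 W)) /weight mulr_sumr.
apply: ltr_sum_seq => // p pts; rewrite mulrC ltr_pM2r ?ts_pos // shiftE.
apply: hd => //; have /andP[_ p1] := ts01 pts.
apply: le_lt_trans yy0 _; rewrite mulrC -ltr_pdivrMr //; lra.
Qed.

Lemma Im_logsum_left (v y0 : R) : 0 < y0 -> v < Im k + pi * weight ts ->
  exists2 B, 1 < B & forall x y, 0 < y <= y0 -> x <= - B -> v < Im (w (x +i* y)).
Proof.
move=> y00 kv; have W := weight_gt0 ts_pos ts_neq0.
pose e := (Im k + pi * weight ts - v) / weight ts.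
have e0 : 0 < e by rewrite divr_gt0 // subr_gt0.
have [d d0 hd] := Im_Log_left e0.
have yd : 0 < y0 / d by rewrite divr_gt0.
exists (2 + y0 / d); first lra.
move=> x y /andP[yp yy0] xB; rewrite Im_logsum -ltrBlDr.
have -> : v - Im k = (pi - e) * weight ts by rewrite /e; field; rewrite gt_eqF.
rewrite /weight mulr_sumr.
apply: ltr_sum_seq => // p pts; rewrite mulrC ltr_pM2l ?ts_pos // shiftE.
apply: hd => //; have /andP[p0 p1] := ts01 pts.
apply: le_lt_trans yy0 _; rewrite mulrC -ltr_pdivrMr //; lra.
Qed.

Lemma logsum_level (v y : R) : Im k < v < Im k + pi * weight ts -> 0 < y ->
  exists x, Im (w (x +i* y)) = v.
Proof.
move=> /andP[kv vk] y0.
have [B B1 hB] := Im_logsum_right y0 kv; have [B' B'1 hB'] := Im_logsum_left y0 vk.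
have BB : - B' <= B by lra.
have cg : {within `[- B', B], continuous (fun x => Im (w (x +i* y)))}.
  apply: continuous_in_subspaceT => x _; apply: ccont_horizontal.
  exact: cdiff_cont (cdiff_logsum ts k _).
have h1 := hB B y; have h2 := hB' (- B') y.
have [|x _ <-] := @IVT R (fun x => Im (w (x +i* y))) _ _ v BB cg; last by exists x.
rewrite y0 lexx in h1 h2; have {}h1 := h1 isT (lexx _); have {}h2 := h2 isT (lexx _).
by rewrite ge_min le_max (ltW h1) (ltW h2) orbT.
Qed.

Lemma logsum_level_unique (x x' y : R) : 0 < y ->
  Im (w (x +i* y)) = Im (w (x' +i* y)) -> x = x'.
Proof.
move=> y0; wlog : x x' / x < x' => [H|xx'] E.
  have [xx'|xx'|//] := ltgtP x x'; first exact: H.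
  by apply/esym; apply: H => //; rewrite E.
have xx0 : 0 < x' - x by rewrite subr_gt0.
have := @Im_logsum_decreasing _ ts k ts_pos ts_neq0 (x +i* y) _ y0 xx0.
have -> : x +i* y + (x' - x)%:C = x' +i* y by apply: complex_ext; rewrite !ReImE; ring.
by rewrite E ltxx.
Qed.

(* The level set Im w = v is a graph over the imaginary axis, along which Re w is
   continuous and tends to +oo. *)
Lemma logsum_level_ivt (z0 : C) (u : R) : 0 < Im z0 -> Re (w z0) <= u ->
  exists2 z, 0 < Im z & w z = u +i* Im (w z0).
Proof.
move=> z00 z0u; set v := Im (w z0).
have vb : Im k < v < Im k + pi * weight ts := Im_logsum_bounds k ts_pos ts_neq0 z00.
have [X hX] : exists X : R -> R, forall y, 0 < y -> Im (w (X y +i* y)) = v.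
  pose P y x := 0 < y -> Im (w (x +i* y)) = v.
  have /choice[X hX] : forall y, exists x, P y x.
    move=> y; have [y0|y0] := ltrP 0 y; last by exists 0; rewrite /P ltNge y0.
    by have [x hx] := logsum_level vb y0; exists x.
  by exists X.
have W := weight_gt0 ts_pos ts_neq0.
(* At this height |z| - 1 is at least the exponential, so weight ln (|z| - 1) + Re k is at least u,
   and the level curve has passed u. *)
pose Y := expR ((`|u| + `|Re k|) / weight ts) + 1 + Im z0.
have E0 := expR_gt0 ((`|u| + `|Re k|) / weight ts).
have Y0 : 0 < Y by rewrite /Y; lra.
have YZ : Im z0 <= Y by rewrite /Y; lra.
have YG : u <= Re (w (X Y +i* Y)).
  have Yc : Y <= cmod (X Y +i* Y).
    by apply: le_trans (Im_le_cmod _); rewrite ImE ler_norm.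
  have c1 : 1 < cmod (X Y +i* Y) by apply: lt_le_trans Yc; rewrite /Y; lra.
  apply: le_trans (Re_logsum_infty k ts_pos ts01 c1).
  have H : (`|u| + `|Re k|) / weight ts <= ln (cmod (X Y +i* Y) - 1).
    rewrite -[leLHS]expRK ler_ln ?posrE //; last by rewrite subr_gt0.
    by rewrite lerBrDr; apply: le_trans Yc; rewrite /Y; lra.
  move: H; rewrite ler_pdivrMr // mulrC => H.
  have := ler_norm u; have := lerNnormlW (lexx `|Re k|); clear - H k ts_pos ts_neq0 ts01; lra.
have XE : X (Im z0) = Re z0.
  apply: (logsum_level_unique z00); rewrite hX // /v; congr (Im (w _)).
  exact: complex_ext.
have contw y : 0 < y -> ccont w (X y +i* y).
  by move=> y0; apply: (cdiff_cont (cdiff_logsum ts k _)).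
(* At height y the value v lies strictly between those of Im w at X y + e and X y - e. This persists
   at nearby heights, and monotonicity traps X there. *)
have contX y e : 0 < y -> 0 < e ->
    exists2 d, 0 < d & forall y', `|y' - y| < d -> `|X y' - X y| < e.
  move=> y0 e0.
  have dec x : 0 < x -> forall x0, Im (w ((x0 + x) +i* y)) < Im (w (x0 +i* y)).
    move=> x0' x0.
    have -> : (x0 + x) +i* y = x0 +i* y + x%:C by apply: complex_ext; rewrite !ReImE; ring.
    exact: Im_logsum_decreasing.
  have cv x : {for y, continuous (fun y => Im (w (x +i* y)))}.
    have cw : ccont (fun z => - 'i * w z) (x +i* y).
      exact/ccont_mul/(cdiff_cont (cdiff_logsum ts k _)).
    have := ccont_vertical cw.
    rewrite (_ : (fun y => Re _) = (fun y => Im (w (x +i* y)))) //.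
    by apply/funext => t; rewrite Re_mulNi.
  have e1 : 0 < v - Im (w ((X y + e) +i* y)) by rewrite subr_gt0 -(hX y y0) dec.
  have e2 : 0 < Im (w ((X y - e) +i* y)) - v.
    by rewrite subr_gt0 -(hX y y0) -[X in Im (w (X +i* _)) < _](subrK e) dec.
  have [d1 d10 H1] := continuousP_epsilon (cv (X y + e)) e1.
  have [d2 d20 H2] := continuousP_epsilon (cv (X y - e)) e2.
  exists (Num.min y (Num.min d1 d2)); first by rewrite !lt_min y0 d10.
  move=> y'; rewrite !lt_min => /and3P[h0 /H1 h1 /H2 h2].
  have y'0 : 0 < y' by move: h0; rewrite ltr_norml; clear - k ts_pos ts_neq0 ts01; lra.
  have dec' x x' : x <= x' -> Im (w (x' +i* y')) <= Im (w (x +i* y')).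
    rewrite le_eqVlt => /predU1P[-> //|xx']; have xx0 : 0 < x' - x by rewrite subr_gt0.
    have -> : x' +i* y' = x +i* y' + (x' - x)%:C by apply: complex_ext; rewrite !ReImE; ring.
    by apply: ltW; exact: Im_logsum_decreasing.
  have E := hX y' y'0; move: h1 h2; rewrite !ltr_norml => h1 h2.
  apply/andP; split; rewrite ltNge; apply/negP => h.
    have h' : X y' <= X y - e by clear - h k ts_pos ts_neq0 ts01; lra.
    by have := dec' _ _ h'; rewrite E; clear - h2 k ts_pos ts_neq0 ts01; lra.
  have h' : X y + e <= X y' by clear - h k ts_pos ts_neq0 ts01; lra.
  by have := dec' _ _ h'; rewrite E; clear - h1 k ts_pos ts_neq0 ts01; lra.
have contG : {within `[Im z0, Y], continuous (fun y => Re (w (X y +i* y)))}.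
  apply: continuous_in_subspaceT => y; rewrite inE /= in_itv /= => /andP[zy _].
  have y0 : 0 < y := lt_le_trans z00 zy.
  apply/cvgrPdist_lt => e e0.
  have [d d0 hd] := ccont_shift (contw y y0) e0.
  have d2 : 0 < d / 2 by rewrite divr_gt0.
  have [d' d'0 hd'] := contX y _ y0 d2.
  have m0 : 0 < Num.min d' (d / 2) by rewrite lt_min d'0.
  have := @nbhsx_ballx _ _ y _ m0; apply: filterS => y'.
  rewrite -ball_normE /= lt_min distrC => /andP[/hd' h1 h2].
  rewrite distrC -ReB; apply: le_lt_trans (Re_le_cmod _) _; apply: hd.
  by apply: le_lt_trans (cmod_le_ReIm _) _; rewrite ReB ImB !ReE !ImE; clear - h1 h2 k ts_pos ts_neq0 ts01; lra.
have G0 : Re (w (X (Im z0) +i* Im z0)) <= u.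
  by rewrite XE (_ : _ +i* _ = z0) //; exact: complex_ext.
have [|y] := @IVT R (fun y => Re (w (X y +i* y))) _ _ u YZ contG.
  by rewrite ge_min le_max G0 YG orbT.
rewrite in_itv /= => /andP[zy _] yE; have y0 : 0 < y := lt_le_trans z00 zy.
by exists (X y +i* y) => //; apply: complex_ext; rewrite ?yE ?hX.
Qed.

(** If some point at level v has Re w <= u, the level curve leads from it to u. Otherwise Re w > u
    on the whole level set, which then keeps a distance m from the real axis: near a pole Re w tends
    to -oo, near a real point at level v it is below u, and near the other real points the level is
    missed. But every height carries a point of the level set. *)
Lemma logsum_surjective (u v : R) : Im k < v < Im k + pi * weight ts ->
  (forall x : R, not_pole ts x%:C -> Im (w x%:C) = v -> Re (w x%:C) < u) ->
  exists2 z, 0 < Im z & w z = u +i* v.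
Proof.
move=> vb real_lt; have /andP[kv vk] := vb.
have [[z z0 [zv zu]]|noz] := pselect (exists2 z, 0 < Im z & Im (w z) = v /\ Re (w z) <= u).
  by have [z' z'0] := logsum_level_ivt z0 zu; rewrite zv; exists z'.
have {noz} big z : 0 < Im z -> Im (w z) = v -> u < Re (w z).
  by move=> z0 zv; rewrite ltNge; apply/negP => zu; apply: noz; exists z.
have [B B1 hB] := Im_logsum_right ltr01 kv; have [B' B'1 hB'] := Im_logsum_left ltr01 vk.
have BB : - B' < B by lra.
have [m m0 hm] : exists2 m, 0 < m & forall z, rectangle (- B') B 0 1 z ->
    0 < Im z -> Im (w z) = v -> m <= Im z.
  apply: rectangle_uniform => //.
    by move=> m m' z _ mm' H z0 /(H z0); exact: le_trans.
  move=> z [_ /andP[]]; rewrite le_eqVlt => /predU1P[z0|z0] _; last first.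
    exists (Im z / 2); first by rewrite divr_gt0.
    exists (Im z / 2); first by rewrite divr_gt0.
    move=> t _ tz _ _; have := le_lt_trans (Im_le_cmod _) tz; rewrite ImB ltr_norml.
    by clear - k ts_pos ts_neq0 ts01; lra.
  have zx : z = (Re z)%:C by apply: complex_ext.
  have [np|p] := pselect (not_pole ts z); last first.
    have [q qts qz] : exists2 q, q \in ts & q.2 = Re z.
      apply: contrapT => H; apply: p => q qts; apply/eqP => zq; apply: H.
      by exists q => //; rewrite zq.
    have := @logsum_at_pole _ ts k ts_pos (Re z) u; rewrite -zx.
    case; [by exists q|move=> d d0 hd].
    exists d => //; exists 1 => // t _ tz t0 tv; exfalso.
    have tnz : t != z by apply: contraTneq t0 => ->; rewrite -z0 ltxx.
    by have := big t t0 tv; rewrite ltNge ltW // hd.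
  have cz := ccont_logsum k np.
  have [vz|vz] := eqVneq (Im (w z)) v; last first.
    have d0 : 0 < `|Im (w z) - v| by rewrite normr_gt0 subr_eq0.
    have [d dp hd] := ccont_shift cz d0.
    exists d => //; exists 1 => // t _ /hd tz t0 tv; exfalso.
    have := le_lt_trans (Im_le_cmod _) tz.
    by rewrite ImB tv distrC ltxx.
  have uz : Re (w z) < u by rewrite zx; apply: real_lt; rewrite -zx.
  have d0 : 0 < u - Re (w z) by rewrite subr_gt0.
  have [d dp hd] := ccont_shift cz d0.
  exists d => //; exists 1 => // t _ /hd tz t0 tv; exfalso.
  have := le_lt_trans (Re_le_cmod _) tz; have := big t t0 tv.
  by rewrite ReB ltr_norml; clear - k ts_pos ts_neq0 ts01; lra.
exfalso; pose y := Num.min 1 (m / 2).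
have [y0 y1 ym] : [/\ 0 < y, y <= 1 & y < m].
  split; first by rewrite lt_min ltr01 divr_gt0.
    by rewrite ge_min lexx.
  by rewrite gt_min; apply/orP; right; clear - m0 k ts_pos ts_neq0 ts01; lra.
have [x xv] := logsum_level vb y0.
have : m <= Im (x +i* y).
  apply: hm => //; split; rewrite ?ReE ?ImE ?(ltW y0) ?y1 //.
  apply/andP; split; rewrite leNgt; apply/negP => h.
    by have := hB' x y; rewrite y0 y1 ltW // xv ltxx => /(_ isT isT).
  by have := hB x y; rewrite y0 y1 ltW // xv ltxx => /(_ isT isT).
by rewrite ImE leNgt ym.
Qed.

Lemma logsum_injective (a b : C) : 0 < Im a -> 0 < Im b -> w a = w b -> a = b.
Proof.
move=> a0 b0 ab; apply/eqP; apply: contraT => nab.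
have := logsum_monotone k ts_pos ts_neq0 a0 (ltW b0) (@not_pole_uhp _ ts b b0) nab.
by rewrite ab subrr mul0r ltxx.
Qed.

End LogSumSurjective.

(** * Extremal weighted polynomials on [0, 1] *)

Section ExtremalZeros.
Variable R : realType.

Definition in01 (s : R) : bool := 0 <= s <= 1.

Definition zero_prod (xs : seq R) (s : R) : R := \prod_(x <- xs) (s - x).

Lemma zero_prod_cons x xs s : zero_prod (x :: xs) s = (s - x) * zero_prod xs s.
Proof. exact: big_cons. Qed.

Lemma zero_prod_cat xs ys s : zero_prod (xs ++ ys) s = zero_prod xs s * zero_prod ys s.
Proof. exact: big_cat. Qed.

Lemma in01_dist (s x : R) : in01 s -> in01 x -> `|s - x| <= 1.
Proof. by rewrite /in01 ler_norml; lra. Qed.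

Lemma zero_prod_le1 xs s : in01 s -> all in01 xs -> `|zero_prod xs s| <= 1.
Proof.
move=> s01; elim: xs => [|x xs IH] /=; first by rewrite /zero_prod big_nil normr1.
move=> /andP[x01 /IH H]; rewrite zero_prod_cons normrM.
by rewrite -[leRHS]mulr1; apply: ler_pM => //; exact: in01_dist.
Qed.

Definition seq_dist (xs ys : seq R) : R := \sum_(z <- zip xs ys) `|z.1 - z.2|.

Lemma zero_prod_lipschitz xs ys s : size xs = size ys -> in01 s ->
  all in01 xs -> all in01 ys -> `|zero_prod xs s - zero_prod ys s| <= seq_dist xs ys.
Proof.
move=> + s01; elim: xs ys => [|x xs IH] [|y ys] //=.
  by rewrite /zero_prod /seq_dist !big_nil subrr normr0.
move=> [sz] /andP[x01 xs01] /andP[y01 ys01]; rewrite !zero_prod_cons /seq_dist /= big_cons.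
have -> : (s - x) * zero_prod xs s - (s - y) * zero_prod ys s =
  (y - x) * zero_prod xs s + (s - y) * (zero_prod xs s - zero_prod ys s) by ring.
apply: le_trans (ler_normD _ _) _; rewrite !normrM; apply: lerD.
  by rewrite distrC ler_piMr // zero_prod_le1.
rewrite -[leRHS]mul1r; apply: ler_pM => //; first exact: in01_dist.
exact: IH.
Qed.

(** A 1-Lipschitz retraction onto [0, 1], which extends a function on the interval to one continuous
    on the whole line. *)
Definition clamp (t : R) : R := Num.max 0 (Num.min 1 t).

Lemma clamp01 t : in01 (clamp t).
Proof. by rewrite /in01 /clamp le_max lexx ge_max ge_min lexx ler01. Qed.

Lemma clamp_id t : in01 t -> clamp t = t.
Proof. by move=> /andP[t0 t1]; rewrite /clamp min_r // max_r. Qed.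

Lemma clamp_dist s t : `|clamp s - clamp t| <= `|s - t|.
Proof.
have h1 := ler_norm (s - t); have h2 := lerNnormlW (lexx `|s - t|).
have h3 := normr_ge0 (s - t).
rewrite /clamp ler_norml.
by case: (leP 1 s) => hs; case: (leP 1 t) => ht; rewrite ?(max_r ler01);
  do ?[case: (leP 0 s) => hs0]; do ?[case: (leP 0 t) => ht0]; lra.
Qed.

Lemma lipschitz_continuous (g : R -> R) (L : R) :
  (forall s t, g s <= g t + L * `|s - t|) -> continuous g.
Proof.
move=> gL t; apply/cvgrPdist_lt => e e0.
have L0 : 0 < 1 + `|L| by rewrite ltr_pwDl.
have := @nbhsx_ballx _ _ t _ (divr_gt0 e0 L0); apply: filterS => s.
rewrite -ball_normE /= ltr_pdivlMr // => H.
have h1 := gL s t; have h2 := gL t s; rewrite distrC in h1.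
have h3 : L * `|t - s| <= `|L| * `|t - s| by rewrite ler_wpM2r // ler_norm.
have := normr_ge0 (t - s); rewrite ltr_norml; clear - h1 h2 h3 H; lra.
Qed.

(** Minimize over one variable at a time: after minimizing over the tail, the value is still
    Lipschitz in the head with the same constant. *)
Lemma lipschitz_seq_min (n : nat) (f : seq R -> R) (L : R) : 0 <= L ->
  (forall xs ys, size xs = n -> size ys = n -> all in01 xs -> all in01 ys ->
     f xs <= f ys + L * seq_dist xs ys) ->
  exists xs, [/\ size xs = n, all in01 xs &
    forall ys, size ys = n -> all in01 ys -> f xs <= f ys].
Proof.
move=> L0; elim: n f => [|n IH] f fL.
  by exists [::]; split => // -[].
have /choice[m hm] : forall t, exists xs, in01 t -> [/\ size xs = n, all in01 xs &
    forall ys, size ys = n -> all in01 ys -> f (t :: xs) <= f (t :: ys)].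
  move=> t; have [t01|nt] := boolP (in01 t); last by exists [::].
  have [|xs Hxs] := IH (fun ys => f (t :: ys)); last by exists xs.
  move=> xs ys sx sy ax ay; apply: le_trans (fL _ (t :: ys) _ _ _ _) _;
    rewrite /= ?sx ?sy ?t01 //.
  by rewrite /seq_dist /= big_cons subrr normr0 add0r.
pose g t := f (clamp t :: m (clamp t)).
have gL : forall s t, g s <= g t + L * `|s - t|.
  move=> s t; have [s1 s2 s3] := hm _ (clamp01 s); have [t1 t2 _] := hm _ (clamp01 t).
  apply: le_trans (s3 _ t1 t2) _.
  apply: le_trans (fL _ (clamp t :: m (clamp t)) _ _ _ _) _; rewrite /= ?t1 ?clamp01 //.
  rewrite lerD2l; apply: ler_wpM2l => //; rewrite /seq_dist /= big_cons.
  rewrite (_ : \sum_(z <- _) _ = 0) ?addr0 ?clamp_dist //.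
  by elim: (m (clamp t)) => [|x xs E]; rewrite ?big_nil //= big_cons subrr normr0 add0r.
have [t t01 tmin] := @EVT_min R g 0 1 ler01 (continuous_subspaceT (lipschitz_continuous gL)).
have {}t01 : in01 t by move: t01; rewrite in_itv.
have [s1 s2 s3] := hm t t01; exists (t :: m t); split; rewrite /= ?s1 ?t01 //.
move=> [|y ys] //= [sy] /andP[y01 ay].
have [r1 r2 r3] := hm y y01; apply: le_trans (r3 ys sy ay).
have := tmin y; rewrite in_itv /= => /(_ y01).
by rewrite /g !clamp_id.
Qed.

Variable W : R -> R.
Hypothesis W_cont : continuous W.
Hypothesis W_ge0 : forall s, 0 <= W s.
Hypothesis W_gt0 : forall s, 0 < s < 1 -> 0 < W s.

Definition wprod (xs : seq R) (s : R) : R := W s * zero_prod xs s.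

Definition wnorm (xs : seq R) : R := sup [set `|wprod xs s| | s in [set s | in01 s]].

Lemma zero_prod_continuous xs : continuous (zero_prod xs).
Proof.
elim: xs => [|x xs IH] s.
  by rewrite /zero_prod (_ : (fun _ => _) = cst 1); [exact: cvg_cst|apply/funext => t; rewrite big_nil].
rewrite (_ : zero_prod (x :: xs) = (fun t => (t - x) * zero_prod xs t)); last first.
  by apply/funext => t; rewrite zero_prod_cons.
apply: cvgM; last exact: IH.
by apply: cvgB; [exact: cvg_id|exact: cvg_cst].
Qed.

Lemma wprod_continuous xs : continuous (fun s => `|wprod xs s|).
Proof.
move=> s; apply: cvg_norm; apply: cvgM; first exact: W_cont.
exact: zero_prod_continuous.
Qed.

Lemma wprod_max_on xs a b : a <= b ->
  exists2 s, a <= s <= b & forall t, a <= t <= b -> `|wprod xs t| <= `|wprod xs s|.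
Proof.
move=> ab; have [s sab smax] := EVT_max ab (continuous_subspaceT (@wprod_continuous xs)).
by exists s; [move: sab|move=> t tab; apply: smax]; rewrite in_itv.
Qed.

Lemma wnorm_ub xs s : in01 s -> `|wprod xs s| <= wnorm xs.
Proof.
move=> s01; apply: ub_le_sup; last by exists s.
have [t t01 tmax] := wprod_max_on xs (@ler01 R).
by exists `|wprod xs t| => _ [u u01 <-]; exact: tmax.
Qed.

Lemma wnorm_le xs e : (forall s, in01 s -> `|wprod xs s| <= e) -> wnorm xs <= e.
Proof.
move=> H; apply: ge_sup; first by exists `|wprod xs 0|, 0 => //; rewrite /= /in01 lexx ler01.
by move=> _ [s s01 <-]; exact: H.
Qed.

Lemma wnorm_lt xs e : (forall s, in01 s -> `|wprod xs s| < e) -> wnorm xs < e.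
Proof.
move=> H; have [t t01 tmax] := wprod_max_on xs (@ler01 R).
exact: le_lt_trans (wnorm_le tmax) (H t t01).
Qed.

Lemma wnorm_lipschitz : exists2 L, 0 <= L & forall xs ys, size xs = size ys ->
  all in01 xs -> all in01 ys -> wnorm xs <= wnorm ys + L * seq_dist xs ys.
Proof.
have [t t01 tmax] := wprod_max_on [::] (@ler01 R).
exists `|wprod [::] t| => // xs ys sz ax ay; apply: wnorm_le => s s01.
have -> : wprod xs s = wprod ys s + W s * (zero_prod xs s - zero_prod ys s).
  by rewrite /wprod; ring.
apply: le_trans (ler_normD _ _) _; apply: lerD; first exact: wnorm_ub.
rewrite normrM; apply: ler_pM => //; last exact: zero_prod_lipschitz.
by have := tmax s s01; rewrite {1}/wprod /zero_prod big_nil mulr1.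
Qed.

Lemma avoid_seq (xs : seq R) (a b : R) : a < b ->
  exists2 s, a < s < b & s \notin xs.
Proof.
elim: xs a b => [|x xs IH] a b ab; first by exists ((a + b) / 2) => //; lra.
have [xm|mx] := lerP x ((a + b) / 2).
  have [|s sab sxs] := IH ((a + b) / 2) b; first lra.
  exists s; first lra.
  by rewrite in_cons negb_or sxs andbT; apply/eqP => sx; lra.
have [|s sab sxs] := IH a ((a + b) / 2); first lra.
exists s; first lra.
by rewrite in_cons negb_or sxs andbT; apply/eqP => sx; lra.
Qed.

Lemma zero_prod_neq0 xs s : s \notin xs -> zero_prod xs s != 0.
Proof.
elim: xs => [|x xs IH]; first by rewrite /zero_prod big_nil oner_eq0.
rewrite in_cons negb_or zero_prod_cons => /andP[sx /IH h].
by rewrite mulf_neq0 // subr_eq0.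
Qed.

Lemma wnorm_gt0 xs : 0 < wnorm xs.
Proof.
have [s s01 sxs] := avoid_seq xs (@ltr01 R).
apply: lt_le_trans (wnorm_ub xs (_ : in01 s)); last by rewrite /in01; lra.
rewrite normr_gt0 mulf_neq0 ?zero_prod_neq0 // gt_eqF //; exact: W_gt0.
Qed.

Lemma wnorm_perm xs ys : perm_eq xs ys -> wnorm xs = wnorm ys.
Proof.
move=> pxy; congr sup; apply/seteqP.
by split => _ [s s01 <-]; exists s => //; rewrite /wprod /zero_prod (perm_big _ pxy).
Qed.

(** * Equioscillation of a minimizer *)

Section Minimizer.
Variables (n : nat) (xs : seq R).
Hypothesis sz : size xs = n.
Hypothesis xs_min : forall ys, size ys = n -> all in01 ys -> wnorm xs <= wnorm ys.

(* If the weighted maximum over [a, b] were smaller than the norm, then replacing xs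
   by ys d for small d would decrease the norm. *)
Lemma gap_attains (a b d1 : R) (ys : R -> seq R) : 0 <= a -> a <= b -> b <= 1 -> 0 < d1 ->
  (forall d, 0 < d < d1 -> [/\ size (ys d) = n, all in01 (ys d),
     forall s, in01 s -> `|zero_prod (ys d) s - zero_prod xs s| <= 2 * d &
     forall s, in01 s -> (s < a - d) || (b + d < s) ->
       zero_prod (ys d) s = 0 \/ `|zero_prod (ys d) s| < `|zero_prod xs s|]) ->
  exists2 s, a <= s <= b & `|wprod xs s| = wnorm xs.
Proof.
move=> a0 ab b1 d10 Hys; have E0 := wnorm_gt0 xs; set E := wnorm xs in E0 *.
have [c cab cmax] := wprod_max_on xs ab.
have c01 : in01 c by rewrite /in01; lra.
have [cE|Ec] := ltrP `|wprod xs c| E; last first.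
  by exists c => //; apply/eqP; rewrite eq_le wnorm_ub.
have [L L0 hL] : exists2 L, 0 < L & forall s, in01 s -> W s <= L.
  have [t t01 tmax] := wprod_max_on [::] (@ler01 R).
  exists (1 + `|wprod [::] t|); first by rewrite ltr_pwDl.
  move=> s /tmax; rewrite {1}/wprod /zero_prod big_nil mulr1 ger0_norm // => H.
  by apply: le_trans H _; rewrite lerDr.
(* A third of the slack pays for leaving [a, b] by less than [ra] or [rb], another third for the
   change of the zeros. *)
pose eta := (E - `|wprod xs c|) / 3.
have eta0 : 0 < eta by rewrite divr_gt0 // subr_gt0.
have cEeta : `|wprod xs c| + 3 * eta = E by rewrite /eta; field.
have near_end e : a <= e <= b -> exists2 r, 0 < r &
    forall s, `|s - e| < r -> `|wprod xs s| < E - eta.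
  move=> eab; have [r r0 hr] := continuousP_epsilon (@wprod_continuous xs e) eta0.
  exists r => // s /hr; rewrite ltr_norml => /andP[_].
  by have := cmax e eab; clear - cEeta eta0; lra.
have [ra ra0 hra] := near_end a ltac:(by rewrite lexx ab).
have [rb rb0 hrb] := near_end b ltac:(by rewrite lexx ab).
have [d [d0 [dd1 dra drb deta]]] : exists d, 0 < d /\ [/\ d < d1, d < ra, d < rb &
    L * (2 * d) < eta].
  pose m := Num.min (Num.min d1 ra) (Num.min rb (eta / (2 * L))).
  have m0 : 0 < m by rewrite !lt_min d10 ra0 rb0 divr_gt0 // mulr_gt0.
  have m1 : m <= d1 by rewrite !ge_min lexx.
  have m2 : m <= ra by rewrite !ge_min lexx orbT.
  have m3 : m <= rb by rewrite !ge_min lexx ?orbT.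
  have m4 : m * (2 * L) <= eta.
    by rewrite -ler_pdivlMr ?mulr_gt0 // !ge_min lexx ?orbT.
  exists (m / 2); split; first by rewrite divr_gt0.
  by split; clear - m0 m1 m2 m3 m4 L0 eta0; nra.
have [sy ay ydist yout] := Hys d ltac:(by rewrite d0 dd1).
suff : wnorm (ys d) < E by rewrite ltNge xs_min.
apply: wnorm_lt => s s01.
have [out|] := boolP ((s < a - d) || (b + d < s)).
  have sE := wnorm_ub xs s01; rewrite -/E in sE.
  have [z0|lt] := yout s s01 out; first by rewrite /wprod z0 mulr0 normr0.
  have := W_ge0 s; rewrite le_eqVlt => /predU1P[W0|W0].
    by rewrite /wprod -W0 mul0r normr0.
  by apply: lt_le_trans sE; rewrite !normrM ltr_pM2l // normr_gt0 gt_eqF.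
rewrite negb_or -!leNgt => /andP[sa sb].
have near : `|wprod xs s| < E - eta.
  have [sa'|sa'] := ltrP s a.
    by apply: hra; rewrite ltr_norml; clear - sa sa' dra d0; lra.
  have [sb'|sb'] := ltrP b s.
    by apply: hrb; rewrite ltr_norml; clear - sb sb' drb d0; lra.
  have := cmax s ltac:(by rewrite sa' sb').
  by clear - cEeta eta0; lra.
have -> : wprod (ys d) s = wprod xs s + W s * (zero_prod (ys d) s - zero_prod xs s).
  by rewrite /wprod; ring.
apply: le_lt_trans (ler_normD _ _) _.
rewrite [X in _ + X < _]normrM (ger0_norm (W_ge0 s)).
have : W s * `|zero_prod (ys d) s - zero_prod xs s| <= L * (2 * d).
  by apply: ler_pM => //; [exact: hL|exact: ydist].
by clear - near deta; lra.
Qed.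

Hypothesis xs01 : all in01 xs.

(* Moving the two zeros around a gap apart replaces (s - m)^2 - h^2 by
   (s - m)^2 - (h + d)^2, which is smaller in modulus outside the gap. *)
Lemma spread_lt (s a b d : R) : a <= b -> 0 < d -> (s < a - d) || (b + d < s) ->
  `|(s - (a - d)) * (s - (b + d))| < `|(s - a) * (s - b)|.
Proof.
move=> ab d0 out.
have p1 : 0 < (s - (a - d)) * (s - (b + d)) by case/orP: out => h; nra.
have p2 : 0 < (s - a) * (s - b) by case/orP: out => h; nra.
by rewrite !gtr0_norm //; nra.
Qed.

Lemma factor_lt (u v P : R) : `|u| < `|v| -> u * P = 0 \/ `|u * P| < `|v * P|.
Proof.
move=> uv; have [->|P0] := eqVneq P 0; first by left; rewrite mulr0.
by right; rewrite !normrM ltr_pM2r // normr_gt0.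
Qed.

Lemma factor_dist (u v P d : R) : `|u - v| <= 2 * d -> `|P| <= 1 -> `|u * P - v * P| <= 2 * d.
Proof.
move=> uv P1; rewrite -mulrBl normrM -[leRHS]mulr1.
exact: ler_pM.
Qed.

(** The leftmost gap ends at 0, so a single zero is moved, to the right; this lowers |s - b| for all
    s beyond the new zero. *)
Lemma gap_left b r : xs = b :: r -> b < 1 ->
  exists2 s, 0 <= s <= b & `|wprod xs s| = wnorm xs.
Proof.
move=> xsE b1; move: sz xs01; rewrite xsE /= => sr /andP[/andP[b0 _] r01].
rewrite -xsE; apply: (@gap_attains 0 b (1 - b) (fun d => b + d :: r)); rewrite ?subr_gt0 ?(ltW b1) //.
move=> d /andP[d0 d1]; split => //=.
- by rewrite r01 andbT /in01; lra.
- move=> s s01; rewrite xsE !zero_prod_cons; apply: factor_dist; last exact: zero_prod_le1.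
  by rewrite (_ : _ - _ = - d) ?normrN ?gtr0_norm //; [lra|ring].
- move=> s /andP[s0 s1] out; rewrite xsE !zero_prod_cons; apply: factor_lt.
  by case/orP: out => h; rewrite ?gtr0_norm; lra.
Qed.

Lemma gap_right a l : xs = l ++ [:: a] -> 0 < a ->
  exists2 s, a <= s <= 1 & `|wprod xs s| = wnorm xs.
Proof.
move=> xsE a0; move: sz xs01; rewrite xsE size_cat all_cat /=.
move=> sr /andP[l01 /andP[/andP[_ a1] _]].
rewrite -xsE; apply: (@gap_attains a 1 a (fun d => l ++ [:: a - d])); rewrite ?(ltW a0) //.
move=> d /andP[d0 d1]; split => //=.
- by rewrite size_cat.
- by rewrite all_cat l01 /= andbT /in01; lra.
- move=> s s01; rewrite xsE !zero_prod_cat ![zero_prod l s * _]mulrC.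
  apply: factor_dist; last exact: zero_prod_le1.
  rewrite /zero_prod !big_seq1 (_ : _ - _ = d); last by ring.
  by rewrite gtr0_norm //; lra.
- move=> s /andP[s0 s1] out; rewrite xsE !zero_prod_cat ![zero_prod l s * _]mulrC.
  apply: factor_lt; rewrite /zero_prod !big_seq1.
  by case/orP: out => h; last lra; rewrite !ltr0_norm; lra.
Qed.

Lemma gap_mid a b l r : xs = l ++ a :: b :: r -> 0 < a -> a <= b -> b < 1 ->
  exists2 s, a <= s <= b & `|wprod xs s| = wnorm xs.
Proof.
move=> xsE a0 ab b1; move: sz xs01; rewrite xsE size_cat all_cat /=.
move=> sr /and4P[l01 _ _ r01].
rewrite -xsE; apply: (@gap_attains a b (Num.min a (1 - b))
  (fun d => l ++ a - d :: b + d :: r)); rewrite ?(ltW a0) ?(ltW b1) //.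
  by rewrite lt_min a0 subr_gt0.
have E t u s : zero_prod (l ++ t :: u :: r) s =
    ((s - t) * (s - u)) * (zero_prod l s * zero_prod r s).
  by rewrite zero_prod_cat !zero_prod_cons; ring.
move=> d /andP[d0]; rewrite lt_min => /andP[da db]; split => //=.
- by rewrite size_cat.
- by rewrite all_cat l01 /= r01 andbT /in01; apply/andP; split; lra.
- move=> s s01; rewrite xsE !E; apply: factor_dist; last first.
    rewrite normrM -[leRHS]mulr1; apply: ler_pM => //; exact: zero_prod_le1.
  have -> : (s - (a - d)) * (s - (b + d)) - (s - a) * (s - b) = - (d * (b - a + d)) by ring.
  rewrite normrN ger0_norm; first nra.
  by apply: mulr_ge0; lra.
- by move=> s s01 out; rewrite xsE !E; apply: factor_lt; exact: spread_lt.
Qed.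

Hypothesis xs_sorted : sorted <=%R xs.

Lemma wprod_at_zero x : x \in xs -> `|wprod xs x| != wnorm xs.
Proof.
move=> xxs; have z0 : zero_prod xs x = 0.
  by apply/eqP; rewrite prodf_seq_eq0; apply/hasP; exists x => //=; rewrite subrr.
by rewrite /wprod z0 mulr0 normr0 lt_eqF // wnorm_gt0.
Qed.

Lemma sorted_cat_le (l r : seq R) x y : xs = l ++ r -> x \in l -> y \in r -> x <= y.
Proof.
move=> xsE xl yr; move: xs_sorted; rewrite sorted_pairwise; last exact: le_trans.
by rewrite xsE pairwise_cat => /and3P[/allrelP H _ _]; exact: H.
Qed.

(** A zero at 0 or 1 would reduce an outer gap to a single point that is itself a zero, where the
    norm cannot be attained. *)
Lemma minimizer_zeros_in x : x \in xs -> 0 < x < 1.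
Proof.
move=> xxs; have /andP[x0 x1] := allP xs01 x xxs.
rewrite !lt_neqAle x0 x1 !andbT; apply/andP; split; apply/negP => /eqP xE.
  case xsE : xs xxs => [//|b r] xbr.
  have bxs : b \in xs by rewrite xsE mem_head.
  have b0 : b = 0.
    apply/eqP; rewrite eq_le; have /andP[-> _] := allP xs01 b bxs; rewrite andbT xE.
    move: xbr; rewrite in_cons => /predU1P[->//|xr].
    by apply: (sorted_cat_le (l := [:: b]) (r := r)); rewrite ?mem_head.
  have [|s /andP[s0 sb] sE] := gap_left xsE; first by rewrite b0.
  have sb' : s = b by apply/eqP; rewrite eq_le sb b0.
  by have := wprod_at_zero bxs; rewrite -sb' sE eqxx.
case/lastP xsE : xs xxs => [//|l a]; rewrite mem_rcons => xal.
rewrite -cats1 in xsE.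
have axs : a \in xs by rewrite xsE mem_cat mem_head orbT.
have a1 : a = 1.
  apply/eqP; rewrite eq_le; have /andP[_ ->] := allP xs01 a axs; rewrite andTb -xE.
  move: xal; rewrite in_cons => /predU1P[->//|xl].
  by apply: (sorted_cat_le xsE); rewrite ?mem_head.
have [|s /andP[sa s1] sE] := gap_right xsE; first by rewrite a1.
have sa' : s = a by apply/eqP; rewrite eq_le sa a1 s1.
by have := wprod_at_zero axs; rewrite -sa' sE eqxx.
Qed.

Lemma minimizer_tip (l r : seq R) : xs = l ++ r -> exists2 s, in01 s &
  [/\ all (fun x => x < s) l, all (fun x => s < x) r & `|wprod xs s| = wnorm xs].
Proof.
move=> xsE.
have lE x : x \in l -> x \in xs by move=> xl; rewrite xsE mem_cat xl.
have rE x : x \in r -> x \in xs by move=> xr; rewrite xsE mem_cat xr orbT.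
have neq s x : `|wprod xs s| = wnorm xs -> x \in xs -> s != x.
  by move=> sE xxs; apply/eqP => sx; have := wprod_at_zero xxs; rewrite -sx sE eqxx.
have sorted3 l1 y r1 : xs = l1 ++ y :: r1 ->
    (forall x, x \in l1 -> x <= y) /\ (forall x, x \in r1 -> y <= x).
  move=> E; split => x xi; first by apply: (sorted_cat_le E); rewrite ?mem_head.
  by apply: (@sorted_cat_le (rcons l1 y) r1); rewrite ?cat_rcons // mem_rcons mem_head.
suff [s s01 [sl sr sE]] : exists2 s, in01 s & [/\ forall x, x \in l -> x <= s,
    forall x, x \in r -> s <= x & `|wprod xs s| = wnorm xs].
  exists s => //; split => //; apply/allP => x xi; rewrite lt_neqAle.
    by rewrite sl // andbT eq_sym; apply: neq => //; exact: lE.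
  by rewrite sr // andbT; apply: neq => //; exact: rE.
case/lastP: l xsE lE => [|l a] /= xsE lE; case: r xsE rE => [|b r] xsE rE.
- have [s s01 smax] := wprod_max_on xs (@ler01 R); exists s => //; split => //.
  by apply/eqP; rewrite eq_le wnorm_ub // wnorm_le.
- have /andP[b0 b1] := minimizer_zeros_in (rE b (mem_head _ _)).
  have [s /andP[s0 sb] sE] := gap_left xsE b1; exists s.
    by rewrite /in01 s0 (le_trans sb) // ltW.
  split => // x; rewrite in_cons => /predU1P[->//|xr]; apply: le_trans sb _.
  exact: (sorted3 [::] b r xsE).2.
- rewrite cats0 -cats1 in xsE.
  have /andP[a0 a1] := minimizer_zeros_in (lE a ltac:(by rewrite mem_rcons mem_head)).
  have [s /andP[sa s1] sE] := gap_right xsE a0; exists s.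
    by rewrite /in01 s1 (le_trans _ sa) // ltW.
  split => // x; rewrite mem_rcons in_cons => /predU1P[->//|xl]; apply: le_trans sa.
  exact: (sorted3 l a [::] xsE).1.
- rewrite cat_rcons in xsE.
  have /andP[a0 a1] := minimizer_zeros_in (lE a ltac:(by rewrite mem_rcons mem_head)).
  have /andP[b0 b1] := minimizer_zeros_in (rE b (mem_head _ _)).
  have ab : a <= b by apply: (sorted3 _ _ _ xsE).2; rewrite mem_head.
  have [s /andP[sa sb] sE] := gap_mid xsE a0 ab b1; exists s.
    by rewrite /in01 (le_trans (ltW a0) sa) (le_trans sb (ltW b1)).
  split => // x.
    rewrite mem_rcons in_cons => /predU1P[->//|xl]; apply: le_trans sa.
    exact: (sorted3 _ _ _ xsE).1.
  rewrite in_cons => /predU1P[->//|xr]; apply: le_trans sb _.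
  by apply: (sorted3 (rcons l a) b r _).2; rewrite ?cat_rcons.
Qed.

End Minimizer.

(** The form in which the minimizer is used afterwards. The splittings [xs = l ++ r] index the n + 1
    gaps, and the strict inequalities at the tips also make the zeros increasing and distinct. *)
Theorem extremal_zeros (n : nat) : exists xs : seq R, exists2 E : R, 0 < E &
  [/\ size xs = n, forall x, x \in xs -> 0 < x < 1,
    forall s, in01 s -> `|wprod xs s| <= E &
    forall l r, xs = l ++ r -> exists2 s, in01 s &
      [/\ all (fun x => x < s) l, all (fun x => s < x) r & `|wprod xs s| = E]].
Proof.
have [L L0 hL] := wnorm_lipschitz.
have [|xs0 [sz0 a0 min0]] := @lipschitz_seq_min n wnorm L L0.
  by move=> xs ys sx sy; apply: hL; rewrite sx sy.
pose xs := sort <=%R xs0.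
have pxs : perm_eq xs xs0 by rewrite perm_sort.
have sz : size xs = n by rewrite size_sort.
have xsmin ys : size ys = n -> all in01 ys -> wnorm xs <= wnorm ys.
  by rewrite (wnorm_perm pxs); exact: min0.
have xs01 : all in01 xs by rewrite (perm_all _ pxs).
have srt : sorted <=%R xs by apply: sort_sorted; exact: le_total.
exists xs, (wnorm xs); first exact: wnorm_gt0; split => //.
- exact: minimizer_zeros_in sz xsmin xs01 srt.
- by move=> s; exact: wnorm_ub.
- exact: minimizer_tip sz xsmin xs01 srt.
Qed.

End ExtremalZeros.

(** * The minimal deviation *)

Section DividedDifference.
Variable F : fieldType.

(** Leading coefficients in the Lagrange interpolation formula: [g] is the interpolant of h at the n
    + 1 nodes, and [lift i] runs through the nodes other than the i-th. *)
Lemma divided_difference (n : nat) (x : 'I_n.+1 -> F) (h : {poly F}) :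
  injective x -> (size h <= n.+1)%N ->
  \sum_(i < n.+1) h.[x i] / \prod_(k < n) (x i - x (lift i k)) = h`_n.
Proof.
move=> injx szh.
pose L (i : 'I_n.+1) : {poly F} := \prod_(k < n) ('X - (x (lift i k))%:P).
have szL i : size (L i) = n.+1 by rewrite size_prod_XsubC [index_enum _]unlock -enumT size_enum_ord.
have Lmon i : (L i)`_n = 1.
  have /monicP := monic_prod_XsubC (index_enum 'I_n) predT (fun k => x (lift i k)).
  by rewrite -/(L i) lead_coefE szL.
have LE i j : (L i).[x j] = \prod_(k < n) (x j - x (lift i k)).
  by rewrite horner_prod; apply: eq_bigr => k _; rewrite hornerXsubC.
have L0 i j : j != i -> (L i).[x j] = 0.
  rewrite eq_sym LE => /unlift_some[k -> _].
  by rewrite (bigD1 k) //= subrr mul0r.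
have Lneq i : (L i).[x i] != 0.
  rewrite LE; apply/prodf_neq0 => k _; rewrite subr_eq0 (inj_eq injx).
  exact: neq_lift.
pose g : {poly F} := \sum_(i < n.+1) (h.[x i] / (L i).[x i]) *: L i.
have gE j : g.[x j] = h.[x j].
  rewrite horner_sum (bigD1 j) //= hornerZ divfK // big1 ?addr0 // => i ij.
  by rewrite hornerZ (L0 i j) ?mulr0 1?eq_sym.
have szg : (size g <= n.+1)%N.
  apply: leq_trans (size_sum _ _ _) _; apply/bigmax_leqP => i _.
  by apply: leq_trans (size_scale_leq _ _) _; rewrite szL.
have -> : h = g.
  apply/eqP; rewrite -subr_eq0; apply/negP => /negP hg.
  have := max_poly_roots (rs := [seq x i | i <- enum 'I_n.+1]) hg.
  rewrite size_map size_enum_ord.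
  have -> : all (root (h - g)) [seq x i | i <- enum 'I_n.+1].
    by apply/allP => _ /mapP[i _ ->]; rewrite rootE hornerD hornerN gE subrr.
  rewrite map_inj_uniq // enum_uniq => /(_ isT isT).
  rewrite ltnNge; apply/negP; rewrite negbK.
  by apply: leq_trans (size_polyD _ _) _; rewrite size_polyN geq_max szh szg.
rewrite coef_sum; apply: eq_bigr => i _.
by rewrite coefZ Lmon mulr1 gE LE.
Qed.

End DividedDifference.

(** * Fourier coefficients by finite averages over the torus *)

Section TorusAverage.
Variable R : realType.
Local Notation C := R[i].

Variable M : nat.
Hypothesis M0 : (0 < M)%N.

(** Averages over the M-th roots of unity replace integrals over the circle; they are exact for
    exponents below M. *)
Definition unit_root (j : nat) : C := cexp (0 +i* (2 * pi * j%:R / M%:R)).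

Lemma unit_rootX j : unit_root j = unit_root 1 ^+ j.
Proof.
elim: j => [|j IH]; first by rewrite /unit_root mulr0 mul0r cexp0.
rewrite exprSr -IH /unit_root -cexpD; congr cexp.
by apply: complex_ext; rewrite !ReImE ?addr0 // -[j.+1]addn1 natrD; ring.
Qed.

Lemma cmod_unit_root j : cmod (unit_root j) = 1.
Proof. by rewrite cmod_cexp ReE expR0. Qed.

Lemma unit_root_conj j : unit_root j * conjc (unit_root j) = 1.
Proof. by rewrite mul_conjc cmod_unit_root expr1n. Qed.

Lemma unit_root_neq1 j : (0 < j < M)%N -> unit_root j != 1.
Proof.
move=> /andP[j0 jM]; apply/eqP => /(congr1 (@complex.Re R)).
rewrite Re_cexp ReE ImE expR0 mul1r ReX1.
have MR : 0 < M%:R :> R by rewrite ltr0n.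
have jR : 0 < j%:R :> R by rewrite ltr0n.
pose t : R := pi * j%:R / M%:R.
have t0 : 0 < t by rewrite divr_gt0 // mulr_gt0 // pi_gt0.
have tpi : t < pi by rewrite ltr_pdivrMr // ltr_pM2l ?pi_gt0 // ltr_nat.
have -> : 2 * pi * j%:R / M%:R = t *+ 2 by rewrite /t -mulr_natl; ring.
rewrite cos_mulr2n => H.
have s0 : 0 < sin t by apply: sin_gt0_pi; rewrite t0.
have := cos2Dsin2 t; have : 0 < sin t ^+ 2 by rewrite exprn_gt0.
by move: H; clear; rewrite mulr2n; lra.
Qed.

Lemma unit_root_period : unit_root M = 1.
Proof.
have MR : M%:R != 0 :> R by rewrite pnatr_eq0 -lt0n.
rewrite /unit_root mulfK //.
have -> : 2 * pi = pi *+ 2 :> R by rewrite mulr_natl.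
by apply: complex_ext; rewrite ?Re_cexp ?Im_cexp ReE ImE expR0 ?cos2pi ?sin2pi mul1r.
Qed.

Lemma unit_root_sum A B : (A < M)%N -> (B < M)%N ->
  \sum_(j < M) unit_root j ^+ A * conjc (unit_root j) ^+ B =
  if A == B then M%:R else 0.
Proof.
move=> AM BM; pose u := unit_root 1; pose z := u ^+ A * conjc u ^+ B.
have uu : u * conjc u = 1 := unit_root_conj 1.
have E : \sum_(j < M) unit_root j ^+ A * conjc (unit_root j) ^+ B = \sum_(j < M) z ^+ j.
  apply: eq_bigr => j _; rewrite unit_rootX rmorphXn /= /z exprMn -!exprM.
  by rewrite [(j * A)%N]mulnC [(j * B)%N]mulnC.
rewrite {}E; case: eqP => [AB|/eqP AB].
  rewrite (eq_bigr (fun=> 1)) => [|j _]; last by rewrite /z AB -exprMn uu !expr1n.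
  by rewrite sumr_const card_ord.
have zM : z ^+ M = 1.
  have uM : u ^+ M = 1 by rewrite -unit_rootX unit_root_period.
  have ucM : conjc u ^+ M = 1 by rewrite -(rmorphXn (@conjc R)) uM /= oppr0.
  by rewrite /z exprMn -!exprM ![(_ * M)%N]mulnC !exprM uM ucM !expr1n mulr1.
have z1 : z != 1.
  apply/eqP => z1.
  have uAB : u ^+ A = u ^+ B.
    by rewrite -[LHS]mulr1 -(expr1n _ B) -uu exprMn mulrCA -/z z1 mulr1.
  have un0 : u != 0 by rewrite -cmod_gt0 cmod_unit_root.
  wlog lt : A B AM BM AB uAB {z zM z1} / (A < B)%N => [H|].
    by case: (ltngtP A B) AB => // AB _; [apply: (H A B)|apply: (H B A)] => //;
       rewrite ?neq_ltn ?AB ?orbT.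
  have : unit_root (B - A) = 1.
    apply: (mulIf (expf_neq0 A un0)); rewrite unit_rootX -exprD subnK; last exact: ltnW.
    by rewrite mul1r uAB.
  apply/eqP/unit_root_neq1; rewrite subn_gt0 lt /=.
  exact: leq_ltn_trans (leq_subr _ _) BM.
have := subrX1 z M; rewrite zM subrr => /esym/eqP.
by rewrite mulf_eq0 subr_eq0 (negPf z1) /= => /eqP.
Qed.

(** The Fourier coefficient of f at the frequency (k1 - l1, k2 - l2) on the torus |z1| = r1, |z2| =
    r2; conjugate powers avoid negative exponents. *)
Definition torus_average (k1 l1 k2 l2 : nat) (f : C -> C -> C) (r1 r2 : R) : C :=
  (M%:R ^+ 2)^-1 * \sum_(j < M) \sum_(k < M)
    (unit_root j ^+ l1 * conjc (unit_root j) ^+ k1 *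
     (unit_root k ^+ l2 * conjc (unit_root k) ^+ k2)) *
    f (r1%:C * unit_root j) (r2%:C * unit_root k).

Lemma torus_average_monomial k1 l1 k2 l2 a b c d r1 r2 :
  (a + l1 < M)%N -> (b + k1 < M)%N -> (c + l2 < M)%N -> (d + k2 < M)%N ->
  torus_average k1 l1 k2 l2 (monomial4 a b c d) r1 r2 =
  if (a + l1 == b + k1)%N && (c + l2 == d + k2)%N then (r1 ^+ (a + b) * r2 ^+ (c + d))%:C
  else 0.
Proof.
move=> h1 h2 h3 h4; rewrite /torus_average.
have MC : M%:R != 0 :> C by rewrite pnatr_eq0 -lt0n.
have -> : \sum_(j < M) \sum_(k < M)
    (unit_root j ^+ l1 * conjc (unit_root j) ^+ k1 *
     (unit_root k ^+ l2 * conjc (unit_root k) ^+ k2)) *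
    monomial4 a b c d (r1%:C * unit_root j) (r2%:C * unit_root k) =
  (r1%:C ^+ (a + b) * r2%:C ^+ (c + d)) *
  ((\sum_(j < M) unit_root j ^+ (a + l1) * conjc (unit_root j) ^+ (b + k1)) *
   (\sum_(k < M) unit_root k ^+ (c + l2) * conjc (unit_root k) ^+ (d + k2))).
  rewrite mulr_suml mulr_sumr; apply: eq_bigr => j _.
  rewrite mulr_sumr mulr_sumr; apply: eq_bigr => k _.
  have cE (x : R) (z : C) : conjc (x%:C * z) = x%:C * conjc z.
    by apply: complex_ext; rewrite !ReImE; ring.
  by rewrite /monomial4 !cE !exprMn !exprD; ring.
rewrite !unit_root_sum //.
case: ifP => _ /=; last by rewrite mul0r !mulr0.
case: ifP => _; last by rewrite !mulr0.
by rewrite rmorphM !rmorphXn /= mulrCA -expr2 mulVf ?mulr1 // expf_neq0.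
Qed.

Lemma torus_averageB k1 l1 k2 l2 f g r1 r2 :
  torus_average k1 l1 k2 l2 (fun z w => f z w - g z w) r1 r2 =
  torus_average k1 l1 k2 l2 f r1 r2 - torus_average k1 l1 k2 l2 g r1 r2.
Proof.
rewrite /torus_average -mulrBr -sumrB; congr (_ * _); apply: eq_bigr => j _.
by rewrite -sumrB; apply: eq_bigr => k _; rewrite mulrBr.
Qed.

Lemma torus_average_sum k1 l1 k2 l2 (I : Type) (s : seq I) (x : I -> C) (f : I -> C -> C -> C) r1 r2 :
  torus_average k1 l1 k2 l2 (fun z w => \sum_(i <- s) x i * f i z w) r1 r2 =
  \sum_(i <- s) x i * torus_average k1 l1 k2 l2 (f i) r1 r2.
Proof.
rewrite /torus_average; under [RHS]eq_bigr do rewrite mulrCA.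
rewrite -mulr_sumr; congr (_ * _).
under [RHS]eq_bigr do rewrite mulr_sumr.
rewrite [RHS]exchange_big; apply: eq_bigr => j _ /=.
under [RHS]eq_bigr do rewrite mulr_sumr.
rewrite [RHS]exchange_big; apply: eq_bigr => k _ /=.
by rewrite mulr_sumr; apply: eq_bigr => i _; ring.
Qed.

Lemma cmod_sum (I : Type) (s : seq I) (F : I -> C) :
  cmod (\sum_(i <- s) F i) <= \sum_(i <- s) cmod (F i).
Proof.
elim: s => [|i s IH]; first by rewrite !big_nil cmod0.
by rewrite !big_cons; apply: le_trans (cmodD _ _) _; rewrite lerD2l.
Qed.

Lemma torus_average_le k1 l1 k2 l2 f r1 r2 (B : R) :
  (forall u v : C, cmod u = 1 -> cmod v = 1 -> cmod (f (r1%:C * u) (r2%:C * v)) <= B) ->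
  cmod (torus_average k1 l1 k2 l2 f r1 r2) <= B.
Proof.
move=> fB; have MR : 0 < M%:R :> R by rewrite ltr0n.
rewrite /torus_average cmodM cmodV cmodX.
have -> : cmod (M%:R : C) = M%:R.
  have -> : (M%:R : C) = (M%:R)%:C by rewrite rmorph_nat.
  by rewrite cmod_real gtr0_norm.
rewrite mulrC ler_pdivrMr ?exprn_gt0 //.
apply: le_trans (cmod_sum _ _) _.
have -> : B * M%:R ^+ 2 = \sum_(j < M) \sum_(k < M) B.
  by rewrite !sumr_const card_ord -mulrnA -[RHS]mulr_natr natrM expr2.
apply: ler_sum => j _; apply: le_trans (cmod_sum _ _) _.
apply: ler_sum => k _; rewrite cmodM.
have phase (u : C) (a b : nat) : cmod u = 1 -> cmod (u ^+ a * conjc u ^+ b) = 1.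
  by move=> u1; rewrite cmodM !cmodX cmod_conj u1 !expr1n mul1r.
rewrite [X in X * _](_ : _ = 1) ?mul1r; first by apply: fB; exact: cmod_unit_root.
by rewrite cmodM (phase _ l1 k1 (cmod_unit_root j)) (phase _ l2 k2 (cmod_unit_root k)) mul1r.
Qed.

End TorusAverage.

(** * Upper and lower bounds for the deviation *)

Section MinimalDeviationValue.
Variable R : realType.
Local Notation C := R[i].

(** The value of |z1|^p |z2|^q at the points of the sphere with |z1|^2 = s. *)
Definition sqrt_weight (p q : nat) (s : R) : R := Num.sqrt s ^+ p * Num.sqrt (1 - s) ^+ q.

Lemma sqrt_weight_continuous p q : continuous (sqrt_weight p q).
Proof.
move=> s; have cX (f : R -> R) m : {for s, continuous f} -> {for s, continuous (fun t => f t ^+ m)}.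
  move=> cf; exact: (continuous_comp cf (@exprn_continuous R m (f s))).
apply: cvgM; apply: cX; first exact: sqrt_continuous.
apply: (@continuous_comp R R R (fun t => 1 - t) Num.sqrt); last exact: sqrt_continuous.
by apply: cvgB; [exact: cvg_cst|exact: cvg_id].
Qed.

Lemma sqrt_weight_ge0 p q s : 0 <= sqrt_weight p q s.
Proof. by rewrite mulr_ge0 // exprn_ge0 // sqrtr_ge0. Qed.

Lemma sqrt_weight_gt0 p q s : 0 < s < 1 -> 0 < sqrt_weight p q s.
Proof. by move=> /andP[s0 s1]; rewrite mulr_gt0 // exprn_gt0 // sqrtr_gt0 ?subr_gt0. Qed.

Lemma zero_prod_monotone (l : seq R) (s t z : R) : all (fun x => x < s) l -> s <= t ->
  0 <= zero_prod l s <= zero_prod l t.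
Proof.
move=> + st; elim: l => [|x l IH] /=; first by rewrite /zero_prod !big_nil lexx ler01.
move=> /andP[xs /IH /andP[h1 h2]]; rewrite !zero_prod_cons.
apply/andP; split; first by rewrite mulr_ge0 // subr_ge0 ltW.
by apply: ler_pM => //; [rewrite subr_ge0 ltW|rewrite lerD2r].
Qed.

(** The modulus of one of the two factors of the extremal polynomial, as a function of the squared
    modulus of its variable. Beyond its zeros it is nondecreasing. *)
Definition half_prod (p : nat) (l : seq R) (s : R) : R := Num.sqrt s ^+ p * `|zero_prod l s|.

Lemma half_prod_ge0 p l s : 0 <= half_prod p l s.
Proof. by rewrite mulr_ge0 // exprn_ge0 // sqrtr_ge0. Qed.

Lemma half_prod_monotone p l (s t : R) : all (fun x => x < s) l -> 0 <= s -> s <= t ->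
  half_prod p l s <= half_prod p l t.
Proof.
move=> ls s0 st; have /andP[h1 h2] := zero_prod_monotone 0 ls st.
rewrite /half_prod (ger0_norm h1) (ger0_norm (le_trans h1 h2)).
apply: ler_pM => //.
by apply: lerXn2r; rewrite ?nnegrE ?sqrtr_ge0 // ler_wsqrtr.
Qed.

Definition mirror (r : seq R) : seq R := [seq 1 - x | x <- r].

Lemma zero_prod_mirror r s : `|zero_prod (mirror r) (1 - s)| = `|zero_prod r s|.
Proof.
rewrite /zero_prod big_map !normr_prod; apply: eq_bigr => x _.
by rewrite distrC; congr `|_|; ring.
Qed.

Lemma wprod_halves p q l r s :
  `|wprod (sqrt_weight p q) (l ++ r) s| = half_prod p l s * half_prod q (mirror r) (1 - s).
Proof.
rewrite /wprod zero_prod_cat /half_prod zero_prod_mirror normrM.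
by rewrite (ger0_norm (sqrt_weight_ge0 p q s)) normrM /sqrt_weight; ring.
Qed.

(* Away from the hypotenuse, push the point onto it along a coordinate direction in
   which the modulus increases; in the corner below the tip (xi, 1 - xi), each factor
   is at most its value at the tip. *)
Lemma triangle_bound p q l r (E xi s t : R) : 0 < E -> in01 xi ->
  all (fun x => x < xi) l -> all (fun x => xi < x) r ->
  `|wprod (sqrt_weight p q) (l ++ r) xi| = E ->
  (forall s, in01 s -> `|wprod (sqrt_weight p q) (l ++ r) s| <= E) ->
  0 <= s -> 0 <= t -> s + t <= 1 ->
  half_prod p l s * half_prod q (mirror r) t <= E.
Proof.
move=> E0 /andP[xi0 xi1] lxi rxi xiE bnd s0 t0 st.
have rxi' : all (fun x => x < 1 - xi) (mirror r).
  by rewrite all_map; apply: sub_all rxi => x /=; rewrite ltrD2l ltrN2.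
rewrite wprod_halves in xiE.
have hyp u : 0 <= u -> u <= 1 -> half_prod p l u * half_prod q (mirror r) (1 - u) <= E.
  by move=> u0 u1; rewrite -wprod_halves bnd // /in01 u0 u1.
have A0 u := half_prod_ge0 p l u; have B0 u := half_prod_ge0 q (mirror r) u.
have [xs|sx] := lerP xi s.
  apply: le_trans (_ : half_prod p l (1 - t) * half_prod q (mirror r) t <= _).
    apply: ler_wpM2r => //; apply: half_prod_monotone => //; last lra.
    by apply: sub_all lxi => x /lt_le_trans; apply.
  by have := hyp (1 - t); rewrite subKr; apply; lra.
have [xt|tx] := lerP (1 - xi) t.
  apply: le_trans (_ : half_prod p l s * half_prod q (mirror r) (1 - s) <= _).
    apply: ler_wpM2l => //; apply: half_prod_monotone => //; last lra.
    by apply: sub_all rxi' => x /lt_le_trans; apply.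
  by apply: hyp; lra.
have [Axi Bxi] : 0 < half_prod p l xi /\ 0 < half_prod q (mirror r) (1 - xi).
  by rewrite !lt_def !A0 !B0 !andbT; split; apply: contraTneq E0 => H;
     rewrite -xiE H ?mul0r ?mulr0 ltxx.
rewrite -xiE; apply: ler_pM => //.
  rewrite -(ler_pM2r Bxi) xiE; apply: le_trans (hyp s _ _); [|lra|lra].
  by apply: ler_wpM2l => //; apply: half_prod_monotone => //; lra.
rewrite -(ler_pM2l Axi) xiE; apply: le_trans (hyp (1 - t) _ _); [|lra|lra].
rewrite subKr; apply: ler_wpM2r => //; apply: half_prod_monotone => //; lra.
Qed.

Section Pi.

(** Such a G is a difference monomial - P with P admissible, so its norm on the ball bounds the
    minimal deviation from above. *)
Definition leading (a b c d : nat) (G : C -> C -> C) : Prop :=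
  Pi_poly ((a + b + c + d)%N%:Z - 1) (fun z1 z2 => monomial4 a b c d z1 z2 - G z1 z2).

Definition eval_terms (s : seq (C * (nat * nat * nat * nat))) (z1 z2 : C) : C :=
  \sum_(t <- s) let: (x, (a, b, c, d)) := t in x * monomial4 a b c d z1 z2.

Lemma leading_monomial a b c d : leading a b c d (monomial4 a b c d).
Proof. by exists [::]; split => // z1 z2; rewrite big_nil subrr. Qed.

Definition shift_term (i j k l : nat) (y : C) (t : C * (nat * nat * nat * nat)) :=
  let: (x, (a, b, c, d)) := t in (y * x, ((a + i)%N, (b + j)%N, (c + k)%N, (d + l)%N)).

Lemma eval_shift i j k l y s z1 z2 :
  eval_terms [seq shift_term i j k l y t | t <- s] z1 z2 =
  y * monomial4 i j k l z1 z2 * eval_terms s z1 z2.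
Proof.
rewrite /eval_terms big_map mulr_sumr; apply: eq_bigr => -[x [[[a b] c] d]] _ /=.
by rewrite /monomial4 !exprD; ring.
Qed.

Lemma leading_mul (i j k l a b c d : nat) (y : C) (G : C -> C -> C) :
  (0 < i + j + k + l)%N -> leading a b c d G ->
  leading (a + i) (b + j) (c + k) (d + l)
    (fun z1 z2 => G z1 z2 * (monomial4 i j k l z1 z2 - y)).
Proof.
move=> ijkl [s [sdeg sE]].
(* With G = A - P, A its leading monomial and m the new one, A m - (A - P) (m - y) = y A + P m - y
   P; these are the three lists. *)
exists ([:: (y, (a, b, c, d))] ++ [seq shift_term i j k l 1 t | t <- s] ++
  [seq shift_term 0 0 0 0 (- y) t | t <- s]); split; last first.
  move=> z1 z2; rewrite -/(eval_terms _ z1 z2) /eval_terms !big_cat big_seq1 /=.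
  rewrite -!/(eval_terms _ z1 z2) !eval_shift -[eval_terms s z1 z2]sE.
  rewrite /monomial4 !exprD !expr0; ring.
move=> x a' b' c' d'; rewrite !mem_cat => /or3P[].
- rewrite inE => /eqP[_ -> -> -> ->]; lia.
- move=> /mapP[[x0 [[[a0 b0] c0] d0]] /sdeg H [_ -> -> -> ->]]; lia.
- move=> /mapP[[x0 [[[a0 b0] c0] d0]] /sdeg H [_ -> -> -> ->]]; lia.
Qed.

End Pi.

Variables (k1 l1 k2 l2 : nat).
Hypotheses (h1 : (l1 <= k1)%N) (h2 : (l2 <= k2)%N).
Local Notation p := (k1 - l1)%N.
Local Notation q := (k2 - l2)%N.
Local Notation n := (l1 + l2)%N.
Local Notation N := (k1 + l1 + k2 + l2)%N.
Local Notation W := (sqrt_weight p q).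

(** On the sphere |z2|^2 - (1 - x) = -(|z1|^2 - x), so the zeros may be shared between the variables
    at will; l1 and l2 of them produce the prescribed leading monomial. *)
Definition extremal_poly (l r : seq R) (z1 z2 : C) : C :=
  z1 ^+ p * z2 ^+ q * (\prod_(x <- l) (z1 * conjc z1 - x%:C)) *
  (\prod_(x <- r) (z2 * conjc z2 - (1 - x)%:C)).

Lemma extremal_poly_leading l r : size l = l1 -> size r = l2 ->
  leading k1 l1 k2 l2 (extremal_poly l r).
Proof.
have H1 : forall l, leading (p + size l) (size l) q 0
   (fun z1 z2 => z1 ^+ p * z2 ^+ q * (\prod_(x <- l) (z1 * conjc z1 - x%:C))).
  elim=> [|x s IH] /=.
    have := leading_monomial p 0 q 0; rewrite addn0 => -[s [sd sE]].
    exists s; split => // z1 z2; rewrite -sE big_nil /monomial4; ring.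
  have := @leading_mul 1 1 0 0 _ _ _ _ x%:C _ isT IH.
  rewrite !addn0 !addn1 -addnS => -[t [td tE]].
  exists t; split => // z1 z2; rewrite -tE big_cons /monomial4; ring.
have H2 : forall l r, leading (p + size l) (size l) (q + size r) (size r) (extremal_poly l r).
  move=> u; elim=> [|x s IH] /=.
    have := H1 u; rewrite addn0 => -[s [sd sE]].
    exists s; split => // z1 z2; rewrite -sE /extremal_poly big_nil; ring.
  have := @leading_mul 0 0 1 1 _ _ _ _ (1 - x)%:C _ isT IH.
  rewrite !addn0 !addn1 -addnS => -[t [td tE]].
  exists t; split => // z1 z2; rewrite -tE /extremal_poly big_cons /monomial4; ring.
by move=> sl sr; have := H2 l r; rewrite sl sr !subnK.
Qed.

Lemma cmod_prod_sub (l : seq R) (z : C) :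
  cmod (\prod_(x <- l) (z * conjc z - x%:C)) = `|zero_prod l (cmod z ^+ 2)|.
Proof.
elim: l => [|x l IH]; first by rewrite /zero_prod !big_nil cmod1 normr1.
rewrite big_cons cmodM IH zero_prod_cons normrM mul_conjc; congr (_ * _).
by rewrite -cmod_real; congr cmod; apply: complex_ext; rewrite !ReImE ?subr0.
Qed.

Lemma cmod_extremal_poly l r z1 z2 : cmod (extremal_poly l r z1 z2) =
  half_prod p l (cmod z1 ^+ 2) * half_prod q (mirror r) (cmod z2 ^+ 2).
Proof.
rewrite /extremal_poly !cmodM !cmodX cmod_prod_sub.
have -> : \prod_(x <- r) (z2 * conjc z2 - (1 - x)%:C) =
    \prod_(x <- mirror r) (z2 * conjc z2 - x%:C) by rewrite big_map.
by rewrite cmod_prod_sub /half_prod !sqrtr_sqr !(ger0_norm (cmod_ge0 _)); ring.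
Qed.

Lemma complex_ball0 : complex_ball ((0, 0) : C * C).
Proof.
change (cmod (0 : C) ^+ 2 + cmod (0 : C) ^+ 2 <= 1).
by rewrite cmod0 expr0n addr0 ler01.
Qed.

Lemma ball_norm_le (F : C -> C -> C) (B : R) :
  (forall z, complex_ball z -> cmod (F z.1 z.2) <= B) -> ball_norm F <= B.
Proof.
move=> H; apply: ge_sup => [|_ [z zb <-]]; last exact: H.
exists (cmod (F 0 0)), (0, 0) => //; exact: complex_ball0.
Qed.

Lemma complex_ball_le1 (z : C * C) : complex_ball z -> cmod z.1 <= 1 /\ cmod z.2 <= 1.
Proof.
rewrite /complex_ball /= => H.
have := sqr_ge0 (cmod z.1); have := sqr_ge0 (cmod z.2).
by split; rewrite -(@expr_le1 _ 2) ?cmod_ge0 //; lra.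
Qed.

Lemma cmod_monomial4_le1 a b c d (z : C * C) : complex_ball z -> cmod (monomial4 a b c d z.1 z.2) <= 1.
Proof.
move=> /complex_ball_le1[z1 z2]; rewrite /monomial4 !cmodM !cmodX !cmod_conj.
by rewrite !mulr_ile1 ?mulr_ge0 ?exprn_ge0 ?cmod_ge0 // exprn_ile1 ?cmod_ge0.
Qed.

Lemma ball_norm_ub (P : C -> C -> C) (z : C * C) : Pi_poly (N%:Z - 1) P -> complex_ball z ->
  cmod (monomial4 k1 l1 k2 l2 z.1 z.2 - P z.1 z.2) <=
  ball_norm (fun z1 z2 => monomial4 k1 l1 k2 l2 z1 z2 - P z1 z2).
Proof.
move=> [s [_ sE]] zb; apply: ub_le_sup; last by exists z.
(* The supremum is an upper bound only if the set is bounded; monomials are at most 1 on the ball,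
   so the coefficients provide a bound. *)
exists (1 + \sum_(t <- s) cmod t.1) => _ [w wb <-].
apply: le_trans (cmodB _ _) _; apply: lerD; first exact: cmod_monomial4_le1.
rewrite sE; apply: le_trans (cmod_sum _ _) _; apply: ler_sum => -[x [[[a b] c] d]] _ /=.
by rewrite cmodM ler_piMr ?cmod_ge0 // cmod_monomial4_le1.
Qed.

Lemma min_deviation_le (P : C -> C -> C) (B : R) : Pi_poly (N%:Z - 1) P ->
  (forall z, complex_ball z -> cmod (monomial4 k1 l1 k2 l2 z.1 z.2 - P z.1 z.2) <= B) ->
  min_deviation R k1 l1 k2 l2 <= B.
Proof.
move=> PP HB.
apply: le_trans (_ : ball_norm (fun z1 z2 => monomial4 k1 l1 k2 l2 z1 z2 - P z1 z2) <= _);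
  last exact: ball_norm_le.
apply: ge_inf; last by exists P.
exists 0 => _ [Q QQ <-].
exact: le_trans (cmod_ge0 _) (ball_norm_ub QQ complex_ball0).
Qed.

(* Averaging over the torus with the phase of the monomial leaves, on the sphere,
   a one-variable polynomial with leading term (-1)^l2 X^n times the weight. *)
Lemma sphere_polynomial (P : C -> C -> C) : Pi_poly (N%:Z - 1) P ->
  exists2 h : {poly C}, ((size h <= n.+1)%N /\ h`_n = (-1) ^+ l2) &
    forall s, in01 s -> W s * cmod h.[s%:C] <=
      ball_norm (fun z1 z2 => monomial4 k1 l1 k2 l2 z1 z2 - P z1 z2).
Proof.
move=> PP; have [ts [deg PE]] := PP; set B := ball_norm _.
(* All exponents met below are at most 2 N, so the averages over M-th roots of unity are exact. *)
pose M := (2 * N).+1.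
pose base b d : {poly C} := 'X^b * (1 - 'X) ^+ d.
have sz1X : size (1 - 'X : {poly C}) = 2%N by rewrite -opprB size_polyN size_XsubC.
have n1X d : (1 - 'X : {poly C}) ^+ d != 0 by rewrite expf_neq0 // -size_poly_eq0 sz1X.
have szX d : size ((1 - 'X : {poly C}) ^+ d) = d.+1.
  have := size_exp (1 - 'X : {poly C}) d; rewrite sz1X mul1n => sE.
  by rewrite -[in RHS]sE prednK // lt0n size_poly_eq0.
have szbase b d : size (base b d) = (b + d).+1.
  by rewrite size_mul ?n1X ?expf_neq0 ?polyX_eq0 // size_polyXn szX addSn addnS.
have basen0 b d : base b d != 0 by rewrite -size_poly_eq0 szbase.
have lcbase b d : (base b d)`_(b + d) = (-1) ^+ d.
  have -> : (base b d)`_(b + d) = lead_coef (base b d) by rewrite lead_coefE szbase.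
  rewrite lead_coefM lead_coefXn mul1r lead_coef_exp; congr (_ ^+ _).
  by rewrite -opprB lead_coefN lead_coefXsubC.
have baseE b d (s : R) : (base b d).[s%:C] = (s ^+ b * (1 - s) ^+ d)%:C.
  rewrite hornerM hornerXn horner_exp hornerD hornerN hornerX hornerC.
  by rewrite rmorphM !rmorphXn rmorphB /= rmorph1.
(* At the selected frequency a + b = p + 2 b and c + d = q + 2 d: the weight splits off and only
   integral powers of s and 1 - s remain. *)
have wE s a b c d : in01 s -> (a + l1 == b + k1)%N -> (c + l2 == d + k2)%N ->
    (Num.sqrt s ^+ (a + b) * Num.sqrt (1 - s) ^+ (c + d))%:C =
    (W s)%:C * (base b d).[s%:C].
  move=> /andP[s0 s1] /eqP ab /eqP cd; rewrite baseE -rmorphM; congr (_%:C).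
  have -> : (a + b = p + b * 2)%N by lia.
  have -> : (c + d = q + d * 2)%N by lia.
  rewrite /sqrt_weight !exprD ![(_ * 2)%N]mulnC !exprM !sqr_sqrtr ?subr_ge0 //; ring.
pose g : {poly C} := \sum_(t <- ts) let: (x, (a, b, c, d)) := t in
  if (a + l1 == b + k1)%N && (c + l2 == d + k2)%N then x *: base b d else 0.
have degN x a b c d : (x, (a, b, c, d)) \in ts -> (a + b + c + d < N)%N.
  by move=> /deg; lia.
(* For the surviving terms p + q + 2 (b + d) < N = p + q + 2 n, hence b + d < n. *)
have szg : (size g <= n)%N.
  rewrite /g big_seq; elim/big_rec: _ => [|[x [[[a b] c] d]] u tts IH]; first by rewrite size_poly0.
  apply: leq_trans (size_polyD _ _) _; rewrite geq_max IH andbT.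
  case: ifP => [/andP[/eqP ab /eqP cd]|_]; last by rewrite size_poly0.
  apply: leq_trans (size_scale_leq _ _) _; rewrite szbase.
  by have := degN _ _ _ _ _ tts; lia.
exists (base l1 l2 - g); first split.
- apply: leq_trans (size_polyD _ _) _; rewrite size_polyN geq_max szbase leqnn.
  exact: leq_trans szg _.
- by rewrite coefB lcbase (nth_default 0 szg) subr0.
move=> s s01; have /andP[s0 s1] := s01.
have := @torus_average_le R M isT k1 l1 k2 l2
  (fun z1 z2 => monomial4 k1 l1 k2 l2 z1 z2 - P z1 z2) (Num.sqrt s) (Num.sqrt (1 - s)) B.
have HB : forall u v : C, cmod u = 1 -> cmod v = 1 ->
    cmod (monomial4 k1 l1 k2 l2 ((Num.sqrt s)%:C * u) ((Num.sqrt (1 - s))%:C * v) -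
     P ((Num.sqrt s)%:C * u) ((Num.sqrt (1 - s))%:C * v)) <= B.
  move=> u v u1 v1.
  apply: (@ball_norm_ub P ((Num.sqrt s)%:C * u, (Num.sqrt (1 - s))%:C * v)) => //.
  rewrite /complex_ball /= !cmodM u1 v1 !mulr1 !cmod_real !real_normK ?num_real //.
  by rewrite !sqr_sqrtr ?subr_ge0 // addrC subrK.
move=> /(_ HB); rewrite torus_averageB torus_average_monomial //; try (rewrite /M; lia).
rewrite !(addnC l1) !(addnC l2) !eqxx /= !(addnC _ l1) !(addnC _ l2).
have -> : torus_average M k1 l1 k2 l2 P (Num.sqrt s) (Num.sqrt (1 - s)) =
    (W s)%:C * g.[s%:C].
  pose x (t : C * (nat * nat * nat * nat)) := t.1.
  pose f (t : C * (nat * nat * nat * nat)) : C -> C -> C :=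
    let: (_, (a, b, c, d)) := t in monomial4 a b c d.
  have -> : P = (fun z1 z2 => \sum_(t <- ts) x t * f t z1 z2).
    apply/funext => z1; apply/funext => z2; rewrite PE.
    by apply: eq_bigr => -[y [[[a b] c] d]] _.
  rewrite torus_average_sum /g horner_sum mulr_sumr big_seq [RHS]big_seq.
  apply: eq_bigr => -[y [[[a b] c] d]] tts; rewrite /x /f /=.
  have dN := degN _ _ _ _ _ tts.
  rewrite torus_average_monomial //; try (rewrite /M; lia).
  case: ifP => [/andP[ab cd]|_]; last by rewrite horner0 !mulr0.
  by rewrite (wE _ _ _ _ _ s01 ab cd) hornerZ; ring.
have := wE s k1 l1 k2 l2 s01; rewrite [(l1 + k1)%N]addnC [(l2 + k2)%N]addnC => /(_ (eqxx _) (eqxx _)).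
move=> ->; rewrite -mulrBr cmodM cmod_real ger0_norm ?sqrt_weight_ge0 //.
by rewrite hornerD hornerN.
Qed.

Lemma tips_interlace (xs : seq R) (xi : nat -> R) : size xs = n ->
  (forall j, (j <= n)%N -> all (fun x => x < xi j) (take j xs) /\
                           all (fun x => xi j < x) (drop j xs)) ->
  forall i j, (i <= n)%N -> (j < n)%N ->
    ((i <= j)%N -> xi i < nth 0 xs j) /\ ((j < i)%N -> nth 0 xs j < xi i).
Proof.
move=> sz H i j iN jn; have [Hl Hr] := H i iN; split => ij.
  have := all_nthP 0 Hr (j - i)%N; rewrite nth_drop subnKC //; apply.
  by rewrite size_drop sz ltn_sub2r // (leq_ltn_trans ij).
have := all_nthP 0 Hl j; rewrite nth_take //; apply.
by rewrite size_take sz; case: ifP => // _; rewrite (leq_trans ij).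
Qed.

Theorem min_deviationE (xs : seq R) (E : R) : 0 < E -> size xs = n ->
  (forall s, in01 s -> `|wprod W xs s| <= E) ->
  (forall l r, xs = l ++ r -> exists2 s, in01 s &
      [/\ all (fun x => x < s) l, all (fun x => s < x) r & `|wprod W xs s| = E]) ->
  min_deviation R k1 l1 k2 l2 = E.
Proof.
move=> E0 sz bnd tips; apply/eqP; rewrite eq_le; apply/andP; split.
  (* Upper bound: the l1 smallest zeros go to |z1|^2, the others to |z2|^2, and the tip between the
     two groups is the one needed in [triangle_bound]. *)
  pose l := take l1 xs; pose r := drop l1 xs.
  have xsE : xs = l ++ r by rewrite cat_take_drop.
  have szl : size l = l1 by rewrite size_take sz; case: ltngtP (leq_addr l2 l1) => //; lia.
  have szr : size r = l2 by rewrite size_drop sz addKn.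
  have [xi xi01 [lxi rxi xiE]] := tips l r xsE.
  have GP := extremal_poly_leading szl szr.
  apply: (min_deviation_le GP) => z zb; rewrite opprB addrC subrK cmod_extremal_poly.
  rewrite xsE in xiE bnd.
  by apply: (triangle_bound E0 xi01 lxi rxi xiE bnd); rewrite ?sqr_ge0.
have /choice[xi hxi] : forall j, exists s, (j <= n)%N -> in01 s /\
    [/\ all (fun x => x < s) (take j xs), all (fun x => s < x) (drop j xs) &
     `|wprod W xs s| = E].
  move=> j; have [s s01 Hs] := tips (take j xs) (drop j xs) (esym (cat_take_drop j xs)).
  by exists s.
have inter := tips_interlace sz (fun j jn => conj (let: And3 h _ _ := (hxi j jn).2 in h)
  (let: And3 _ h _ := (hxi j jn).2 in h)).
have xi_lt i j : (i < j)%N -> (j <= n)%N -> xi i < xi j.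
  move=> ij jn; have iN : (i < n)%N := leq_trans ij jn.
  apply: lt_trans ((inter i i (ltnW iN) iN).1 (leqnn i)) ((inter j i jn iN).2 ij).
apply: lb_le_inf.
  exists (ball_norm (fun z1 z2 => monomial4 k1 l1 k2 l2 z1 z2 - (fun=> fun=> 0) z1 z2)).
  by exists (fun=> fun=> 0) => //; exists [::]; split => // z1 z2; rewrite big_nil.
move=> _ [P PP <-]; set B := ball_norm _.
have [h [szh lch] hB] := sphere_polynomial PP; rewrite -/B in hB.
pose x (i : 'I_n.+1) : R := xi i.
have injx : injective x.
  move=> i j xij; apply/val_inj; case: (ltngtP i j) => // ij.
    by have := xi_lt i j ij (ltn_ord j); rewrite -/(x i) xij ltxx.
  by have := xi_lt j i ij (ltn_ord i); rewrite -/(x i) xij ltxx.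
pose dprod i := \prod_(k < n) (x i - x (lift i k)).
(* The k-th zero and the tip with index lift i k lie on the same side of the i-th tip. *)
have sgn i : 0 < dprod i * zero_prod xs (x i).
  rewrite /zero_prod (big_nth 0) sz big_mkord -big_split /=.
  apply: prodr_gt0 => k _.
  have [lo hi] := inter i k (ltn_ord i) (ltn_ord k).
  have [ik|ki] := leqP i k.
    have lk : lift i k = k.+1 :> nat by rewrite /= /bump ik.
    rewrite -mulrNN !opprB mulr_gt0 // subr_gt0; last exact: lo.
    by rewrite /x lk xi_lt // ltnS.
  have lk : lift i k = k :> nat by rewrite /= /bump leqNgt ki.
  rewrite mulr_gt0 // subr_gt0; last exact: hi.
  by rewrite /x lk xi_lt // -ltnS ltn_ord.
have tipE i : W (x i) * `|zero_prod xs (x i)| = E.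
  have [_ [_ _ <-]] := hxi i (ltn_ord i).
  by rewrite normrM ger0_norm // sqrt_weight_ge0.
have d0 i : 0 < `|dprod i|.
  by rewrite normr_gt0; apply/eqP => d0; have := sgn i; rewrite d0 mul0r ltxx.
have W0 i : 0 < W (x i).
  rewrite lt_def sqrt_weight_ge0 andbT; apply: contraTneq E0 => W0.
  by rewrite -(tipE i) W0 mul0r ltxx.
(* The divided difference of the extremal monic polynomial: all its terms are positive, and each
   equals E / (|dprod i| W (x i)). *)
have sumE : E * \sum_(i < n.+1) (`|dprod i| * W (x i))^-1 = 1.
  have := @divided_difference R n x (\prod_(y <- xs) ('X - y%:P)) injx.
  rewrite size_prod_XsubC sz => /(_ (leqnn _)).
  have -> : (\prod_(y <- xs) ('X - y%:P))`_n = 1.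
    by have /monicP := monic_prod_XsubC xs predT id; rewrite lead_coefE size_prod_XsubC sz.
  move=> <-; rewrite mulr_sumr; apply: eq_bigr => i _.
  have -> : (\prod_(y <- xs) ('X - y%:P)).[x i] = zero_prod xs (x i).
    by rewrite horner_prod; apply: eq_bigr => y _; rewrite hornerXsubC.
  have dn0 : dprod i != 0 by rewrite -normr_gt0.
  have -> : zero_prod xs (x i) / dprod i = `|zero_prod xs (x i)| / `|dprod i|.
    rewrite -normfV -normrM ger0_norm //.
    have -> : zero_prod xs (x i) / dprod i = (dprod i * zero_prod xs (x i)) / dprod i ^+ 2.
      by field.
    by rewrite divr_ge0 ?sqr_ge0 // ltW.
  by rewrite -(tipE i); field; rewrite !gt_eqF.
have S0 : 0 < \sum_(i < n.+1) (`|dprod i| * W (x i))^-1.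
  by rewrite -(pmulr_rgt0 _ E0) sumE.
rewrite -(ler_pM2r S0) sumE.
pose xC (i : 'I_n.+1) : C := (x i)%:C.
have injxC : injective xC by move=> i j /(congr1 (@complex.Re R)) /injx.
(* The same functional applied to h gives a number of modulus 1, while W |h| <= B at the tips;
   comparison with [sumE] yields E <= B. *)
have := divided_difference injxC szh; rewrite lch => /(congr1 (@cmod R)).
rewrite cmodX cmodN cmod1 expr1n => <-.
apply: le_trans (cmod_sum _ _) _; rewrite mulr_sumr; apply: ler_sum => i _.
have -> : \prod_(k < n) (xC i - xC (lift i k)) = (dprod i)%:C.
  by rewrite rmorph_prod; apply: eq_bigr => k _; rewrite rmorphB.
have -> : B * (`|dprod i| * W (x i))^-1 = (B / W (x i)) / `|dprod i|.
  by field; rewrite !gt_eqF.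
rewrite cmod_div cmod_real ler_pM2r ?invr_gt0 //.
have [xi01 _] := hxi i (ltn_ord i).
by rewrite ler_pdivlMr // mulrC; exact: hB.
Qed.

End MinimalDeviationValue.

(** * The normalized conformal map *)

Section ConformalMap.
Variable R : realType.
Local Notation C := R[i].
Local Notation H := (@upper_half_plane R).

Variables (p q : nat) (xs : seq R) (E : R).
Local Notation W := (sqrt_weight p q).
Local Notation n := (size xs).
Hypothesis E0 : 0 < E.
Hypothesis xs_in : forall x, x \in xs -> 0 < x < 1.
Hypothesis bnd : forall s, in01 s -> `|wprod W xs s| <= E.
Hypothesis tips : forall l r, xs = l ++ r -> exists2 s, in01 s &
  [/\ all (fun x => x < s) l, all (fun x => s < x) r & `|wprod W xs s| = E].
Hypothesis nondegenerate : ~~ [&& n == 0, p == 0 & q == 0]%N.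

Local Notation alpha := (p%:R / 2 : R).
Local Notation beta := (q%:R / 2 : R).

(** The filter removes the terms at 0 and 1 of weight zero, so that all weights are positive and an
    endpoint of weight zero does not count as a pole. *)
Definition map_terms : seq (R * R) :=
  [seq t <- (alpha, 0) :: (beta, 1) :: [seq (1, x) | x <- xs] | 0 < t.1].
Local Notation ts := map_terms.

(** The real part sends the points with |F| = E to the imaginary axis; the imaginary part gives the
    interval between the last zero and 1 the height 0. *)
Definition map_cst : C := - ln E +i* - (beta * pi).
Local Notation k := map_cst.
Local Notation w := (logsum ts k).

Lemma half_nat_eq0 (m : nat) : (m%:R / 2 == 0 :> R) = (m == 0)%N.
Proof. by rewrite mulf_eq0 invr_eq0 !pnatr_eq0 orbF. Qed.

Lemma half_nat_gt0 (m : nat) : (0 < m%:R / 2 :> R) = (0 < m)%N.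
Proof. by rewrite pmulr_lgt0 ?invr_gt0 // ltr0n. Qed.

Lemma ts_pos t : t \in ts -> 0 < t.1.
Proof. by rewrite mem_filter => /andP[]. Qed.

Lemma mem_ts t : t \in ts <->
  [\/ (0 < p)%N /\ t = (alpha, 0), (0 < q)%N /\ t = (beta, 1) | exists2 x, x \in xs & t = (1, x)].
Proof.
rewrite mem_filter !in_cons; split.
  case/andP => t0 /or3P[/eqP tE|/eqP tE|/mapP[x xxs tE]].
  - by constructor 1; split=> //; move: t0; rewrite tE half_nat_gt0.
  - by constructor 2; split=> //; move: t0; rewrite tE half_nat_gt0.
  - by constructor 3; exists x.
case=> [[p0 ->]|[q0 ->]|[x xxs ->]] /=.
- by rewrite half_nat_gt0 p0 eqxx.
- by rewrite half_nat_gt0 q0 eqxx orbT.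
- by rewrite ltr01 /= map_f // !orbT.
Qed.

Lemma ts01 t : t \in ts -> 0 <= t.2 <= 1.
Proof.
move=> /mem_ts[[_ ->]|[_ ->]|[x /xs_in/andP[x0 x1] ->]] /=; rewrite ?lexx ?ler01 //.
by rewrite !ltW.
Qed.

Lemma ts_neq0 : ts != [::].
Proof.
apply/eqP => ts0; have nin t : ~ t \in ts by rewrite ts0.
move: nondegenerate; rewrite !negb_and -!lt0n => /or3P[n0|p0|q0].
- have [x xxs] : exists x, x \in xs by case: xs n0 => // x s _; exists x; rewrite mem_head.
  by apply: (nin (1, x)); apply/mem_ts; constructor 3; exists x.
- by apply: (nin (alpha, 0)); apply/mem_ts; constructor 1.
- by apply: (nin (beta, 1)); apply/mem_ts; constructor 2.
Qed.

Lemma sum_ts (f : R -> R) : \sum_(t <- ts) t.1 * f t.2 =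
  alpha * f 0 + (beta * f 1 + \sum_(x <- xs) f x).
Proof.
have a0 : 0 <= alpha by rewrite divr_ge0.
have b0 : 0 <= beta by rewrite divr_ge0.
rewrite big_filter big_mkcond !big_cons /= big_map; congr (_ + (_ + _)).
- by case: ltgtP a0 => // <- _; rewrite mul0r.
- by case: ltgtP b0 => // <- _; rewrite mul0r.
- by apply: eq_bigr => x _; rewrite ltr01 mul1r.
Qed.

Lemma weightE : weight ts = alpha + beta + n%:R.
Proof.
have := sum_ts (fun=> 1); rewrite !mulr1 big_const_seq count_predT iter_addr addr0 addrA => <-.
by apply: eq_bigr => t _; rewrite mulr1.
Qed.

Definition upper_weight (s : R) : R := \sum_(t <- ts | s < t.2) t.1.

Lemma upper_weightE s : upper_weight s =
  alpha * (s < 0)%R%:R + (beta * (s < 1)%R%:R + (count (fun x => (s < x)%R) xs)%:R).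
Proof.
rewrite /upper_weight -sum1_count natr_sum [in RHS]big_mkcond /=.
have -> : \sum_(x <- xs) (if s < x then 1 else 0) = \sum_(x <- xs) (s < x)%R%:R :> R.
  by apply: eq_bigr => x _; case: ifP.
rewrite -(sum_ts (fun x => (s < x)%R%:R)) big_mkcond; apply: eq_bigr => t _.
by case: ifP => _; rewrite ?mulr1 ?mulr0.
Qed.

Lemma ImE_real s : not_pole ts s%:C -> Im (w s%:C) = pi * upper_weight s - beta * pi.
Proof. exact: Im_logsum_real. Qed.

Lemma not_poleP s : not_pole ts s%:C <->
  [/\ (0 < p)%N -> s != 0, (0 < q)%N -> s != 1 & s \notin xs].
Proof.
have E1 (a b : R) : a%:C != b%:C :> C -> a != b by apply: contra => /eqP ->.
have E2 (a b : R) : a != b -> a%:C != b%:C :> C.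
  by apply: contra => /eqP /(congr1 (@complex.Re R)) /= ->.
split=> [np|[p0 q0 sxs] t /mem_ts[[pp ->]|[qq ->]|[x xxs ->]]].
- split=> [pp|qq|].
  + by apply: E1; apply: (np (alpha, 0)); apply/mem_ts; constructor 1.
  + by apply: E1; apply: (np (beta, 1)); apply/mem_ts; constructor 2.
  + apply/negP => sxs; have : (1, s) \in ts by apply/mem_ts; constructor 3; exists s.
    by move/np; rewrite eqxx.
- by apply: E2; exact: p0.
- by apply: E2; exact: q0.
- by apply: E2; apply: contraNneq sxs => ->.
Qed.

Lemma sqrtX_neq0 (m : nat) (s : R) : 0 <= s ->
  (Num.sqrt s ^+ m != 0) = (m == 0)%N || (s != 0).
Proof.
by move=> s0; rewrite expf_eq0 sqrtr_eq0 negb_and -eqn0Ngt -ltNge lt_def s0 andbT.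
Qed.

Lemma wprod_neq0 s : in01 s -> wprod W xs s != 0 <-> not_pole ts s%:C.
Proof.
move=> /andP[s0 s1]; rewrite not_poleP /wprod /sqrt_weight !mulf_eq0 !negb_or.
rewrite !sqrtX_neq0 ?subr_ge0 // subr_eq0 [1 == s]eq_sym.
have zE : (zero_prod xs s != 0) = (s \notin xs).
  apply/idP/idP; last exact: zero_prod_neq0.
  apply: contra => sxs; rewrite prodf_seq_eq0; apply/hasP; exists s => //=.
  by rewrite subrr.
rewrite zE; split=> [/andP[/andP[a b] ->]|[a b ->]].
  by split=> //; rewrite lt0n => m0; [move: a|move: b]; rewrite (negPf m0).
by rewrite andbT; apply/andP; split; case: posnP => //= ?.
Qed.

Lemma ln_sqrtX (m : nat) (s : R) : 0 <= s -> ln (Num.sqrt s ^+ m) = m%:R / 2 * ln s.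
Proof.
(* At s = 0 both sides are 0, because [ln 0] is 0. *)
rewrite le_eqVlt => /predU1P[<-|s0].
  by rewrite sqrtr0 expr0n [ln 0]ln0 // mulr0; case: (m == 0%N); rewrite ?ln1 ?ln0.
have r0 : 0 < Num.sqrt s by rewrite sqrtr_gt0.
rewrite lnXn // -[X in _ * ln X](sqr_sqrtr (ltW s0)) lnXn //.
by rewrite -[LHS]mulr_natl -[ln _ *+ 2]mulr_natl; field.
Qed.

Lemma ReE_real s : in01 s -> not_pole ts s%:C -> Re (w s%:C) = ln `|wprod W xs s| - ln E.
Proof.
move=> s01 np; have wn0 := (wprod_neq0 s01).2 np; have /andP[s0 s1] := s01.
have cE (x : R) : cmod (s%:C - x%:C) = `|s - x|.
  by rewrite -cmod_real; congr cmod; apply: complex_ext; rewrite !ReImE ?subrr.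
rewrite Re_logsum; congr (_ + _).
under eq_bigr do rewrite cE.
rewrite (sum_ts (fun x => ln `|s - x|)).
move: wn0; rewrite /wprod /sqrt_weight !mulf_eq0 !negb_or => /andP[/andP[a b] c].
rewrite !normrM !lnM ?posrE ?mulr_gt0 ?normr_gt0 // !(ger0_norm (exprn_ge0 _ (sqrtr_ge0 _))).
rewrite !ln_sqrtX ?subr_ge0 // subr0 (ger0_norm s0) distrC (ger0_norm (_ : 0 <= 1 - s)) ?subr_ge0 //.
rewrite -addrA; congr (_ + (_ + _)).
elim: xs c => [|x r IH]; first by rewrite /zero_prod !big_nil normr1 ln1.
rewrite zero_prod_cons big_cons mulf_eq0 negb_or => /andP[sx rn].
by rewrite IH // normrM lnM ?posrE ?normr_gt0.
Qed.

Lemma Re_le0_real s : in01 s -> not_pole ts s%:C -> Re (w s%:C) <= 0.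
Proof.
move=> s01 np; have wn0 := (wprod_neq0 s01).2 np.
by rewrite ReE_real // subr_le0 ler_ln ?posrE ?normr_gt0 // bnd.
Qed.

(** Each zero to the right of s contributes pi, and the contribution of the pole at 1 is cancelled
    by [map_cst]: these are the heights of the cuts. *)
Lemma level_real s : in01 s -> not_pole ts s%:C ->
  Im (w s%:C) = (count (fun x => (s < x)%R) xs)%:R * pi.
Proof.
move=> /andP[s0 s1] np; have [_ q1 _] := (not_poleP s).1 np.
rewrite ImE_real // upper_weightE ltNge s0 mulr0 add0r.
have -> : beta * (s < 1)%R%:R = beta.
  have [q0|q0] := posnP q; first by rewrite q0 mul0r mul0r.
  by rewrite lt_neqAle (q1 q0) s1 mulr1.
ring.
Qed.

Lemma split_count l r s : xs = l ++ r -> all (fun x => x < s) l -> all (fun x => s < x) r ->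
  count (fun x => (s < x)%R) xs = size r.
Proof.
move=> -> /allP ls /allP rs; rewrite count_cat.
rewrite (eq_in_count (a2 := pred0)) => [|x /ls xs0]; last by apply/negbTE; rewrite -leNgt ltW.
by rewrite count_pred0 (eq_in_count (a2 := predT)) ?count_predT // => x /rs ->.
Qed.

Lemma tip l r : xs = l ++ r -> exists s, [/\ in01 s, not_pole ts s%:C,
  w s%:C = 0 +i* ((size r)%:R * pi), all (fun x => x < s) l & all (fun x => s < x) r].
Proof.
move=> xsE; have [s s01 [ls rs sE]] := tips xsE.
have np : not_pole ts s%:C by apply/(wprod_neq0 s01); rewrite -normr_gt0 sE.
exists s; split=> //; apply: complex_ext; first by rewrite ReE_real // sE subrr.
by rewrite level_real // (split_count xsE).
Qed.

Lemma tip_side (s v : R) z : not_pole ts s%:C -> w s%:C = 0 +i* v -> 0 < Im z ->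
  Re (w z) <= 0 -> (Im (w z) - v) * (Re z - s) < 0.
Proof.
move=> np ws z0 wz.
have zs : z != s%:C by apply: contraTneq z0 => ->; rewrite ltxx.
have s0 : 0 <= Im s%:C by rewrite Im_real.
have := logsum_monotone k ts_pos ts_neq0 z0 s0 np zs.
rewrite ws; move: (w z) wz => om om0; rewrite !ReImE.
have := mulr_ge0_le0 (ltW z0) om0; lra.
Qed.

Lemma map_range z : 0 < Im z -> - (beta * pi) < Im (w z) < (alpha + n%:R) * pi.
Proof.
move=> z0; have := Im_logsum_bounds k ts_pos ts_neq0 z0.
rewrite weightE ImE => /andP[-> h]; apply: lt_le_trans h _.
by rewrite le_eqVlt; apply/orP; left; apply/eqP; ring.
Qed.

Lemma map_image : w @` H = Omega n alpha beta.
Proof.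
have pi0 := pi_gt0 R.
apply/seteqP; split=> [_ [z z0 <-]|[u v]].
  have /andP[h1 h2] := map_range z0; split=> /=.
    by rewrite ltr_pdivlMr // ltr_pdivrMr // mulNr h1 h2.
  move=> [j /= jn [vj u0]].
  (* The height of a tip counts the zeros to its right, so the cut at height j pi ends at the tip
     followed by j zeros. *)
  have xsE : xs = take (n - j) xs ++ drop (n - j) xs by rewrite cat_take_drop.
  have [s [s01 np ws _ _]] := tip xsE.
  have jE : size (drop (n - j) xs) = j by rewrite size_drop subKn // -ltnS.
  have := tip_side np ws z0 u0; rewrite jE -vj divfK ?gt_eqF //.
  by rewrite subrr mul0r ltxx.
rewrite /Omega /= => -[]; rewrite ltr_pdivlMr // ltr_pdivrMr // mulNr => /andP[h1 h2] cut.
have [||z z0 wz] := @logsum_surjective _ ts k ts_pos ts_neq0 ts01 u v; last by exists z.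
  rewrite weightE ImE h1 /=; apply: lt_le_trans h2 _.
  by rewrite le_eqVlt; apply/orP; left; apply/eqP; ring.
(* A real point outside [0, 1] has the height of an edge of the strip. Inside, the height is that of
   a cut and Re w <= 0, while u > 0 because u + i v avoids the cut. *)
move=> x np wx.
have [x0|x0] := ltrP x 0.
  move: wx; rewrite ImE_real // upper_weightE x0 (lt_trans x0 ltr01) !mulr1.
  have -> : count (fun y => (x < y)%R) xs = n.
    rewrite (eq_in_count (a2 := predT)) ?count_predT // => y /xs_in/andP[y0 _].
    exact: lt_trans y0.
  by move=> vE; move: h2; rewrite -vE; lra.
have [x1|x1] := ltrP 1 x.
  move: wx; rewrite ImE_real // upper_weightE ltNge x0 ltNge (ltW x1) !mulr0 !add0r.
  rewrite (eq_in_count (a2 := pred0)) ?count_pred0 => [vE|y /xs_in/andP[_ y1]].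
    by move: h1; rewrite -vE mulr0 add0r ltxx.
  by apply/negbTE; rewrite -leNgt ltW // (lt_trans y1).
have x01 : in01 x by rewrite /in01 x0 x1.
apply: le_lt_trans (Re_le0_real x01 np) _; rewrite ltNge; apply/negP => u0; apply: cut.
exists (count (fun y => (x < y)%R) xs) => /=; first by rewrite ltnS count_size.
by rewrite -wx level_real // mulfK ?gt_eqF.
Qed.

(** Without weight at 0, |F| does not increase from 0 to the first tip, so |F 0| >= E and 0 is
    itself a tip. *)
Lemma value_at_0 : p = 0%N -> not_pole ts 0%:C /\ w 0%:C = 0 +i* (n%:R * pi).
Proof.
move=> p0; have i0 : in01 (0 : R) by rewrite /in01 lexx ler01.
have [xi xi01 [_ rxi xiE]] := tips (esym (cat0s xs)).
have Fxi s : `|wprod W xs s| = half_prod q (mirror xs) (1 - s).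
  by rewrite -[xs in LHS]cat0s wprod_halves p0 /half_prod /zero_prod big_nil expr0 normr1 !mul1r.
have F0 : `|wprod W xs 0| = E.
  apply/eqP; rewrite eq_le bnd // -xiE !Fxi subr0.
  have /andP[x0 x1] := xi01; apply: half_prod_monotone; [|lra|lra].
  by rewrite all_map; apply: sub_all rxi => x /=; lra.
have np : not_pole ts 0%:C by apply/(wprod_neq0 i0); rewrite -normr_gt0 F0.
split=> //; apply: complex_ext; first by rewrite ReE_real // F0 subrr.
rewrite level_real // ImE; congr (_%:R * _).
rewrite (eq_in_count (a2 := predT)) ?count_predT // => x /xs_in/andP[x0 _].
exact: x0.
Qed.

Lemma value_at_1 : q = 0%N -> not_pole ts 1%:C /\ w 1%:C = 0.
Proof.
move=> q0; have i1 : in01 (1 : R) by rewrite /in01 lexx ler01.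
have [xi xi01 [lxi _ xiE]] := tips (esym (cats0 xs)).
have Fxi s : `|wprod W xs s| = half_prod p xs s.
  rewrite -[xs in LHS]cats0 wprod_halves q0 /mirror /= {2}/half_prod /zero_prod big_nil.
  by rewrite expr0 normr1 !mulr1.
have F1 : `|wprod W xs 1| = E.
  apply/eqP; rewrite eq_le bnd // -xiE !Fxi.
  by have /andP[x0 x1] := xi01; apply: half_prod_monotone.
have np : not_pole ts 1%:C by apply/(wprod_neq0 i1); rewrite -normr_gt0 F1.
split=> //; apply: complex_ext; first by rewrite ReE_real // F1 subrr.
rewrite level_real // (eq_in_count (a2 := pred0)) ?count_pred0 ?mul0r //.
by move=> x /xs_in/andP[_ x1]; apply/negbTE; rewrite -leNgt ltW.
Qed.

(** The tip that separates 0 from all other poles; it identifies the topmost end of the domain. *)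
Lemma top_tip : exists xi, [/\ not_pole ts xi%:C, w xi%:C = 0 +i* (n%:R * pi), 0 <= xi,
  (0 < p)%N -> 0 < xi & forall t, t \in ts -> t.2 != 0 -> xi < t.2].
Proof.
have [xi [xi01 np wxi _ rxi]] := tip (esym (cat0s xs)).
have /andP[x0 x1] := xi01; have [p0 q0 _] := (not_poleP xi).1 np.
exists xi; split=> // [pp|t /mem_ts[[_ ->]|[qq ->]|[x xxs ->]]] /=; rewrite ?eqxx //.
- by rewrite lt_def p0.
- by rewrite lt_neqAle q0.
- by move=> _; have /allP := rxi; apply.
Qed.

Lemma bottom_tip : exists xi, [/\ not_pole ts xi%:C, w xi%:C = 0, xi <= 1,
  (0 < q)%N -> xi < 1 & forall t, t \in ts -> t.2 != 1 -> t.2 < xi].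
Proof.
have [xi [xi01 np wxi lxi _]] := tip (esym (cats0 xs)).
have /andP[x0 x1] := xi01; have [p0 q0 _] := (not_poleP xi).1 np.
exists xi; split=> // [|qq|t /mem_ts[[pp ->]|[_ ->]|[x xxs ->]]] /=; rewrite ?eqxx //.
- by rewrite wxi mul0r.
- by rewrite lt_neqAle q0.
- by rewrite lt_def p0.
- by move=> _; have /allP := lxi; apply.
Qed.

Lemma pole_cvg (e : R) : (exists2 t, t \in ts & t.2 = e) ->
  complex.Re (w z) @[z --> uhp_at e] --> -oo.
Proof.
move=> ets; have FF := uhp_at_filter e.
apply/cvgrNyPltr => M _; apply/near_uhp_at.
have [d d0 hd] := logsum_at_pole k ts_pos M ets; exists d => // z z0 zd.
by apply: hd => //; apply: contraTneq z0 => ->; rewrite ltxx.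
Qed.

Lemma not_pole_cvg (e : R) : not_pole ts e%:C -> w z @[z --> uhp_at e] --> (w e%:C : C^o).
Proof.
move=> np; have FF := uhp_at_filter e; apply/cvg_complexP => eps eps0.
apply/near_uhp_at; have [r r0 hr] := ccont_shift (ccont_logsum k np) eps0.
by exists r => // z _; exact: hr.
Qed.

Theorem logsum_normalized : normalized_map n alpha beta w.
Proof.
have pi0 := pi_gt0 R.
split.
- split=> [z z0|].
    apply/derivable_cdiff; exists (\sum_(t <- ts) t.1%:C * (z - t.2%:C)^-1).
    exact: cdiff_logsum.
  split=> [z Hz|a b|y].
  + by rewrite -map_image; exists z.
  + by rewrite !inE => Ha Hb; exact: (logsum_injective ts_pos ts_neq0).
  + by rewrite -map_image.
- rewrite half_nat_eq0; case: ifPn => [/eqP p0|].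
    by have [np <-] := value_at_0 p0; exact: not_pole_cvg.
  rewrite -lt0n => p0.
  have ets : exists2 t, t \in ts & t.2 = 0.
    by exists (alpha, 0) => //; apply/mem_ts; constructor 1.
  split; first exact: pole_cvg.
  (* Near 0 the real part is negative and z lies to the left of this tip, so [tip_side] places w z
     above the n-th cut. *)
  have [xi [np wxi _ /(_ p0) xi0 _]] := top_tip.
  have [d d0 hd] := logsum_at_pole k ts_pos 0 ets.
  apply/near_uhp_at; exists (Num.min d xi); first by rewrite lt_min d0.
  move=> z z0; rewrite lt_min => /andP[zd zxi].
  have /andP[_ h2] := map_range z0.
  have wz : Re (w z) <= 0.
    by apply/ltW/hd => //; apply: contraTneq z0 => ->; rewrite ltxx.
  have := tip_side np wxi z0 wz.
  have zx : Re z - xi < 0.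
    by have := le_lt_trans (Re_le_cmod _) zxi; rewrite ReB Re_real subr0 ltr_norml; lra.
  rewrite nmulr_llt0 // subr_gt0 => h1.
  by rewrite ltr_pdivlMr // h1 ltr_pdivrMr // addrC.
- rewrite half_nat_eq0; case: ifPn => [/eqP q0|].
    by have [np <-] := value_at_1 q0; exact: not_pole_cvg.
  rewrite -lt0n => q0.
  have ets : exists2 t, t \in ts & t.2 = 1.
    by exists (beta, 1) => //; apply/mem_ts; constructor 2.
  split; first exact: pole_cvg.
  have [xi [np wxi _ /(_ q0) xi1 _]] := bottom_tip.
  have [d d0 hd] := logsum_at_pole k ts_pos 0 ets.
  apply/near_uhp_at; exists (Num.min d (1 - xi)); first by rewrite lt_min d0 subr_gt0.
  move=> z z0; rewrite lt_min => /andP[zd zxi].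
  have /andP[h1 _] := map_range z0.
  have wz : Re (w z) <= 0.
    by apply/ltW/hd => //; apply: contraTneq z0 => ->; rewrite ltxx.
  have := tip_side np (wxi : w xi%:C = 0 +i* 0) z0 wz.
  have zx : 0 < Re z - xi.
    by have := le_lt_trans (Re_le_cmod _) zxi; rewrite ReB Re_real ltr_norml; lra.
  rewrite pmulr_llt0 // subr_lt0 => h2.
  by rewrite ltr_pdivlMr // mulNr h1 ltr_pdivrMr // mul0r.
- have FF := uhp_infty_filter R; apply/cvgryPgtr => M _; apply/near_uhp_infty.
  have W0 := weight_gt0 ts_pos ts_neq0.
  exists (1 + expR ((M - Re k) / weight ts)) => z z0 zr.
  have e0 := expR_gt0 ((M - Re k) / weight ts).
  have z1 : 1 < cmod z by lra.
  apply: lt_le_trans (Re_logsum_infty k ts_pos ts01 z1).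
  rewrite -ltrBlDr mulrC -ltr_pdivrMr // -[ltLHS]expRK ltr_ln ?posrE //; lra.
Qed.

Theorem logsum_asymptotic_const : asymptotic_const n alpha beta w (- ln E).
Proof.
exists (weight ts * 4); apply/near_uhp_infty; exists 2 => z z0 /ltW z2.
by rewrite -weightE; exact: (logsum_asymptotic k ts_pos ts01).
Qed.

Lemma level_eq_below (b : R) : not_pole ts b%:C -> upper_weight b = weight ts ->
  forall t, t \in ts -> b < t.2.
Proof.
move=> np bE t tts; rewrite ltNge; apply/negP => tb.
have : upper_weight b < weight ts.
  rewrite /upper_weight /weight big_mkcond (perm_big _ (perm_to_rem tts)) big_cons.
  rewrite [ltRHS](perm_big _ (perm_to_rem tts)) big_cons.
  rewrite (le_gtF tb); apply: ltr_leD; first exact: ts_pos.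
  rewrite big_seq [leRHS]big_seq; apply: ler_sum => s /mem_rem /ts_pos s0.
  by case: ifP => // _; exact: ltW.
by rewrite bE ltxx.
Qed.

Lemma level_eq_above (b : R) : not_pole ts b%:C -> upper_weight b = 0 ->
  forall t, t \in ts -> t.2 < b.
Proof.
move=> np bE t tts; rewrite lt_neqAle.
have -> /= : t.2 != b by apply/eqP => tb; have := np t tts; rewrite tb eqxx.
rewrite leNgt; apply/negP => bt.
have : 0 < upper_weight b.
  rewrite /upper_weight big_mkcond (perm_big _ (perm_to_rem tts)) big_cons bt.
  apply: ltr_wpDr; last exact: ts_pos.
  rewrite big_seq; apply: sumr_ge0 => s /mem_rem /ts_pos s0.
  by case: ifP => // _; exact: ltW.
by rewrite bE ltxx.
Qed.

Lemma Re_real_lt (a b : R) : not_pole ts a%:C ->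
  (forall t, t \in ts -> `|a - t.2| < `|b - t.2|) -> Re (w a%:C) < Re (w b%:C).
Proof.
move=> np lt; rewrite !Re_logsum ltrD2r; apply: ltr_sum_seq; first exact: ts_neq0.
have cE (x y : R) : cmod (x%:C - y%:C) = `|x - y|.
  by rewrite -cmod_real; congr cmod; apply: complex_ext; rewrite !ReImE ?subrr.
move=> t tts; rewrite !cE ltr_pM2l ?ts_pos // ltr_ln ?posrE ?lt //.
  by rewrite -cE cmod_gt0 subr_eq0 np.
by apply: le_lt_trans (lt t tts).
Qed.

(** The height n pi is maximal here, which forces b to the left of all poles, and there Re w is
    strictly decreasing. *)
Lemma boundary_0 (b : R) : p = 0%N -> not_pole ts b%:C -> w b%:C = w 0%:C -> b = 0.
Proof.
move=> p0 np wb; have [np0 w0] := value_at_0 p0.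
have pos t : t \in ts -> 0 < t.2.
  by move=> /mem_ts[[]|[_ ->]|[x /xs_in/andP[x0 _] ->]] //=; rewrite p0.
have [b0|b0|//] := ltgtP b 0.
  have : Re (w 0%:C) < Re (w b%:C).
    apply: Re_real_lt => // t /pos t0; rewrite !ltr0_norm ?subr_lt0 //; lra.
  by rewrite wb ltxx.
have bt : forall t, t \in ts -> b < t.2.
  apply: level_eq_below => //; apply: (mulfI (lt0r_neq0 (pi_gt0 R))).
  have := congr1 (@complex.Im R) wb; rewrite w0 ImE ImE_real // weightE p0 => E1.
  by move: E1; lra.
have : Re (w b%:C) < Re (w 0%:C).
  apply: Re_real_lt => // t tts; have := bt t tts; have := pos t tts => t0 tb.
  rewrite !ltr0_norm ?subr_lt0 //; lra.
by rewrite wb ltxx.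
Qed.

Lemma boundary_1 (b : R) : q = 0%N -> not_pole ts b%:C -> w b%:C = w 1%:C -> b = 1.
Proof.
move=> q0 np wb; have [np1 w1] := value_at_1 q0.
have lt1 t : t \in ts -> t.2 < 1.
  by move=> /mem_ts[[_ ->]|[]|[x /xs_in/andP[_ x1] ->]] //=; rewrite ?q0.
have [b1|b1|//] := ltgtP b 1; last first.
  have : Re (w 1%:C) < Re (w b%:C).
    apply: Re_real_lt => // t /lt1 t1; rewrite !gtr0_norm ?subr_gt0 //; lra.
  by rewrite wb ltxx.
have bt : forall t, t \in ts -> t.2 < b.
  apply: level_eq_above => //; apply: (mulfI (lt0r_neq0 (pi_gt0 R))).
  have := congr1 (@complex.Im R) wb; rewrite w1 ImE_real // q0 mul0r mul0r subr0 mulr0.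
  by [].
have : Re (w b%:C) < Re (w 1%:C).
  apply: Re_real_lt => // t tts; have tb := bt t tts; have t1 := lt1 t tts.
  rewrite !gtr0_norm ?subr_gt0 //; lra.
by rewrite wb ltxx.
Qed.

(** * Boundary normalization under an affine change of variable *)

Section Transfer.
Variables (g : C -> C) (la b : R).
Hypothesis la0 : 0 < la.
Hypothesis gE : forall z, 0 < Im z -> g z = w (la%:C * z + b%:C).

Lemma transfer_point (e r d : R) : 0 < r -> 0 < d ->
  exists z, [/\ 0 < Im z, cmod (z - e%:C) < r, 0 < Im (la%:C * z + b%:C),
    Re (la%:C * z + b%:C) = la * e + b & cmod (la%:C * z + b%:C - (la * e + b)%:C) < d].
Proof.
move=> r0 d0; pose y := Num.min r (d / la) / 2.
have [y0 yr yd] : [/\ 0 < y, y < r & la * y < d].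
  have M0 : 0 < Num.min r (d / la) by rewrite lt_min r0 divr_gt0.
  have M1 : Num.min r (d / la) <= r by rewrite ge_min lexx.
  have M2 : Num.min r (d / la) <= d / la by rewrite ge_min lexx orbT.
  rewrite ler_pdivlMr // in M2.
  by rewrite /y; split; [lra|lra|nra].
have ci (x : R) : 0 < x -> cmod (0 +i* x) = x.
  by move=> x0; rewrite cmodE /= expr0n add0r sqrtr_sqr gtr0_norm.
exists (e +i* y); split.
- by rewrite ImE.
- have -> : e +i* y - e%:C = 0 +i* y by apply: complex_ext; rewrite !ReImE; ring.
  by rewrite ci.
- by rewrite !ReImE mul0r !addr0 mulr_gt0.
- by rewrite !ReImE mul0r subr0.
- have -> : la%:C * (e +i* y) + b%:C - (la * e + b)%:C = 0 +i* (la * y).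
    by apply: complex_ext; rewrite !ReImE; ring.
  by rewrite ci // mulr_gt0.
Qed.

Lemma not_not_pole (x : R) : ~ not_pole ts x%:C -> exists2 t, t \in ts & t.2 = x.
Proof.
move=> H1; apply: contrapT => H2; apply: H1 => t tts; apply/eqP => xt; apply: H2.
by exists t => //; have := congr1 (@complex.Re R) xt.
Qed.

(** Approach e vertically. A pole at la e + b would make Re g tend to -oo; otherwise continuity of w
    identifies the limit. *)
Lemma transfer_finite (e : R) (L : C) : g z @[z --> uhp_at e] --> (L : C^o) ->
  not_pole ts (la * e + b)%:C /\ w (la * e + b)%:C = L.
Proof.
move=> gL; have FF := uhp_at_filter e.
have near (eps : R) : 0 < eps -> exists2 r, 0 < r & forall z, 0 < Im z ->
    cmod (z - e%:C) < r -> cmod (g z - L) < eps.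
  by move=> e0; apply/near_uhp_at; move/cvg_complexP: gL; apply.
have np : not_pole ts (la * e + b)%:C.
  apply: contrapT => /not_not_pole pole.
  have [r r0 hr] := near 1 ltr01.
  have [d d0 hd] := logsum_at_pole k ts_pos (Re L - 1) pole.
  have [z [z0 zr z'0 _ zd]] := transfer_point e r0 d0.
  have h1 := le_lt_trans (Re_le_cmod _) (hr z z0 zr).
  have h2 : Re (g z) < Re L - 1.
    by rewrite gE //; apply: hd => //; apply: contraTneq z'0 => ->; rewrite ltxx.
  by move: h1; rewrite ReB ltr_norml; lra.
split=> //; apply/eqP; rewrite -subr_eq0 -cmod_eq0 eq_le cmod_ge0 andbT.
apply/ler_addgt0Pr => eps eps0; rewrite add0r.
have e2 : 0 < eps / 2 by lra.
have [r r0 hr] := near _ e2; have [d d0 hd] := ccont_shift (ccont_logsum k np) e2.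
have [z [z0 zr z'0 _ zd]] := transfer_point e r0 d0.
have h1 := hr z z0 zr; have h2 := hd _ zd; rewrite -gE // in h2.
have -> : w (la * e + b)%:C - L = (g z - L) - (g z - w (la * e + b)%:C) by ring.
by apply: le_trans (cmodB _ _) _; lra.
Qed.

Lemma transfer_infinite (e : R) : complex.Re (g z) @[z --> uhp_at e] --> -oo ->
  exists2 t, t \in ts & t.2 = la * e + b.
Proof.
move=> gN; have FF := uhp_at_filter e; apply: not_not_pole => np.
have [r r0 hr] := (near_uhp_at _ _).1 (cvgrNy_ltr gN (num_real (Re (w (la * e + b)%:C) - 1))).
have [d d0 hd] := ccont_shift (ccont_logsum k np) (@ltr01 R).
have [z [z0 zr z'0 _ zd]] := transfer_point e r0 d0.
have h1 := hr z z0 zr; have := le_lt_trans (Re_le_cmod _) (hd _ zd).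
by rewrite -gE // ReB ltr_norml; lra.
Qed.

Lemma transfer_0 : (if alpha == 0
    then g z @[z --> uhp_at 0] --> (0 +i* (n%:R * pi) : C^o)
    else tends_to_left_end (uhp_at 0) g n%:R (n%:R + alpha)) -> la * 0 + b = 0.
Proof.
have pi0 := pi_gt0 R; rewrite half_nat_eq0; case: ifPn => [/eqP p0|_].
  have [_ w0] := value_at_0 p0; rewrite -w0.
  by move=> /transfer_finite[np wb]; exact: boundary_0.
move=> [gN gnear]; have [r r0 hr] := (near_uhp_at _ _).1 gnear.
have [t tts tE] := transfer_infinite gN.
(* A pole other than 0 lies to the right of the top tip, where [tip_side] puts the image below
   height n pi, against the normalization of g. *)
rewrite -tE; apply/eqP; apply/contraT => t0.
have [xi [np wxi _ _ /(_ t tts t0) xit]] := top_tip.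
have FF := uhp_at_filter (0 : R).
have [r' r'0 hr'] := (near_uhp_at _ _).1 (cvgrNy_ltr gN (num_real 0)).
have m0 : 0 < Num.min r r' by rewrite lt_min r0.
have [z [z0 zr z'0 z'E _]] := transfer_point 0 m0 ltr01.
move: zr; rewrite lt_min => /andP[zr zr'].
have /andP[h1 _] := hr z z0 zr; have h2 := hr' z z0 zr'.
rewrite ltr_pdivlMr // in h1.
have := tip_side np wxi z'0; rewrite -gE // z'E -tE => /(_ (ltW h2)).
by rewrite pmulr_rlt0 ?subr_gt0 // subr_lt0 ltNge (ltW xit).
Qed.

Lemma transfer_1 : (if beta == 0
    then g z @[z --> uhp_at 1] --> (0 : C^o)
    else tends_to_left_end (uhp_at 1) g (- beta) 0) -> la * 1 + b = 1.
Proof.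
have pi0 := pi_gt0 R; rewrite half_nat_eq0; case: ifPn => [/eqP q0|_].
  have [_ w1] := value_at_1 q0; rewrite -w1.
  by move=> /transfer_finite[np wb]; exact: boundary_1.
move=> [gN gnear]; have [r r0 hr] := (near_uhp_at _ _).1 gnear.
have [t tts tE] := transfer_infinite gN.
rewrite -tE; apply/eqP; apply/contraT => t1.
have [xi [np wxi _ _ /(_ t tts t1) xit]] := bottom_tip.
have FF := uhp_at_filter (1 : R).
have [r' r'0 hr'] := (near_uhp_at _ _).1 (cvgrNy_ltr gN (num_real 0)).
have m0 : 0 < Num.min r r' by rewrite lt_min r0.
have [z [z0 zr z'0 z'E _]] := transfer_point 1 m0 ltr01.
move: zr; rewrite lt_min => /andP[zr zr'].
have /andP[_ h1] := hr z z0 zr; have h2 := hr' z z0 zr'.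
rewrite ltr_pdivrMr // mul0r in h1.
have := tip_side np (wxi : w xi%:C = 0 +i* 0) z'0; rewrite -gE // z'E -tE => /(_ (ltW h2)).
by rewrite subr0 nmulr_rlt0 // subr_gt0 ltNge (ltW xit).
Qed.

End Transfer.

Theorem asymptotic_const_unique (g : C -> C) (c : R) :
  normalized_map n alpha beta g -> asymptotic_const n alpha beta g c -> c = - ln E.
Proof.
move=> [[dg [gfun ginj gsurj]] g0 g1 ginf] [K /near_uhp_infty[r hr]].
have W0 := weight_gt0 ts_pos ts_neq0.
have hw : holo_on H w by move=> z z0; eexists; exact: (cdiff_logsum ts k z0).
have hg : holo_on H g by move=> z z0; apply/derivable_cdiff; exact: dg.
have injw : {in H &, injective w}.
  by move=> x y; rewrite !inE => Hx Hy; exact: (logsum_injective ts_pos ts_neq0).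
have img : w @` H = g @` H.
  rewrite map_image; apply/seteqP; split=> [y /gsurj //|_ [z Hz <-]].
  exact: gfun.
have FF := uhp_infty_filter R.
have df z : H z -> exists2 l, l != 0 & cdiff w z l.
  move=> z0; exists (\sum_(t <- ts) t.1%:C * (z - t.2%:C)^-1).
    exact: (@logsum_derivative_neq0 _ ts ts_pos ts_neq0 z z0).
  exact: (@cdiff_logsum _ ts k z z0).
have fbnd (s : R) : exists M, forall z, 0 < Im z -> cmod z <= s -> Re (w z) <= M.
  exists (\sum_(t <- ts) t.1 * (s + `|t.2|) + Re k) => z _.
  exact: (Re_logsum_upper k ts_pos).
have gbig (M : R) : exists s, forall z, 0 < Im z -> s < cmod z -> M < Re (g z).
  exact: ((near_uhp_infty _).1 (cvgry_gtr ginf (num_real M))).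
have asw : log_asymptotic w (weight ts) k.
  exists (weight ts * 4), 2 => z z0 /ltW z2.
  exact: (logsum_asymptotic k ts_pos ts01).
have asg : log_asymptotic g (weight ts) (c +i* - (beta * pi)).
  by exists K, r => z z0 zr; rewrite weightE; exact: hr.
have [b gE] := uhp_automorphism_affine W0 hw hg injw ginj df img fbnd gbig asw asg (erefl _).
have la0 := expR_gt0 ((Re (c +i* - (beta * pi)) - Re k) / weight ts).
have t0 := transfer_0 la0 gE g0; have t1 := transfer_1 la0 gE g1.
(* The affine map fixes 0 and 1, so its slope is 1; the logarithm of the slope is (c + ln E) divided
   by the weight. *)
have la1 : expR ((Re (c +i* - (beta * pi)) - Re k) / weight ts) = expR 0.
  by rewrite expR0; move: t0 t1; set la := expR _; lra.
have /eqP := expR_inj la1; rewrite mulf_eq0 invr_eq0 (gt_eqF W0) orbF subr_eq0.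
by move/eqP.
Qed.

End ConformalMap.

Theorem theorem1p1 (R : realType) (k1 l1 k2 l2 : nat)
    (h1 : (l1 <= k1)%N) (h2 : (l2 <= k2)%N) :
  ln (Lambda R k1 l1 k2 l2) =
  conf_const (l1 + l2) ((k1%:R - l1%:R) / 2 : R) ((k2%:R - l2%:R) / 2 : R).
Proof.
rewrite -!natrB //; set p := (k1 - l1)%N; set q := (k2 - l2)%N.
have [xs [E E0 [sz xs_in bnd tips]]] := extremal_zeros
  (@sqrt_weight_continuous R p q) (@sqrt_weight_ge0 R p q) (@sqrt_weight_gt0 R p q) (l1 + l2).
rewrite /Lambda (min_deviationE h1 h2 E0 sz bnd tips) lnV ?posrE //.
rewrite -sz /conf_const !half_nat_eq0; case: ifPn => [/and3P[n0 /eqP p0 /eqP q0]|nd].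
  (* Degenerate case: no zeros and a constant weight, so E = 1 and - ln E is the conventional value
     0. *)
  have [s _ [_ _ <-]] := tips [::] xs erefl.
  move: n0; rewrite size_eq0 => /eqP ->.
  by rewrite /wprod /sqrt_weight p0 q0 /zero_prod big_nil !expr0 !mulr1 normr1 ln1 oppr0.
(* Whatever constant is selected equals - ln E by uniqueness; the explicit logarithmic sum shows
   that the set of candidates is nonempty. *)
case: xgetP => [c _ [g [ng ag]]|none].
  exact/esym/(asymptotic_const_unique E0 xs_in bnd tips nd ng ag).
have [] := none (- ln E); exists (logsum (map_terms p q xs) (map_cst q E)).
split; first exact: logsum_normalized E0 xs_in bnd tips nd.
by apply: logsum_asymptotic_const.
Qed.
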